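(* Let $i\in\mathbb{S}$ and $a\in\mathbb{D}_i$, and let $T_a$ be the slice hyperholomorphic Möbius transformation associated with $a$. If $f\in\mathrm{BMOSH}(\mathbb{D})$, then $f\circ_iT_a\in\mathrm{BMOSH}(\mathbb{D})$.
   Context: Let $\mathbb{H}$ be the quaternions, $\mathbb{S}=\{x\in\mathbb{H}:\mathrm{Re}(x)=0,|x|=1\}$, $\mathbb{C}_i=\{x_0+ix_1:x_0,x_1\in\mathbb{R}\}$ for $i\in\mathbb{S}$, $\mathbb{D}$ the open unit ball of $\mathbb{H}$, $\mathbb{D}_i=\mathbb{D}\cap\mathbb{C}_i$. Every $x\in\mathbb{H}$ is written $x=x_0+i_xx_1$ with $x_0=\mathrm{Re}(x)$, $x_1=|\mathrm{Im}(x)|\ge 0$, $i_x\in\mathbb{S}$. A real differentiable $f:\mathbb{D}\to\mathbb{H}$ is (left) slice hyperholomorphic, $f\in\mathcal{SH}_L(\mathbb{D})$, if $f(x)=\alpha(x_0,x_1)+i_x\beta(x_0,x_1)$ for all $x\in\mathbb{D}$, where the $\mathbb{H}$-valued functions $\alpha,\beta$ satisfy $\alpha(x_0,-x_1)=\alpha(x_0,x_1)$, $\beta(x_0,-x_1)=-\beta(x_0,x_1)$, $\partial_{x_0}\alpha=\partial_{x_1}\beta$, $\partial_{x_0}\beta=-\partial_{x_1}\alpha$. For $g:\mathbb{D}_i\to\mathbb{H}$ with $\partial_{x_0}g+i\,\partial_{x_1}g=0$, $\mathrm{ext}(g)$ is the unique slice hyperholomorphic function on $\mathbb{D}$ whose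 restriction to $\mathbb{D}_i$ is $g$; explicitly $\mathrm{ext}(g)(x)=\frac12(1-i_xi)g(x_0+ix_1)+\frac12(1+i_xi)g(x_0-ix_1)$. For $f\in\mathcal{SH}_L(\mathbb{D})$ write $f_i=f|_{\mathbb{D}_i}$. For $f,g\in\mathcal{SH}_L(\mathbb{D})$ with $g(\mathbb{D}_i)\subset\mathbb{D}_i$, the $i$-composition is $f\circ_ig=\mathrm{ext}(f_i\circ g_i)$. For $a\in\mathbb{D}_i$, the slice hyperholomorphic Möbius transformation is $T_a=\mathrm{ext}(T_{a,\mathbb{C}})$, where $T_{a,\mathbb{C}}(z)=(z+a)/(1+\overline{a}z)$ for $z\in\mathbb{D}_i$; thus $f\circ_iT_a=\mathrm{ext}(f_i\circ T_{a,\mathbb{C}})$. $\mathcal{H}^2(\mathbb{D})$ is the set of $f\in\mathcal{SH}_L(\mathbb{D})$ with $\sup_{i\in\mathbb{S}}\lim_{r\nearrow1}\frac1{2\pi}\int_0^{2\pi}|f(re^{i\theta})|^2\,d\theta<\infty$; boundary values $f(e^{i\theta})$ are radial limits (existing for almost every $\theta$). For $f\in\mathcal{H}^2(\mathbb{D})$, $i\in\mathbb{S}$ and an interval $I=(\alpha,\beta)\subset\mathbb{R}$ with $|I|=\beta-\alpha\le2\pi$, let $f_{I,i}=\frac1{|I|}\int_If(e^{i\theta})\,d\theta$, and put $|f|_{\mathrm{BMOSH}(\mathbb{D}_i)}^2=\sup_{|I|\le2\pi}\frac1{|I|}\int_I|f(e^{i\theta})-f_{I,i}|^2\,d\theta$,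 $|f|_{\mathrm{BMOSH}(\mathbb{D})}=\sup_{i\in\mathbb{S}}|f|_{\mathrm{BMOSH}(\mathbb{D}_i)}$. $\mathrm{BMOSH}(\mathbb{D})$ is the set of $f\in\mathcal{H}^2(\mathbb{D})$ with $|f|_{\mathrm{BMOSH}(\mathbb{D})}<\infty$. *)

(* Defs.v *)
From HB Require Import structures.
From mathcomp Require Import all_boot all_order all_algebra.
From mathcomp Require Import all_classical all_reals all_analysis.
From mathcomp Require Import ring lra.
Set Implicit Arguments.
Unset Strict Implicit.
Unset Printing Implicit Defensive.
Import Order.TTheory GRing.Theory Num.Theory.
Import numFieldTopology.Exports numFieldNormedType.Exports.
Local Open Scope classical_set_scope.
Local Open Scope ring_scope.

(* A quaternion a + b e1 + c e2 + d e3 is the row (a, b, c, d).  The topology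
   and the real normed space structure are those of 'rV[R]_4; in particular the
   library norm `|x| is the sup norm, whereas the quaternionic modulus is
   [qnorm x].  The two norms are equivalent, so limits and differentiability
   do not depend on the choice. *)
Definition quat (R : realType) : Type := 'rV[R]_4.

HB.instance Definition _ (R : realType) :=
  NormedModule.copy (quat R) 'rV[R]_4.
HB.instance Definition _ (R : realType) := Complete.copy (quat R) 'rV[R]_4.
HB.instance Definition _ (R : realType) := Pointed.copy (quat R) 'rV[R]_4.

Section Quaternion.
Variable R : realType.
Implicit Types x y z : quat R.

Definition mkq (a b c d : R) : quat R := \row_(k < 4) [:: a; b; c; d]`_k.

Definition q0 x : R := x ord0 (@Ordinal 4 0 isT).
Definition q1 x : R := x ord0 (@Ordinal 4 1 isT).
Definition q2 x : R := x ord0 (@Ordinal 4 2 isT).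
Definition q3 x : R := x ord0 (@Ordinal 4 3 isT).

Lemma q0E a b c d : q0 (mkq a b c d) = a. Proof. by rewrite /q0 mxE. Qed.
Lemma q1E a b c d : q1 (mkq a b c d) = b. Proof. by rewrite /q1 mxE. Qed.
Lemma q2E a b c d : q2 (mkq a b c d) = c. Proof. by rewrite /q2 mxE. Qed.
Lemma q3E a b c d : q3 (mkq a b c d) = d. Proof. by rewrite /q3 mxE. Qed.
Definition qE := (q0E, q1E, q2E, q3E).

Lemma quatP x y :
  q0 x = q0 y -> q1 x = q1 y -> q2 x = q2 y -> q3 x = q3 y -> x = y.
Proof.
move=> h0 h1 h2 h3; apply/rowP => -[[|[|[|[|//]]]] k4];
  rewrite (bool_irrelevance k4 isT).
- exact: h0.
- exact: h1.
- exact: h2.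
- exact: h3.
Qed.

Lemma mkq_eta x : x = mkq (q0 x) (q1 x) (q2 x) (q3 x).
Proof. by apply: quatP; rewrite qE. Qed.

Lemma q0D x y : q0 (x + y) = q0 x + q0 y. Proof. by rewrite /q0 mxE. Qed.
Lemma q1D x y : q1 (x + y) = q1 x + q1 y. Proof. by rewrite /q1 mxE. Qed.
Lemma q2D x y : q2 (x + y) = q2 x + q2 y. Proof. by rewrite /q2 mxE. Qed.
Lemma q3D x y : q3 (x + y) = q3 x + q3 y. Proof. by rewrite /q3 mxE. Qed.
Definition qD := (q0D, q1D, q2D, q3D).

Lemma q0Z (r : R) x : q0 (r *: x) = r * q0 x. Proof. by rewrite /q0 mxE. Qed.
Lemma q1Z (r : R) x : q1 (r *: x) = r * q1 x. Proof. by rewrite /q1 mxE. Qed.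
Lemma q2Z (r : R) x : q2 (r *: x) = r * q2 x. Proof. by rewrite /q2 mxE. Qed.
Lemma q3Z (r : R) x : q3 (r *: x) = r * q3 x. Proof. by rewrite /q3 mxE. Qed.
Definition qZ := (q0Z, q1Z, q2Z, q3Z).

Definition qone : quat R := mkq 1 0 0 0.

Definition qmul x y : quat R :=
  mkq (q0 x * q0 y - q1 x * q1 y - q2 x * q2 y - q3 x * q3 y)
      (q0 x * q1 y + q1 x * q0 y + q2 x * q3 y - q3 x * q2 y)
      (q0 x * q2 y - q1 x * q3 y + q2 x * q0 y + q3 x * q1 y)
      (q0 x * q3 y + q1 x * q2 y - q2 x * q1 y + q3 x * q0 y).

Definition qconj x : quat R := mkq (q0 x) (- q1 x) (- q2 x) (- q3 x).

Definition qsqnorm x : R := q0 x ^+ 2 + q1 x ^+ 2 + q2 x ^+ 2 + q3 x ^+ 2.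

Definition qnorm x : R := Num.sqrt (qsqnorm x).

Definition qinv x : quat R := (qsqnorm x)^-1 *: qconj x.

Lemma qmulA : associative qmul.
Proof. by move=> x y z; apply: quatP; rewrite !qE; ring. Qed.
Lemma qmul1 : left_id qone qmul.
Proof. by move=> x; apply: quatP; rewrite !qE; ring. Qed.
Lemma qmulr1 : right_id qone qmul.
Proof. by move=> x; apply: quatP; rewrite !qE; ring. Qed.
Lemma qmulDl : left_distributive qmul +%R.
Proof. by move=> x y z; apply: quatP; rewrite !(qE, qD); ring. Qed.
Lemma qmulDr : right_distributive qmul +%R.
Proof. by move=> x y z; apply: quatP; rewrite !(qE, qD); ring. Qed.
Lemma qone_neq0 : qone != 0.
Proof.
apply/eqP => /(congr1 q0); rewrite qE /q0 mxE => /eqP.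
by rewrite oner_eq0.
Qed.

Lemma qsqnorm_eq0 x : (qsqnorm x == 0) = (x == 0).
Proof.
apply/idP/eqP => [|->]; last first.
  by rewrite /qsqnorm /q0 /q1 /q2 /q3 !mxE expr0n /= !addr0.
rewrite /qsqnorm !paddr_eq0 ?addr_ge0 ?sqr_ge0// !sqrf_eq0.
move=> /andP[/andP[/andP[/eqP h0 /eqP h1] /eqP h2] /eqP h3].
by apply: quatP; rewrite ?h0 ?h1 ?h2 ?h3 /q0 /q1 /q2 /q3 mxE.
Qed.

Lemma qmulV x : x != 0 -> qmul (qinv x) x = qone.
Proof.
rewrite -qsqnorm_eq0 => x0; apply: quatP; rewrite !(qE, qZ);
  rewrite /qsqnorm in x0 *; field => //.
Qed.

Lemma qmulrV x : x != 0 -> qmul x (qinv x) = qone.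
Proof.
rewrite -qsqnorm_eq0 => x0; apply: quatP; rewrite !(qE, qZ);
  rewrite /qsqnorm in x0 *; field => //.
Qed.

Lemma qinv0 : qinv 0 = 0.
Proof.
by apply: quatP; rewrite !qZ !qE /q0 /q1 /q2 /q3 !mxE ?oppr0 mulr0.
Qed.

End Quaternion.

HB.instance Definition _ (R : realType) :=
  GRing.Zmodule_isNzRing.Build (quat R)
    (@qmulA R) (@qmul1 R) (@qmulr1 R) (@qmulDl R) (@qmulDr R) (@qone_neq0 R).

Section QuaternionAlgebra.
Variable R : realType.
Implicit Types x y : quat R.

Let qunit : pred (quat R) := fun x => x != 0.

Let qmulVx : {in qunit, left_inverse 1 (@qinv R) *%R}.
Proof. by move=> x x0; exact: qmulV. Qed.
Let qmulxV : {in qunit, right_inverse 1 (@qinv R) *%R}.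
Proof. by move=> x x0; exact: qmulrV. Qed.
Let qunitP x y : y * x = 1 /\ x * y = 1 -> qunit x.
Proof.
move=> [yx1 _]; apply/eqP => x0; move: yx1; rewrite x0 mulr0 => /eqP.
by rewrite eq_sym oner_eq0.
Qed.
Let qinv_out : {in [predC qunit], @qinv R =1 id}.
Proof. by move=> x; rewrite inE /= negbK => /eqP ->; exact: qinv0. Qed.

HB.instance Definition _ :=
  GRing.NzRing_hasMulInverse.Build (quat R) qmulVx qmulxV qunitP qinv_out.

Let qscalerAl (r : R) x y : r *: (x * y) = (r *: x) * y.
Proof. by apply: quatP; rewrite !(qE, qZ); ring. Qed.
HB.instance Definition _ :=
  GRing.Lmodule_isLalgebra.Build R (quat R) qscalerAl.

Let qscalerAr (r : R) x y : r *: (x * y) = x * (r *: y).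
Proof. by apply: quatP; rewrite !(qE, qZ); ring. Qed.
HB.instance Definition _ :=
  GRing.Lalgebra_isAlgebra.Build R (quat R) qscalerAr.

End QuaternionAlgebra.

Section SliceHyperholomorphic.
Variable R : realType.
Local Notation H := (quat R).
Local Notation mu := (@lebesgue_measure R).
Implicit Types (i j x z a : H) (f g : H -> H).

Definition Sph : set H := [set i | q0 i = 0 /\ qnorm i = 1].

Definition Ci i : set H := [set x | exists u v : R, x = u%:A + v *: i].

Definition Dball : set H := [set x | qnorm x < 1].

Definition Di i : set H := Dball `&` Ci i.

(* x = (rpart x)%:A + ipart x *: iunit x with ipart x >= 0 and iunit x in Sph.
   For real x the unit i_x may be any element of Sph; we take e1, and this
   choice is immaterial in [SHL] (where beta u 0 = 0) and in [ext]. *)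
Definition rpart x : R := q0 x.
Definition ipart x : R := qnorm (x - (rpart x)%:A).
Definition iunit x : H :=
  if ipart x == 0 then mkq 0 1 0 0 else (ipart x)^-1 *: (x - (rpart x)%:A).

(* Functions on Dball are total functions of which only the values on Dball
   matter. *)
Definition SHL : set (H -> H) := [set f |
  (forall x, Dball x -> differentiable f x) /\
  exists alpha beta : R -> R -> H,
    (forall x, Dball x ->
       f x = alpha (rpart x) (ipart x) + iunit x * beta (rpart x) (ipart x)) /\
    (forall u v : R, u ^+ 2 + v ^+ 2 < 1 ->
      [/\ alpha u (- v) = alpha u v,
          beta u (- v) = - beta u v,
          derivable (alpha^~ v) u 1 /\ derivable (alpha u) v 1,
          derivable (beta^~ v) u 1 /\ derivable (beta u) v 1 &
          'D_1 (alpha^~ v) u = 'D_1 (beta u) v /\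
          'D_1 (beta^~ v) u = - 'D_1 (alpha u) v])].

Definition ext i g : H -> H := fun x =>
  2^-1 *: ((1 - iunit x * i) * g ((rpart x)%:A + ipart x *: i)) +
  2^-1 *: ((1 + iunit x * i) * g ((rpart x)%:A - ipart x *: i)).

Definition icomp i f g : H -> H := ext i (f \o g).

(* Applied only to z and a in the same commutative plane Ci i, so the side of
   the quotient does not matter. *)
Definition moebiusC a : H -> H := fun z => (z + a) / (1 + qconj a * z).

Definition moebius i a : H -> H := ext i (moebiusC a).

Definition qcis j (t : R) : H := (cos t)%:A + sin t *: j.

Definition sqmean f j (r : R) : \bar R :=
  ((2 * pi)^-1%:E *
   \int[mu]_(t in `[0%R, (2 * pi)%R]) ((qnorm (f (r *: qcis j t))) ^+ 2)%:E)%E.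

(* For f in SHL the mean is nondecreasing in r, so the limit always exists in
   [0, +oo]. *)
Definition Hardy2 : set (H -> H) := [set f | SHL f /\
  (ereal_sup [set lim (sqmean f j r @[r --> 1^'-]) | j in Sph] < +oo)%E].

(* Radial limit f(e^{jt}) (a junk value where the limit does not exist). *)
Definition bdry f j (t : R) : H := lim (f (r *: qcis j t) @[r --> 1^'-]).

(* f_{I,j} for I = (al, be); the H-valued integral is taken coordinatewise. *)
Definition bmean f j (al be : R) : H :=
  (be - al)^-1 *: (\row_(k < 4) \int[mu]_(t in `]al, be[) (bdry f j t ord0 k) : H).

Definition bosc f j (al be : R) : \bar R :=
  ((be - al)^-1%:E *
   \int[mu]_(t in `]al, be[)
     ((qnorm (bdry f j t - bmean f j al be)) ^+ 2)%:E)%E.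

Definition bmo_slice f j : \bar R :=
  sqrte (ereal_sup [set bosc f j I.1 I.2 |
    I in [set I : R * R | I.1 < I.2 /\ I.2 - I.1 <= 2 * pi]]).

Definition bmo_norm f : \bar R := ereal_sup [set bmo_slice f j | j in Sph].

Definition BMOSH : set (H -> H) :=
  [set f | Hardy2 f /\ (bmo_norm f < +oo)%E].

End SliceHyperholomorphic.

(* Main.v *)
(* On the slice of [i], [f] is a function F of a disc variable all of whose four real
   components are real parts of holomorphic functions.  Square-integrable circle means
   give each component a boundary function, of which it is the Poisson integral, and at
   Lebesgue points it has nontangential limits.  The Moebius map T of the disc preserves
   nontangential approach and acts on the circle as e^{it} |-> e^{i tau(t)} with tau
   bi-Lipschitz and tau(t + 2 pi) = tau(t) + 2 pi.  Hence on the slice of [j] the composition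
   has boundary values
     1/2 (1 - j i) Phi(tau t) + 1/2 (1 + j i) Phi(tau (- t)),
   where Phi is the boundary function of F.  Changing variables by tau maps an interval of
   length at most 2 pi to another one of comparable length at most 2 pi, which bounds the
   mean oscillation uniformly in [j]; the circle means are bounded by Jensen's inequality
   for the Poisson kernel. *)
From HB Require Import structures.
Require Import Defs.
From mathcomp Require Import all_boot all_order all_algebra.
From mathcomp Require Import all_classical all_reals all_analysis.
From mathcomp Require Import measurable_realfun ring lra.
Set Implicit Arguments.
Unset Strict Implicit.
Unset Printing Implicit Defensive.
Import Order.TTheory GRing.Theory Num.Theory.
Import numFieldTopology.Exports numFieldNormedType.Exports.
Local Open Scope classical_set_scope.
Local Open Scope ring_scope.


(** * Goursat's lemma and the Poisson formula in the disc *)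

Section ContinuousIntegral.
Variable R : realType.
Local Notation mu := (@lebesgue_measure R).
Implicit Types (a b c : R) (k : R -> R).

(** Slice hyperholomorphy gives real differentiability of f and existence of the partial derivatives
    of alpha and beta, but no continuity of derivatives; closed forms are therefore integrated by
    Goursat's bisection instead of Green's formula. Radial limits are not enough for the
    composition, because T in general carries a radius to a curve that is not a radius; that curve
    stays in a nontangential region whose aperture depends on a alone. With da = 1 - |a|^2 one has
    da/4 <= tau' <= 4/da, and the oscillation is multiplied by a constant times (4/da)^2: one factor
    4/da is the density of the change of variables, the other the growth of the interval. Image
    intervals have length at most 2 pi by monotonicity and periodicity of tau, since the Lipschitz
    bound alone would not give it. Uniformity in j comes from |j i| = 1 in the representation
    formula. Radial limits are total functions with junk values on a null set, so integrals of them
    are compared by almost everywhere domination without assuming measurability. *)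

Definition contin a b k := forall x, a <= x <= b -> {for x, continuous k}.

Lemma contin_within a b k : contin a b k -> {within `[a, b], continuous k}.
Proof.
move=> ck; apply: continuous_in_subspaceT => x; rewrite inE/= in_itv/= => xab.
exact: ck.
Qed.

Lemma contin_integrable a b k : contin a b k ->
  mu.-integrable `[a, b] (EFin \o k).
Proof.
move=> /contin_within ck.
by apply: continuous_compact_integrable => //; exact: segment_compact.
Qed.

Lemma contin_cst a b r : contin a b (cst r).
Proof. by move=> x _; exact: cst_continuous. Qed.

Lemma continM a b k l : contin a b k -> contin a b l -> contin a b (k \* l).
Proof. by move=> ck cl x xab; apply: continuousM; [exact: ck|exact: cl]. Qed.

Lemma continB a b k l : contin a b k -> contin a b l -> contin a b (k \- l).
Proof. by move=> ck cl x xab; apply: continuousB; [exact: ck|exact: cl]. Qed.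

Lemma Rintegral_itv_cst a b r : a <= b -> \int[mu]_(x in `[a, b]) r = r * (b - a).
Proof.
move=> ab; rewrite Rintegral_cst//; congr (_ * _).
have /(congr1 fine) E := lebesgue_measure_itv `[a, b].
apply: (etrans E); rewrite /= lte_fin.
by case: ltgtP ab => // -> _; rewrite subrr.
Qed.

Lemma Rintegral_split a c b k : a <= c -> c <= b -> contin a b k ->
  \int[mu]_(x in `[a, b]) k x =
  \int[mu]_(x in `[a, c]) k x + \int[mu]_(x in `[c, b]) k x.
Proof.
move=> ac cb ck.
have /eqP := @Rintegral_itvB R k (BLeft a) (BRight b) c (contin_integrable ck) ac cb.
rewrite subr_eq addrC => /eqP ->; congr +%R.
apply: Rintegral_itv_obnd_cbnd.
apply: (@integrableS _ _ _ mu `[a, b]) => //; last exact: contin_integrable.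
by apply: subset_itvr; rewrite bnd_simp.
Qed.

Lemma Rintegral_le_cst a b r k M : a <= b -> contin a b k ->
  (forall x, a <= x <= b -> `|k x - r| <= M) ->
  `|\int[mu]_(x in `[a, b]) k x - r * (b - a)| <= M * (b - a).
Proof.
move=> ab ck kM.
rewrite -!Rintegral_itv_cst// -RintegralB//; last 2 first.
- exact: contin_integrable.
- exact: (contin_integrable (@contin_cst a b r)).
have ckr := continB ck (@contin_cst a b r).
apply: (le_trans (le_normr_Rintegral _ (contin_integrable ckr))) => //.
apply: le_Rintegral => //.
- apply: (@contin_integrable _ _ (fun x => `|k x - r|)) => x xab.
  by apply: (@continuous_comp _ _ _ (k \- cst r) Num.norm); [exact: ckr|exact: norm_continuous].
- exact: (contin_integrable (@contin_cst a b M)).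
Qed.

End ContinuousIntegral.

(** * Closed forms on a rectangle: Goursat's bisection *)

Section Goursat.
Variable R : realType.
Local Notation mu := (@lebesgue_measure R).
Implicit Types (A P Q : R * R -> R) (p q : R * R) (a b c d : R).

(** Total differentiability at the single point p with gradient (a, b); nothing is said about
    continuity of the partial derivatives. *)
Definition hasgrad A p a b := is_diff p A (fun h => a * h.1 + b * h.2).

Lemma hasgrad_eps A p a b (e : R) : hasgrad A p a b -> 0 < e ->
  exists2 del : R, 0 < del & forall s t, `|s - p.1| < del -> `|t - p.2| < del ->
    `|A (s, t) - A p - (a * (s - p.1) + b * (t - p.2))|
      <= e * (`|s - p.1| + `|t - p.2|).
Proof.
move=> [dA dAE] e0; have [_] := (diff_locallyP p A).1 dA.
rewrite dAE => /eqaddoP /(_ _ e0) /nbhs_ballP[del/= del0 H].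
exists del => // s t sp tp.
have /= := H (s - p.1, t - p.2).
rewrite !fctE /shift/= => /(_ _)/le_trans H'.
have -> : (s, t) = ((s - p.1, t - p.2) + p).
  by case: p {H H' dA dAE} sp tp => u v /= _ _; congr pair; rewrite subrK.
rewrite -[X in `|X|]addrA -opprD; apply: H'.
  split => /=; rewrite /ball/= sub0r normrN//.
rewrite ler_wpM2l ?(ltW e0)//= prod_normE/= ge_max.
by rewrite lerDl lerDr !normr_ge0.
Qed.

Lemma hasgrad_continuous A p a b : hasgrad A p a b -> {for p, continuous A}.
Proof. by move=> [dA _]; exact: differentiable_continuous. Qed.

Lemma continuous_pair_l A (s t : R) : {for (s, t), continuous A} ->
  {for t, continuous (fun y => A (s, y))}.
Proof.
move=> cA; apply: (@continuous_comp _ _ _ (fun y => (s, y)) A) => //.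
exact: (cvg_pair (cvg_cst s) cvg_id).
Qed.

Lemma continuous_pair_r A (s t : R) : {for (s, t), continuous A} ->
  {for s, continuous (fun x => A (x, t))}.
Proof.
move=> cA; apply: (@continuous_comp _ _ _ (fun x => (x, t)) A) => //.
exact: (cvg_pair cvg_id (cvg_cst t)).
Qed.

(** The integral of P ds + Q dt counterclockwise along the boundary of the rectangle [a, b] x
    [c, d]. *)
Definition circulation P Q a b c d : R :=
  \int[mu]_(t in `[c, d]) Q (b, t) - \int[mu]_(t in `[c, d]) Q (a, t)
  - (\int[mu]_(s in `[a, b]) P (s, d) - \int[mu]_(s in `[a, b]) P (s, c)).

Section closed_form.
Variables (P Q : R * R -> R) (a0 b0 c0 d0 : R).
Hypothesis closedPQ : forall s t, a0 <= s <= b0 -> c0 <= t <= d0 ->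
  exists ps r qt, hasgrad P (s, t) ps r /\ hasgrad Q (s, t) r qt.

Let inR a b c d := [/\ a0 <= a, a <= b, b <= b0, c0 <= c & c <= d /\ d <= d0].

Let cQ s a b c d : inR a b c d -> a <= s <= b -> contin c d (fun t => Q (s, t)).
Proof.
move=> [a1 ab b1 c1 [cd d1]] /andP[as_ sb] t /andP[ct td].
have [||? [r] [? [_ /hasgrad_continuous]]] := @closedPQ s t.
- by rewrite (le_trans a1)//= (le_trans sb).
- by rewrite (le_trans c1)//= (le_trans td).
by move=> h; exact: continuous_pair_l h.
Qed.

Let cP t a b c d : inR a b c d -> c <= t <= d -> contin a b (fun s => P (s, t)).
Proof.
move=> [a1 ab b1 c1 [cd d1]] /andP[ct td] s /andP[as_ sb].
have [||? [r] [? [/hasgrad_continuous + _]]] := @closedPQ s t.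
- by rewrite (le_trans a1)//= (le_trans sb).
- by rewrite (le_trans c1)//= (le_trans td).
by move=> h; exact: continuous_pair_r h.
Qed.

Let circ_split_s a m b c d : inR a b c d -> a <= m <= b ->
  circulation P Q a b c d = circulation P Q a m c d + circulation P Q m b c d.
Proof.
move=> I /andP[am mb]; rewrite /circulation.
have [a1 ab b1 c1 [cd d1]] := I.
have Pc : contin a b (fun s => P (s, c)) by apply: (cP I); rewrite lexx cd.
have Pd : contin a b (fun s => P (s, d)) by apply: (cP I); rewrite lexx cd.
rewrite (Rintegral_split am mb Pc) (Rintegral_split am mb Pd).
by ring.
Qed.

Let circ_split_t a b c m d : inR a b c d -> c <= m <= d ->
  circulation P Q a b c d = circulation P Q a b c m + circulation P Q a b m d.
Proof.
move=> I /andP[cm md]; rewrite /circulation.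
have [a1 ab b1 c1 [cd d1]] := I.
have Qa : contin c d (fun t => Q (a, t)) by apply: (cQ I); rewrite lexx ab.
have Qb : contin c d (fun t => Q (b, t)) by apply: (cQ I); rewrite lexx ab.
rewrite (Rintegral_split cm md Qa) (Rintegral_split cm md Qb).
by ring.
Qed.

(** The common partial derivative r = P_t = Q_s contributes r (b - a) (d - c) to both differences
    and cancels. What is left are the first-order remainders, at most e / 2 times the half perimeter
    w under each integral; a difference of two values collects two remainders, whence the tolerance
    e / 4. *)
Let circ_small (s t e : R) : a0 <= s <= b0 -> c0 <= t <= d0 -> 0 < e ->
  exists2 del : R, 0 < del & forall a b c d, inR a b c d ->
    a <= s <= b -> c <= t <= d -> b - a < del -> d - c < del ->
    `|circulation P Q a b c d| <= e * ((b - a) + (d - c)) ^+ 2.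
Proof.
move=> sI tI e0; have [ps [r [qt [gP gQ]]]] := closedPQ sI tI.
have e40 : 0 < e / 4 by rewrite divr_gt0.
have [dP dP0 HP] := hasgrad_eps gP e40.
have [dQ dQ0 HQ] := hasgrad_eps gQ e40.
exists (Num.min dP dQ); first by rewrite lt_min dP0.
move=> a b c d I /andP[as_ sb] /andP[ct td]; rewrite !lt_min.
move=> /andP[abP abQ] /andP[cdP cdQ].
have [a1 ab b1 c1 [cd d1]] := I.
rewrite /circulation.
have cQa : contin c d (fun t => Q (a, t)) by apply: (cQ I); rewrite lexx ab.
have cQb : contin c d (fun t => Q (b, t)) by apply: (cQ I); rewrite lexx ab.
have cPc : contin a b (fun s => P (s, c)) by apply: (cP I); rewrite lexx cd.
have cPd : contin a b (fun s => P (s, d)) by apply: (cP I); rewrite lexx cd.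
rewrite -RintegralB//; [|exact: contin_integrable cQb|exact: contin_integrable cQa].
rewrite -RintegralB//; [|exact: contin_integrable cPd|exact: contin_integrable cPc].
set w := (b - a) + (d - c).
have HQ' y : c <= y <= d -> `|Q (b, y) - Q (a, y) - r * (b - a)| <= e / 2 * w.
  move=> /andP[cy yd]; rewrite /w.
  have /= := HQ b y; have /= := HQ a y.
  have -> : `|a - s| = s - a by rewrite ler0_norm ?subr_le0// opprB.
  have -> : `|b - s| = b - s by rewrite ger0_norm ?subr_ge0.
  have yt : `|y - t| <= d - c by rewrite ler_norml; apply/andP; split; lra.
  move=> /(_ _ _)h1 /(_ _ _)h2.
  have {}h1 := h1 ltac:(lra) (le_lt_trans yt cdQ).
  have {}h2 := h2 ltac:(lra) (le_lt_trans yt cdQ).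
  pose u1 := Q (a, y) - Q (s, t) - (r * (a - s) + qt * (y - t)).
  pose u2 := Q (b, y) - Q (s, t) - (r * (b - s) + qt * (y - t)).
  rewrite -/u1 -/u2 in h1 h2.
  have -> : Q (b, y) - Q (a, y) - r * (b - a) = u2 - u1 by rewrite /u1 /u2; ring.
  apply: (le_trans (ler_normB _ _)); apply: (le_trans (lerD h2 h1)).
  rewrite -mulrDr; have -> : e / 2 * (b - a + (d - c)) = e / 4 * (2 * (b - a + (d - c))).
    by field.
  by rewrite ler_pM2l//; lra.
have HP' x : a <= x <= b -> `|P (x, d) - P (x, c) - r * (d - c)| <= e / 2 * w.
  move=> /andP[ax xb]; rewrite /w.
  have /= := HP x c; have /= := HP x d.
  have -> : `|c - t| = t - c by rewrite ler0_norm ?subr_le0// opprB.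
  have -> : `|d - t| = d - t by rewrite ger0_norm ?subr_ge0.
  have xs : `|x - s| <= b - a by rewrite ler_norml; apply/andP; split; lra.
  move=> /(_ _ _)h1 /(_ _ _)h2.
  have {}h1 := h1 (le_lt_trans xs abP) ltac:(lra).
  have {}h2 := h2 (le_lt_trans xs abP) ltac:(lra).
  pose u1 := P (x, d) - P (s, t) - (ps * (x - s) + r * (d - t)).
  pose u2 := P (x, c) - P (s, t) - (ps * (x - s) + r * (c - t)).
  rewrite -/u1 -/u2 in h1 h2.
  have -> : P (x, d) - P (x, c) - r * (d - c) = u1 - u2 by rewrite /u1 /u2; ring.
  apply: (le_trans (ler_normB _ _)); apply: (le_trans (lerD h1 h2)).
  rewrite -mulrDr; have -> : e / 2 * (b - a + (d - c)) = e / 4 * (2 * (b - a + (d - c))).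
    by field.
  by rewrite ler_pM2l//; lra.
have KQ := @Rintegral_le_cst _ c d (r * (b - a)) (fun y => Q (b, y) - Q (a, y)) _ cd
  (continB cQb cQa) HQ'.
have KP := @Rintegral_le_cst _ a b (r * (d - c)) (fun x => P (x, d) - P (x, c)) _ ab
  (continB cPd cPc) HP'.
have w0 : 0 <= w by rewrite /w; lra.
set X := Rintegral _ _ _ in KQ *; set Y := Rintegral _ _ _ in KP *.
have -> : X - Y = (X - r * (b - a) * (d - c)) - (Y - r * (d - c) * (b - a)) by ring.
apply: (le_trans (ler_normB _ _)); apply: (le_trans (lerD KQ KP)).
rewrite -mulrDr (_ : d - c + (b - a) = w); last by rewrite /w addrC.
rewrite (_ : e / 2 * w * w = e * w ^+ 2 / 2); last by ring.
have : 0 <= e * w ^+ 2 by rewrite mulr_ge0 ?sqr_ge0// ltW.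
lra.
Qed.

(** The circulations of the four quarters add up to the whole, so one of them carries at least a
    fourth of it. *)
Let quarter (N : R) a b c d : inR a b c d -> 4 * N <= `|circulation P Q a b c d| ->
  exists a' b' c' d', [/\ inR a' b' c' d', a <= a' /\ b' <= b, c <= c' /\ d' <= d,
    b' - a' = (b - a) / 2 /\ d' - c' = (d - c) / 2
    & N <= `|circulation P Q a' b' c' d'|].
Proof.
move=> I; have [a1 ab b1 c1 [cd d1]] := I => H.
pose m := (a + b) / 2; pose n := (c + d) / 2.
have am : a <= m <= b by rewrite /m; apply/andP; split; lra.
have cn : c <= n <= d by rewrite /n; apply/andP; split; lra.
have /andP[am1 am2] := am; have /andP[cn1 cn2] := cn.
have [N1|N1] := leP N `|circulation P Q a m c n|.
  by exists a, m, c, n; split=> //; split=> //; try lra; rewrite /m /n; field.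
have [N2|N2] := leP N `|circulation P Q a m n d|.
  by exists a, m, n, d; split=> //; split=> //; try lra; rewrite /m /n; field.
have [N3|N3] := leP N `|circulation P Q m b c n|.
  by exists m, b, c, n; split=> //; split=> //; try lra; rewrite /m /n; field.
have [N4|N4] := leP N `|circulation P Q m b n d|.
  by exists m, b, n, d; split=> //; split=> //; try lra; rewrite /m /n; field.
exfalso; move: H.
rewrite (circ_split_s I am) (@circ_split_t a m c n d)//; last by split=> //; lra.
rewrite (@circ_split_t m b c n d)//; last by split=> //; lra.
move: N1 N2 N3 N4.
set x1 := circulation _ _ _ _ _ _; set x2 := circulation _ _ _ _ _ _.
set x3 := circulation _ _ _ _ _ _; set x4 := circulation _ _ _ _ _ _.
have := ler_normD (x1 + x2) (x3 + x4).
have := ler_normD x1 x2; have := ler_normD x3 x4.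
lra.
Qed.

(** A circulation of modulus N > 0 would leave at least N / 4^n on the n-th of a sequence of nested
    quarters, while [circ_small] at their common point bounds it by e W^2 / 4^n, where W is the
    initial half perimeter. *)
Theorem goursat : a0 <= b0 -> c0 <= d0 -> circulation P Q a0 b0 c0 d0 = 0.
Proof.
move=> ab0 cd0; apply/eqP; rewrite -normr_le0 leNgt; apply/negP => N0.
set N := `|_| in N0.
pose T := (R * R * (R * R))%type.
pose good (n : nat) (x : T) := inR x.1.1 x.1.2 x.2.1 x.2.2 /\
  N / 4 ^+ n <= `|circulation P Q x.1.1 x.1.2 x.2.1 x.2.2|.
pose step (x y : T) := [/\ x.1.1 <= y.1.1 /\ y.1.2 <= x.1.2,
  x.2.1 <= y.2.1 /\ y.2.2 <= x.2.2 &
  y.1.2 - y.1.1 = (x.1.2 - x.1.1) / 2 /\ y.2.2 - y.2.1 = (x.2.2 - x.2.1) / 2].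
(* The condition [good n x] is a premise inside the existential, so that [choice] returns a total
   successor function. *)
have next n x : exists y, good n x -> good n.+1 y /\ step x y.
  have [[I H]|] := pselect (good n x); last by move=> ng; exists x.
  have [|a' [b' [c' [d' [I' A1 A2 A3 A4]]]]] := @quarter (N / 4 ^+ n.+1) _ _ _ _ I.
    rewrite (_ : 4 * (N / 4 ^+ n.+1) = N / 4 ^+ n)//.
    by rewrite exprS; field; rewrite expf_neq0.
  by exists ((a', b'), (c', d')) => _; split; split.
have [nx nxP] := choice (fun nx : nat * T => next nx.1 nx.2).
pose fix x n : T := if n is m.+1 then nx (m, x m) else ((a0, b0), (c0, d0)).
have gx n : good n (x n).
  elim: n => [|n IH]; last by have [] := nxP (n, x n) IH.
  by split => /=; [split|rewrite expr0 divr1].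
have sx n : step (x n) (x n.+1) by have [] := nxP (n, x n) (gx n).
have wid n : (x n).1.2 - (x n).1.1 = (b0 - a0) / 2 ^+ n /\
             (x n).2.2 - (x n).2.1 = (d0 - c0) / 2 ^+ n.
  elim: n => [|n [IH1 IH2]]; first by rewrite expr0 !divr1.
  have [_ _ [-> ->]] := sx n; rewrite IH1 IH2 exprS.
  by split; field; rewrite ?expf_neq0.
have mon1 m n : (m <= n)%N -> (x m).1.1 <= (x n).1.1 /\ (x n).1.2 <= (x m).1.2
    /\ (x m).2.1 <= (x n).2.1 /\ (x n).2.2 <= (x m).2.2.
  elim: n => [|n IH]; first by rewrite leqn0 => /eqP ->.
  rewrite leq_eqVlt => /predU1P[->//|]; rewrite ltnS => /IH[h1 [h2 [h3 h4]]].
  have [[k1 k2] [k3 k4] _] := sx n.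
  by rewrite (le_trans h1 k1) (le_trans k2 h2) (le_trans h3 k3) (le_trans k4 h4).
have gxI n := (gx n).1.
have limP (l r : nat -> R) : (forall m n, (m <= n)%N -> l m <= l n /\ r n <= r m) ->
    (forall n, l n <= r n) -> exists s, forall n, l n <= s <= r n.
  move=> mon lr; exists (sup (range l)) => n; apply/andP; split.
    apply: ub_le_sup; last by exists n.
    by exists (r 0) => _ [m _ <-]; rewrite (le_trans (lr m))//; have [] := mon 0 m isT.
  apply: ge_sup; first by exists (l 0), 0.
  move=> _ [m _ <-]; have [_ H1] := mon n (maxn m n) (leq_maxr _ _).
  have [H2 _] := mon m (maxn m n) (leq_maxl _ _).
  by rewrite (le_trans H2)// (le_trans _ H1).
have [s sP] : exists s, forall n, (x n).1.1 <= s <= (x n).1.2.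
  apply: limP => [m n /mon1[? [? _]]//|n]; by have [] := gxI n.
have [t tP] : exists s, forall n, (x n).2.1 <= s <= (x n).2.2.
  apply: limP => [m n /mon1[_ [_ []]]//|n]; by have [_ _ _ _ []] := gxI n.
pose W := (b0 - a0) + (d0 - c0).
have W0 : 0 <= W by rewrite /W; lra.
(* Chosen so that e W^2 < N; the powers of 4 cancel in the final comparison. *)
pose e := N / (2 * (W ^+ 2 + 1)).
have D0 : 0 < W ^+ 2 + 1 by rewrite ltr_wpDl ?sqr_ge0.
have e0 : 0 < e by rewrite divr_gt0// mulr_gt0.
have [del del0 small] := circ_small (sP 0%N) (tP 0%N) e0.
have [n nP] : exists n, W / 2 ^+ n < del.
  have := @cvg_geometric R W (2^-1); rewrite ger0_norm ?invr_ge0// => /(_ _).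
  move/(_ ltac:(by rewrite invf_lt1 ?ltr1n))/cvgrPdist_lt => /(_ _ del0)[n _ H].
  exists n; have := H n (leqnn n); rewrite sub0r normrN /geometric/= exprVn.
  by apply: le_lt_trans; exact: ler_norm.
have p2 : 0 < 2 ^+ n :> R by rewrite exprn_gt0.
have [w1 w2] := wid n.
have := small _ _ _ _ (gxI n) (sP n) (tP n).
rewrite w1 w2 -mulrDl -/W => /(_ _ _).
have q1 : (b0 - a0) / 2 ^+ n <= W / 2 ^+ n by rewrite ler_pM2r ?invr_gt0// /W; lra.
have q2 : (d0 - c0) / 2 ^+ n <= W / 2 ^+ n by rewrite ler_pM2r ?invr_gt0// /W; lra.
move=> /(_ (le_lt_trans q1 nP) (le_lt_trans q2 nP)) K.
have := le_trans (gx n).2 K.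
rewrite expr_div_n -exprM mulnC exprM (_ : 2 ^+ 2 = 4 :> R); last by rewrite -natrX.
rewrite mulrA ler_pM2r ?invr_gt0 ?exprn_gt0//.
rewrite /e mulrAC ler_pdivlMr ?mulr_gt0// ler_pM2l//.
by have := sqr_ge0 W; lra.
Qed.

End closed_form.
End Goursat.

(** * Calculus of gradients and of Cauchy-Riemann pairs *)

Section Gradient.
Variable R : realType.
Implicit Types (A B C D : R * R -> R) (p : R * R) (a b c d : R).

Lemma hasgrad_val A p a b a' b' : hasgrad A p a b -> a = a' -> b = b' ->
  hasgrad A p a' b'.
Proof. by move=> ? <- <-. Qed.

Lemma hasgrad_cst c p : hasgrad (cst c) p 0 0.
Proof.
apply: (is_diff_eq (is_diff_cst c p)).
by apply/funext => h; rewrite !mul0r addr0.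
Qed.

Lemma hasgrad_fst p : hasgrad fst p 1 0.
Proof.
have E : (fun h : R * R => 1 * h.1 + 0 * h.2) = fst.
  by apply/funext => h; rewrite mul1r mul0r addr0.
pose f : {linear (R * R)%type -> R} := fst.
have cf : continuous f by move=> x; exact: cvg_fst.
rewrite /hasgrad E; apply: DiffDef.
  exact: (@linear_differentiable R _ _ f p cf).
by rewrite (@diff_lin R _ _ f p cf).
Qed.

Lemma hasgrad_snd p : hasgrad snd p 0 1.
Proof.
have E : (fun h : R * R => 0 * h.1 + 1 * h.2) = snd.
  by apply/funext => h; rewrite mul1r mul0r add0r.
pose f : {linear (R * R)%type -> R} := snd.
have cf : continuous f by move=> x; exact: cvg_snd.
rewrite /hasgrad E; apply: DiffDef.
  exact: (@linear_differentiable R _ _ f p cf).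
by rewrite (@diff_lin R _ _ f p cf).
Qed.

Lemma hasgradD A B p a b c d : hasgrad A p a b -> hasgrad B p c d ->
  hasgrad (fun q => A q + B q) p (a + c) (b + d).
Proof.
move=> hA hB; apply: (is_diff_eq (is_diffD hA hB)).
by apply/funext => h; rewrite !fctE/=; ring.
Qed.

Lemma hasgradN A p a b : hasgrad A p a b ->
  hasgrad (fun q => - A q) p (- a) (- b).
Proof.
move=> hA; apply: (is_diff_eq (is_diffN hA)).
by apply/funext => h; rewrite !fctE/=; ring.
Qed.

Lemma hasgradB A B p a b c d : hasgrad A p a b -> hasgrad B p c d ->
  hasgrad (fun q => A q - B q) p (a - c) (b - d).
Proof. by move=> hA /hasgradN; exact: hasgradD. Qed.

Lemma hasgradM A B p a b c d : hasgrad A p a b -> hasgrad B p c d ->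
  hasgrad (fun q => A q * B q) p (A p * c + B p * a) (A p * d + B p * b).
Proof.
move=> hA hB; apply: (is_diff_eq (is_diffM hA hB)).
by apply/funext => h; rewrite !fctE/= /GRing.scale/=; ring.
Qed.

Lemma hasgrad_comp1 A p a b (f : R -> R) l : hasgrad A p a b ->
  is_derive (A p) 1 f l -> hasgrad (fun q => f (A q)) p (l * a) (l * b).
Proof.
move=> hA [df dfl].
have df' : differentiable f (A p) by apply/derivable1_diffP.
apply: (is_diff_eq (is_diff_comp hA (differentiableP df'))).
apply/funext => h /=; rewrite deriv1E//= derive1E dfl /GRing.scale/=; ring.
Qed.

Lemma hasgradV A p a b : A p != 0 -> hasgrad A p a b ->
  hasgrad (fun q => (A q)^-1) p (- (A p) ^- 2 * a) (- (A p) ^- 2 * b).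
Proof.
move=> A0 hA; apply: (hasgrad_comp1 hA).
have := @is_deriveV R id (A p) 1 1 A0; rewrite /GRing.scale/= mulr1; exact.
Qed.

Lemma hasgrad_comp2 A (w1 w2 : R * R -> R) p a b a1 b1 a2 b2 :
  hasgrad A (w1 p, w2 p) a b -> hasgrad w1 p a1 b1 -> hasgrad w2 p a2 b2 ->
  hasgrad (fun q => A (w1 q, w2 q)) p (a * a1 + b * a2) (a * b1 + b * b2).
Proof.
move=> hA h1 h2.
have hw := is_diff_pair h1 h2.
apply: (is_diff_eq (@is_diff_comp _ _ _ _ (fun q => (w1 q, w2 q)) _ A _ p hw hA)).
by apply/funext => h /=; ring.
Qed.

(** A + iB is complex differentiable at p, with derivative a - ib. *)
Definition CR A B p := exists a b, hasgrad A p a b /\ hasgrad B p (- b) a.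

Lemma CR_eq A B A' B' p : A =1 A' -> B =1 B' -> CR A B p -> CR A' B' p.
Proof. by move=> /funext -> /funext ->. Qed.

Lemma CR_rot A B p : CR A B p -> CR B (fun q => - A q) p.
Proof.
move=> [a [b [hA hB]]]; exists (- b), a; split => //.
exact: hasgradN.
Qed.

(** The affine map z |-> (al + i be) z + (ga + i de). *)
Lemma CR_affine (al be ga de : R) p :
  CR (fun q => al * q.1 - be * q.2 + ga) (fun q => be * q.1 + al * q.2 + de) p.
Proof.
exists al, (- be); split.
- apply: hasgrad_val.
  + apply: hasgradD (hasgrad_cst ga p).
    by apply: hasgradB; apply: hasgradM; [exact: (hasgrad_cst al)|exact: hasgrad_fst|
      exact: (hasgrad_cst be)|exact: hasgrad_snd].
  + by rewrite /=; ring.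
  + by rewrite /=; ring.
- apply: hasgrad_val.
  + apply: hasgradD (hasgrad_cst de p).
    by apply: hasgradD; apply: hasgradM; [exact: (hasgrad_cst be)|exact: hasgrad_fst|
      exact: (hasgrad_cst al)|exact: hasgrad_snd].
  + by rewrite /=; ring.
  + by rewrite /=; ring.
Qed.

Lemma CR_mul A B C D p : CR A B p -> CR C D p ->
  CR (fun q => A q * C q - B q * D q) (fun q => A q * D q + B q * C q) p.
Proof.
move=> [a [b [hA hB]]] [c [d [hC hD]]].
eexists; eexists; split; first exact: hasgradB (hasgradM hA hC) (hasgradM hB hD).
by apply: hasgrad_val (hasgradD (hasgradM hA hD) (hasgradM hB hC)) _ _; ring.
Qed.

Lemma CR_inv A B p : A p ^+ 2 + B p ^+ 2 != 0 -> CR A B p ->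
  CR (fun q => A q / (A q ^+ 2 + B q ^+ 2)) (fun q => - B q / (A q ^+ 2 + B q ^+ 2)) p.
Proof.
move=> n0 [a [b [hA hB]]].
have hN := hasgradD (hasgradM hA hA) (hasgradM hB hB).
have n0' : A p * A p + B p * B p != 0 by rewrite -!expr2.
have hV := hasgradV n0' hN.
apply: (@CR_eq (fun q => A q * (A q * A q + B q * B q)^-1)
  (fun q => - B q * (A q * A q + B q * B q)^-1)) => [q|q|]; rewrite ?expr2//.
eexists; eexists; split; first exact: hasgradM hA hV.
by apply: hasgrad_val (hasgradM (hasgradN hB) hV) _ _; field.
Qed.

Lemma CR_comp A B (w1 w2 : R * R -> R) p :
  CR A B (w1 p, w2 p) -> CR w1 w2 p ->
  CR (fun q => A (w1 q, w2 q)) (fun q => B (w1 q, w2 q)) p.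
Proof.
move=> [a [b [hA hB]]] [c [d [h1 h2]]].
eexists; eexists; split; first exact: hasgrad_comp2 hA h1 h2.
by apply: hasgrad_val (hasgrad_comp2 hB h1 h2) _ _; ring.
Qed.

Lemma CR_continuous A B p : CR A B p -> {for p, continuous A} /\ {for p, continuous B}.
Proof. by move=> [a [b [/hasgrad_continuous + /hasgrad_continuous]]]. Qed.

End Gradient.

(** * Cauchy's formula by contraction of the circle to an interior point *)

Section Poisson.
Variable R : realType.
Local Notation mu := (@lebesgue_measure R).
Implicit Types (A B : R * R -> R) (l t : R).

(* The Poisson kernel at $z = u + iv$ and the boundary point $x + iy$. *)
Definition Pk (u v x y : R) : R :=
  (1 - u ^+ 2 - v ^+ 2) / ((x - u) ^+ 2 + (y - v) ^+ 2).

(** For |w| = 1 and m = |z|^2, the product |w - z|^2 |w + z|^2 = (1 + m)^2 - 4 s^2 is at least (1 -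
    m)^2, because s = Re(w conj z) satisfies s^2 <= m; and |w + z|^2 <= 4. *)
Lemma chord_ge (u v x y : R) : u ^+ 2 + v ^+ 2 <= 1 -> x ^+ 2 + y ^+ 2 = 1 ->
  (1 - u ^+ 2 - v ^+ 2) ^+ 2 / 4 <= (x - u) ^+ 2 + (y - v) ^+ 2.
Proof.
move=> uv xy; set m := u ^+ 2 + v ^+ 2; pose s := u * x + v * y.
have sm : s ^+ 2 <= m.
  have : 0 <= (u * y - v * x) ^+ 2 by rewrite sqr_ge0.
  have -> : (u * y - v * x) ^+ 2 = m * (x ^+ 2 + y ^+ 2) - s ^+ 2 by rewrite /m /s; ring.
  by rewrite xy; lra.
have -> : (x - u) ^+ 2 + (y - v) ^+ 2 = 1 + m - 2 * s.
  by transitivity ((x ^+ 2 + y ^+ 2) + m - 2 * s); [rewrite /m /s; ring|rewrite xy].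
have -> : 1 - u ^+ 2 - v ^+ 2 = 1 - m by rewrite /m; ring.
have m0 : 0 <= m by rewrite addr_ge0 ?sqr_ge0.
rewrite -/m in uv.
have s1 : s <= 1 by nra.
have s2 : - 1 <= s by nra.
have H : (1 - m) ^+ 2 <= (1 + m - 2 * s) * (1 + m + 2 * s) by nra.
have X0 : 0 <= 1 + m - 2 * s by have := sqr_ge0 (1 - s); nra.
have : (1 + m - 2 * s) * (1 + m + 2 * s) <= (1 + m - 2 * s) * 4.
  by rewrite ler_wpM2l//; lra.
lra.
Qed.

Lemma chord_gt0 (u v x y : R) : u ^+ 2 + v ^+ 2 < 1 -> x ^+ 2 + y ^+ 2 = 1 ->
  0 < (x - u) ^+ 2 + (y - v) ^+ 2.
Proof.
move=> uv xy; apply: lt_le_trans (chord_ge (ltW uv) xy).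
by rewrite divr_gt0// exprn_gt0//; lra.
Qed.

Lemma Pk_gt0 (u v x y : R) : u ^+ 2 + v ^+ 2 < 1 -> x ^+ 2 + y ^+ 2 = 1 ->
  0 < Pk u v x y.
Proof. by move=> uv xy; rewrite divr_gt0 ?chord_gt0//; lra. Qed.

Section homotopy.
Variables (A B : R * R -> R).
Hypothesis AB : forall x y, x ^+ 2 + y ^+ 2 <= 1 -> CR A B (x, y).
Variables (u v : R).
Hypothesis uv : u ^+ 2 + v ^+ 2 < 1.

Let w1 (q : R * R) := u + q.1 * (cos q.2 - u).
Let w2 (q : R * R) := v + q.1 * (sin q.2 - v).
Let D t := (cos t - u) ^+ 2 + (sin t - v) ^+ 2.

(* $c(\theta) = e^{i\theta} / (e^{i\theta} - z) = c_x + i c_y$ *)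
Definition cauchy_x t := (1 - (u * cos t + v * sin t)) / ((cos t - u) ^+ 2 + (sin t - v) ^+ 2).
Definition cauchy_y t := (v * cos t - u * sin t) / ((cos t - u) ^+ 2 + (sin t - v) ^+ 2).
Local Notation cx := cauchy_x.
Local Notation cy := cauchy_y.

Let D_gt0 t : 0 < D t.
Proof. by apply: chord_gt0; rewrite ?cos2Dsin2. Qed.

Let cosq (p : R * R) : hasgrad (fun q => cos q.2) p 0 (- sin p.2).
Proof.
by apply: hasgrad_val (hasgrad_comp1 (hasgrad_snd p) (is_derive_cos p.2)) _ _; ring.
Qed.

Let sinq (p : R * R) : hasgrad (fun q => sin q.2) p 0 (cos p.2).
Proof.
by apply: hasgrad_val (hasgrad_comp1 (hasgrad_snd p) (is_derive_sin p.2)) _ _; ring.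
Qed.

Let disc l t : 0 <= l <= 1 -> w1 (l, t) ^+ 2 + w2 (l, t) ^+ 2 <= 1.
Proof.
move=> /andP[l0 l1]; rewrite /w1 /w2 /=.
have -> : (u + l * (cos t - u)) ^+ 2 + (v + l * (sin t - v)) ^+ 2 =
  (1 - l) * (u ^+ 2 + v ^+ 2) + l * (cos t ^+ 2 + sin t ^+ 2) - l * (1 - l) * D t.
  by rewrite /D; ring.
rewrite cos2Dsin2; have : 0 <= l * (1 - l) * D t.
  by rewrite mulr_ge0 ?(ltW (D_gt0 _))// mulr_ge0//; lra.
have h1 : 0 <= 1 - l by lra.
have h2 : 0 <= 1 - (u ^+ 2 + v ^+ 2) by have := uv; lra.
have := mulr_ge0 h1 h2.
lra.
Qed.

Let grad_w1 l t : hasgrad w1 (l, t) (cos t - u) (- l * sin t).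
Proof.
apply: hasgrad_val.
- apply: hasgradD (hasgrad_cst u _) _.
  by apply: hasgradM (hasgrad_fst _) (hasgradB (cosq _) (hasgrad_cst u _)).
- by rewrite /=; ring.
- by rewrite /=; ring.
Qed.

Let grad_w2 l t : hasgrad w2 (l, t) (sin t - v) (l * cos t).
Proof.
apply: hasgrad_val.
- apply: hasgradD (hasgrad_cst v _) _.
  by apply: hasgradM (hasgrad_fst _) (hasgradB (sinq _) (hasgrad_cst v _)).
- by rewrite /=; ring.
- by rewrite /=; ring.
Qed.

(* With $w = z + \lambda (e^{i\theta} - z)$ and $h = A + iB$, the form
   $P\,d\lambda + Q\,d\theta$ is the real part of $-i h(w)\,dw / (w - z)$. *)
Let Q (q : R * R) := A (w1 q, w2 q) * cx q.2 - B (w1 q, w2 q) * cy q.2.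
Let P (q : R * R) := q.1^-1 * B (w1 q, w2 q).

Let gradD p : hasgrad (fun q => D q.2) p 0
  (2 * (cos p.2 - u) * - sin p.2 + 2 * (sin p.2 - v) * cos p.2).
Proof.
have h1 := hasgradB (cosq p) (hasgrad_cst u p).
have h2 := hasgradB (sinq p) (hasgrad_cst v p).
have := hasgradD (hasgradM h1 h1) (hasgradM h2 h2).
rewrite (_ : (fun q => _) = (fun q => D q.2)); last first.
  by apply/funext => q; rewrite /D !expr2.
by move=> h; apply: hasgrad_val h _ _; rewrite /=; ring.
Qed.

Let gradcx p : exists d, hasgrad (fun q => cx q.2) p 0 d.
Proof.
have hn := hasgradB (hasgrad_cst 1 p) (hasgradD (hasgradM (hasgrad_cst u p) (cosq p))
  (hasgradM (hasgrad_cst v p) (sinq p))).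
have hV := hasgradV (lt0r_neq0 (D_gt0 p.2)) (gradD p).
eexists; apply: hasgrad_val (hasgradM hn hV) _ erefl.
by rewrite /=; ring.
Qed.

Let gradcy p : exists d, hasgrad (fun q => cy q.2) p 0 d.
Proof.
have hn := hasgradB (hasgradM (hasgrad_cst v p) (cosq p))
  (hasgradM (hasgrad_cst u p) (sinq p)).
have hV := hasgradV (lt0r_neq0 (D_gt0 p.2)) (gradD p).
eexists; apply: hasgrad_val (hasgradM hn hV) _ erefl.
by rewrite /=; ring.
Qed.

(** With [cauchyE2] this is (e^{it} - z) c(t) = e^{it}, which turns the equality of mixed
    derivatives in [closed] into the Cauchy-Riemann equations. *)
Let cauchyE1 t : (cos t - u) * cx t - (sin t - v) * cy t = cos t.
Proof.
have D0 := lt0r_neq0 (D_gt0 t); rewrite /cx /cy -/(D t).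
transitivity ((cos t * D t + (1 - (cos t ^+ 2 + sin t ^+ 2)) * (cos t - u)) / D t).
  by rewrite !mulrA -mulrBl; congr (_ / _); rewrite /D; ring.
by rewrite cos2Dsin2 subrr mul0r addr0 mulfK.
Qed.

Let cauchyE2 t : (sin t - v) * cx t + (cos t - u) * cy t = sin t.
Proof.
have D0 := lt0r_neq0 (D_gt0 t); rewrite /cx /cy -/(D t).
transitivity ((sin t * D t + (1 - (cos t ^+ 2 + sin t ^+ 2)) * (sin t - v)) / D t).
  by rewrite !mulrA -mulrDl; congr (_ / _); rewrite /D; ring.
by rewrite cos2Dsin2 subrr mul0r addr0 mulfK.
Qed.

(** The factor 1 / l in P is singular at l = 0, so closedness is claimed for l > 0; the endpoint l =
    0 is reached by continuity in [homotopy_limit]. *)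
Let closed l t : 0 < l <= 1 ->
  exists ps r qt, hasgrad P (l, t) ps r /\ hasgrad Q (l, t) r qt.
Proof.
move=> /andP[l0 l1].
have [|a [b [hA hB]]] := @AB (w1 (l, t)) (w2 (l, t)); first by rewrite disc ?(ltW l0).
have gA := hasgrad_comp2 hA (grad_w1 l t) (grad_w2 l t).
have gB := hasgrad_comp2 hB (grad_w1 l t) (grad_w2 l t).
have [d1 gx] := gradcx (l, t); have [d2 gy] := gradcy (l, t).
have gV := hasgradV (lt0r_neq0 l0 : fst (l, t) != 0) (hasgrad_fst (l, t)).
eexists; eexists; eexists; split; first exact: hasgradM gV gB.
apply: hasgrad_val (hasgradB (hasgradM gA gx) (hasgradM gB gy)) _ erefl.
transitivity (a * ((cos t - u) * cx t - (sin t - v) * cy t) +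
  b * ((sin t - v) * cx t + (cos t - u) * cy t)); first by rewrite /=; ring.
by rewrite cauchyE1 cauchyE2 /=; field; rewrite lt0r_neq0.
Qed.

Let Q_contin l a b : 0 <= l <= 1 -> contin a b (fun t => Q (l, t)).
Proof.
move=> l01 t _.
have [|a' [b' [hA hB]]] := @AB (w1 (l, t)) (w2 (l, t)); first by rewrite disc.
have gA := hasgrad_comp2 hA (grad_w1 l t) (grad_w2 l t).
have gB := hasgrad_comp2 hB (grad_w1 l t) (grad_w2 l t).
have [d1 gx] := gradcx (l, t); have [d2 gy] := gradcy (l, t).
have /hasgrad_continuous := hasgradB (hasgradM gA gx) (hasgradM gB gy).
by move=> h; exact: continuous_pair_l h.
Qed.

(** Goursat's lemma on [l, 1] x [0, 2 pi]: the integrals of P along the sides t = 0 and t = 2 pi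
    cancel by periodicity of the homotopy. *)
Let Q_int_eq l : 0 < l <= 1 ->
  \int[mu]_(t in `[0, 2 * pi]) Q (1, t) = \int[mu]_(t in `[0, 2 * pi]) Q (l, t).
Proof.
move=> /andP[l0 l1].
have tp : 0 <= 2 * pi :> R by rewrite mulr_ge0 ?pi_ge0.
have := @goursat R P Q l 1 0 (2 * pi) _ l1 tp.
rewrite /circulation [X in _ - X](_ : _ = 0) ?subr0; last first.
  rewrite /P /w1 /w2 /= mulr_natl cos2pi sin2pi cos0 sin0 subrr//.
move=> H; apply/eqP; rewrite -subr_eq0; apply/eqP; apply: H => s t /andP[ls s1] _.
by apply: closed; rewrite (lt_le_trans l0).
Qed.

Let cxy_sqr t : cx t ^+ 2 + cy t ^+ 2 = (D t)^-1.
Proof.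
have D0 := lt0r_neq0 (D_gt0 t).
rewrite /cx /cy -/(D t).
transitivity ((D t + (1 - (cos t ^+ 2 + sin t ^+ 2)) * (1 - u ^+ 2 - v ^+ 2)) / D t ^+ 2).
  by rewrite !expr_div_n -mulrDl; congr (_ / _); rewrite /D; ring.
by rewrite cos2Dsin2 subrr mul0r addr0; field.
Qed.

(** By [Q_int_eq] the integral does not depend on l > 0, and Q(l, t) tends to Q(0, t) uniformly in t
    as l -> 0, since A and B are continuous at z and c is bounded. *)
Lemma homotopy_limit :
  \int[mu]_(t in `[0, 2 * pi]) Q (1, t) = \int[mu]_(t in `[0, 2 * pi]) Q (0, t).
Proof.
have tp : 0 <= 2 * pi :> R by rewrite mulr_ge0 ?pi_ge0.
apply/eqP; rewrite -subr_eq0 -normr_le0; apply/ler_addgt0Pl => e e0; rewrite addr0.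
pose m := 1 - u ^+ 2 - v ^+ 2; have m0 : 0 < m by rewrite /m; have := uv; lra.
(* |c(t)| = 1 / |e^{it} - z| is at most 2 / (1 - |z|^2) by [chord_ge]. *)
pose K := 2 / m.
have K0 : 0 < K by rewrite divr_gt0.
have cK t : `|cx t| <= K /\ `|cy t| <= K.
  have H : cx t ^+ 2 + cy t ^+ 2 <= K ^+ 2.
    rewrite cxy_sqr (_ : K ^+ 2 = (m ^+ 2 / 4)^-1); last first.
      by rewrite /K expr_div_n invf_div -natrX.
    rewrite lef_pV2 ?posrE ?D_gt0 ?divr_gt0 ?exprn_gt0//.
    exact: chord_ge (ltW uv) (cos2Dsin2 t).
  have := sqr_ge0 (cx t); have := sqr_ge0 (cy t).
  by split; rewrite ler_norml; apply/andP; split; nra.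
pose e' := e / (2 * K * (2 * pi) + 1).
have T0 : 0 < 2 * K * (2 * pi) + 1 by have := mulr_ge0 (ltW K0) (pi_ge0 R); lra.
have e'0 : 0 < e' by rewrite divr_gt0.
have uv1 := ltW uv; have [cA cB] := CR_continuous (AB uv1).
have /cvgrPdist_le /(_ _ e'0)/nbhs_ballP[dA dA0 HA] := cA.
have /cvgrPdist_le /(_ _ e'0)/nbhs_ballP[dB dB0 HB] := cB.
(* At parameter l each coordinate of the homotopy is within 2 l of that of z. *)
pose l := Num.min 1 (Num.min dA dB / 3).
have d0 : 0 < Num.min dA dB by rewrite lt_min dA0.
have l0 : 0 < l by rewrite /l lt_min ltr01 divr_gt0.
have l1 : l <= 1 by rewrite /l ge_min lexx.
have ld : 2 * l < Num.min dA dB.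
  have : l <= Num.min dA dB / 3 by rewrite /l ge_min lexx orbT.
  by lra.
rewrite (@Q_int_eq l) ?l0//.
have cQl : contin 0 (2 * pi) (fun t => Q (l, t)) by apply: Q_contin; rewrite l1 (ltW l0).
have cQ0 : contin 0 (2 * pi) (fun t => Q (0, t)) by apply: Q_contin; rewrite lexx ler01.
rewrite -RintegralB//; [|exact: contin_integrable cQl|exact: contin_integrable cQ0].
have := @Rintegral_le_cst R 0 (2 * pi) 0 (fun t => Q (l, t) - Q (0, t)) (e' * (2 * K)) tp.
rewrite mul0r !subr0 => /(_ _ _)H; apply: (le_trans (H _ _)).
- exact: continB.
- move=> t _; rewrite subr0.
  have near0 : `|u - w1 (l, t)| < Num.min dA dB /\ `|v - w2 (l, t)| < Num.min dA dB.
    have := cos_max t; have := sin_max t.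
    rewrite !ler_norml => /andP[s1 s2] /andP[c1 c2].
    have u1 : -1 <= u <= 1 by apply/andP; split; have := uv; nra.
    have v1 : -1 <= v <= 1 by apply/andP; split; have := uv; nra.
    move/andP: u1 => [u1 u1']; move/andP: v1 => [v1 v1'].
    by split; apply: le_lt_trans ld; rewrite /w1 /w2 /= ler_norml; apply/andP; split; nra.
  have [n1 n2] := near0.
  have EA : `|A (u, v) - A (w1 (l, t), w2 (l, t))| <= e'.
    by apply: (HA (_, _)); split; apply: (lt_le_trans _ (_ : Num.min dA dB <= dA));
       rewrite ?ge_min ?lexx.
  have EB : `|B (u, v) - B (w1 (l, t), w2 (l, t))| <= e'.
    by apply: (HB (_, _)); split; apply: (lt_le_trans _ (_ : Num.min dA dB <= dB));
       rewrite ?ge_min ?lexx ?orbT.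
  have [k1 k2] := cK t.
  rewrite /Q /= {3 4}/w1 {3 4}/w2 /= !mul0r !addr0.
  set a1 := A (w1 _, _) in EA *; set b1 := B (w1 _, _) in EB *.
  have -> : a1 * cx t - b1 * cy t - (A (u, v) * cx t - B (u, v) * cy t) =
    (B (u, v) - b1) * cy t - (A (u, v) - a1) * cx t by ring.
  apply: (le_trans (ler_normB _ _)).
  rewrite (normrM (B (u, v) - b1)) (normrM (A (u, v) - a1)).
  rewrite (_ : e' * (2 * K) = e' * K + e' * K); last by ring.
  by apply: lerD; apply: ler_pM.
- by rewrite -mulrA /e' mulrAC ler_pdivrMr// ler_wpM2l ?(ltW e0)//; lra.
Qed.

End homotopy.

(** At z = 0 the factor c is identically 1. *)
Lemma mean_value A B : (forall x y, x ^+ 2 + y ^+ 2 <= 1 -> CR A B (x, y)) ->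
  \int[mu]_(t in `[0, 2 * pi]) A (cos t, sin t) = A (0, 0) * (2 * pi).
Proof.
move=> AB.
have z0 : 0 ^+ 2 + 0 ^+ 2 < 1 :> R by rewrite expr0n addr0 ltr01.
have := homotopy_limit AB z0.
have Ex t : cauchy_x 0 0 t = 1 :> R.
  by rewrite /cauchy_x !mul0r addr0 !subr0 cos2Dsin2 divr1.
have Ey t : cauchy_y 0 0 t = 0 :> R by rewrite /cauchy_y !mul0r subr0 mul0r.
under eq_Rintegral do rewrite Ex Ey /= !add0r !subr0 !mul1r mulr0 subr0 mulr1.
under [in X in _ = X -> _]eq_Rintegral do rewrite Ex Ey /= !add0r !subr0 !mul0r mulr0 subr0 mulr1.
by move=> ->; rewrite Rintegral_itv_cst ?subr0// mulr_ge0 ?pi_ge0.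
Qed.

End Poisson.

(** * From Cauchy's formula to Poisson's formula *)

Section PoissonFormula.
Variable R : realType.
Local Notation mu := (@lebesgue_measure R).
Implicit Types (A B : R * R -> R) (u v x y t r : R).

(* $1 - \bar z w$ for $z = u + iv$ and $w = q_1 + i q_2$; [cinv] is its inverse. *)
Definition cden_x u v (q : R * R) : R := 1 - (u * q.1 + v * q.2).
Definition cden_y u v (q : R * R) : R := v * q.1 - u * q.2.

Lemma cden_gt0 u v x y : u ^+ 2 + v ^+ 2 < 1 -> x ^+ 2 + y ^+ 2 <= 1 ->
  0 < cden_x u v (x, y) ^+ 2 + cden_y u v (x, y) ^+ 2.
Proof.
move=> uv xy; rewrite /cden_x /cden_y /= ltr_pwDl ?sqr_ge0//.
have : u * x + v * y < 1.
  have := sqr_ge0 (u - x); have := sqr_ge0 (v - y); nra.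
by move=> h; rewrite exprn_gt0// subr_gt0.
Qed.

Lemma CR_cden u v p : CR (cden_x u v) (cden_y u v) p.
Proof.
apply: CR_eq (CR_affine (- u) v 1 0 p) => q; rewrite /cden_x /cden_y /=; ring.
Qed.

Definition cinv_x u v q := cden_x u v q / (cden_x u v q ^+ 2 + cden_y u v q ^+ 2).
Definition cinv_y u v q := - cden_y u v q / (cden_x u v q ^+ 2 + cden_y u v q ^+ 2).

Lemma CR_cinv u v x y : u ^+ 2 + v ^+ 2 < 1 -> x ^+ 2 + y ^+ 2 <= 1 ->
  CR (cinv_x u v) (cinv_y u v) (x, y).
Proof.
by move=> uv xy; apply: CR_inv (CR_cden _ _ _); rewrite lt0r_neq0// cden_gt0.
Qed.

Lemma cden_sqr u v t : cden_x u v (cos t, sin t) ^+ 2 + cden_y u v (cos t, sin t) ^+ 2 =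
  (cos t - u) ^+ 2 + (sin t - v) ^+ 2.
Proof.
rewrite /cden_x /cden_y /=.
transitivity ((cos t - u) ^+ 2 + (sin t - v) ^+ 2 +
  (u ^+ 2 + v ^+ 2 - 1) * (cos t ^+ 2 + sin t ^+ 2 - 1)); first by ring.
by rewrite cos2Dsin2 subrr mulr0 addr0.
Qed.

(** On the circle e^{it} / (e^{it} - z) is the conjugate of 1 / (1 - conj(z) e^{it}); the second
    factor, unlike the first, is the restriction of a function holomorphic on the closed disc. *)
Lemma cauchy_xE u v t : cauchy_x u v t = cinv_x u v (cos t, sin t).
Proof. by rewrite /cinv_x cden_sqr. Qed.

Lemma cauchy_yE u v t : cauchy_y u v t = - cinv_y u v (cos t, sin t).
Proof. by rewrite /cinv_y cden_sqr mulNr opprK. Qed.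

(** The integrand is the real part of h times the conjugate of k = 1 / (1 - conj(z) w). The limit in
    [homotopy_limit] freezes h at z, and the mean of k over the circle is k(0) = 1. *)
Lemma cauchy_formula A B u v : u ^+ 2 + v ^+ 2 < 1 ->
  (forall x y, x ^+ 2 + y ^+ 2 <= 1 -> CR A B (x, y)) ->
  \int[mu]_(t in `[0, 2 * pi]) (A (cos t, sin t) * cinv_x u v (cos t, sin t)
    + B (cos t, sin t) * cinv_y u v (cos t, sin t)) = A (u, v) * (2 * pi).
Proof.
move=> uv AB; have := homotopy_limit AB uv.
under eq_Rintegral do
  rewrite /= !mul1r (addrC u) subrK (addrC v) subrK cauchy_xE cauchy_yE mulrN opprK.
under [in X in _ = X -> _]eq_Rintegral do
  rewrite /= !mul0r !addr0 cauchy_xE cauchy_yE mulrN opprK.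
have ck x y : x ^+ 2 + y ^+ 2 <= 1 -> CR (cinv_x u v) (cinv_y u v) (x, y).
  exact: CR_cinv.
have Ix := mean_value ck.
have Iy := mean_value (fun x y h => CR_rot (ck x y h)).
have cxy : contin 0 (2 * pi) (fun t => cinv_x u v (cos t, sin t)) /\
           contin 0 (2 * pi) (fun t => cinv_y u v (cos t, sin t)).
  have H t : {for t, continuous (fun t => (cos t, sin t))}.
    exact: (cvg_pair (@continuous_cos R t) (@continuous_sin R t)).
  split=> t _.
  - apply: (@continuous_comp _ _ _ _ (cinv_x u v) t (H t)).
    by have [] := CR_continuous (ck (cos t) (sin t) _); rewrite ?cos2Dsin2.
  - apply: (@continuous_comp _ _ _ _ (cinv_y u v) t (H t)).
    by have [] := CR_continuous (ck (cos t) (sin t) _); rewrite ?cos2Dsin2.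
have [cx cy] := cxy.
move=> ->; rewrite RintegralD//; last 2 first.
- exact: (contin_integrable (continM (@contin_cst R _ _ _) cx)).
- exact: (contin_integrable (continM (@contin_cst R _ _ _) cy)).
rewrite !RintegralZl//; [|exact: contin_integrable..].
rewrite Ix Iy /cinv_x /cinv_y /cden_x /cden_y /= !mulr0 !addr0 !subr0 oppr0 !mul0r.
by rewrite !mulr0 addr0 expr0n expr1n addr0 divr1 mul1r.
Qed.

(** Cauchy's formula is applied to h(w) (1 - |z|^2) / (1 - conj(z) w): on the circle the extra
    factor turns the Cauchy kernel into the Poisson kernel, and at w = z it equals 1. *)
Lemma poisson_unit A B u v : u ^+ 2 + v ^+ 2 < 1 ->
  (forall x y, x ^+ 2 + y ^+ 2 <= 1 -> CR A B (x, y)) ->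
  \int[mu]_(t in `[0, 2 * pi]) (Pk u v (cos t) (sin t) * A (cos t, sin t))
    = A (u, v) * (2 * pi).
Proof.
move=> uv AB; pose m := 1 - u ^+ 2 - v ^+ 2.
have m0 : m != 0 by rewrite lt0r_neq0// /m; lra.
have AB' x y : x ^+ 2 + y ^+ 2 <= 1 ->
    CR (fun q => (A q * cinv_x u v q - B q * cinv_y u v q) * m - 
                 (A q * cinv_y u v q + B q * cinv_x u v q) * 0)
       (fun q => (A q * cinv_x u v q - B q * cinv_y u v q) * 0 +
                 (A q * cinv_y u v q + B q * cinv_x u v q) * m) (x, y).
  move=> xy; apply: CR_mul (CR_mul (AB _ _ xy) (CR_cinv uv xy)) _.
  apply: CR_eq (CR_affine 0 0 m 0 _) => q; rewrite /=; ring.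
have := cauchy_formula uv AB'.
rewrite [in X in _ = X -> _](_ : _ * m - _ = A (u, v)); last first.
  rewrite /cinv_x /cinv_y /cden_x /cden_y /= (_ : v * u - u * v = 0); last by ring.
  rewrite (_ : 1 - (u * u + v * v) = m); last by rewrite /m; ring.
  by field.
move=> <-; apply: eq_Rintegral => t _.
set kx := cinv_x _ _ _; set ky := cinv_y _ _ _.
have K : m * (kx ^+ 2 + ky ^+ 2) = Pk u v (cos t) (sin t).
  have D0 := lt0r_neq0 (chord_gt0 uv (cos2Dsin2 t)).
  have E := cden_sqr u v t.
  rewrite /kx /ky /cinv_x /cinv_y E /Pk -/m !expr_div_n sqrrN -mulrDl E.
  by congr (_ * _); field.
by rewrite -K; ring.
Qed.

(** The dilation w |-> r w makes a function holomorphic in the open disc holomorphic up to the unit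
    circle. *)
Lemma poisson_formula A B u v r : u ^+ 2 + v ^+ 2 < 1 -> 0 <= r < 1 ->
  (forall x y, x ^+ 2 + y ^+ 2 < 1 -> CR A B (x, y)) ->
  \int[mu]_(t in `[0, 2 * pi]) (Pk u v (cos t) (sin t) * A (r * cos t, r * sin t))
    = A (r * u, r * v) * (2 * pi).
Proof.
move=> uv /andP[r0 r1] AB.
apply: (@poisson_unit (fun q => A (r * q.1, r * q.2)) (fun q => B (r * q.1, r * q.2))) => //.
move=> x y xy; apply: (@CR_comp R A B (fun q => r * q.1) (fun q => r * q.2)).
  apply: AB => /=; have -> : (r * x) ^+ 2 + (r * y) ^+ 2 = r ^+ 2 * (x ^+ 2 + y ^+ 2) by ring.
  have : r ^+ 2 < 1 by rewrite expr_lt1.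
  have := sqr_ge0 r; nra.
by apply: CR_eq (CR_affine r 0 0 0 _) => q; rewrite /=; ring.
Qed.

Lemma Pk_int u v : u ^+ 2 + v ^+ 2 < 1 ->
  \int[mu]_(t in `[0, 2 * pi]) Pk u v (cos t) (sin t) = 2 * pi.
Proof.
move=> uv; have := @poisson_unit (cst 1) (cst 0) u v uv.
under eq_Rintegral do rewrite mulr1.
rewrite /= mul1r; apply => x y _.
by exists 0, 0; split; [exact: hasgrad_cst|rewrite oppr0; exact: hasgrad_cst].
Qed.

End PoissonFormula.

(** * Exchange of integrals over a product of two sets *)

Section FubiniOnBoxes.
Variable R : realType.
Local Notation mu := (@lebesgue_measure R).
Implicit Types (D E : set R) (k : R * R -> R).

(** Extension by zero off D x E turns iterated integrals over the box into integrals over the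
    plane. *)
Let boxed D E k (p : R * R) : R := k p * \1_D p.1 * \1_E p.2.

Let boxed_measurable D E k : measurable D -> measurable E ->
  measurable_fun setT k -> measurable_fun setT (boxed D E k).
Proof.
move=> mD mE mk; apply: measurable_funM; first apply: measurable_funM => //.
- by apply: (measurableT_comp (measurable_indic mD) measurable_fst).
- by apply: (measurableT_comp (measurable_indic mE) measurable_snd).
Qed.

Let boxed_int1' D E k :
  (fun x => \int[mu]_y (boxed D E k (x, y))%:E)%E =
  (fun x => \int[mu]_(y in E) (k (x, y))%:E)%E \_ D.
Proof.
apply/funext => x; rewrite patchE; case: ifPn => xD.
  rewrite [RHS]integral_mkcond; apply: eq_integral => y _.
  rewrite patchE /boxed /= !indicE xD; case: ifPn => yE.
    by rewrite !mulr1.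
  by rewrite mulr0.
rewrite integral0_eq// => y _; rewrite /boxed /= indicE (negbTE xD).
by rewrite mulr0 mul0r.
Qed.

Let boxed_int1 D E k :
  (\int[mu]_x \int[mu]_y (boxed D E k (x, y))%:E =
   \int[mu]_(x in D) \int[mu]_(y in E) (k (x, y))%:E)%E.
Proof. by rewrite [RHS]integral_mkcond boxed_int1'. Qed.

Let boxed_int2 D E k :
  (\int[mu]_y \int[mu]_x (boxed D E k (x, y))%:E =
   \int[mu]_(y in E) \int[mu]_(x in D) (k (x, y))%:E)%E.
Proof.
rewrite [RHS]integral_mkcond; apply: eq_integral => y _.
rewrite patchE; case: ifPn => yE.
  rewrite [RHS]integral_mkcond; apply: eq_integral => x _.
  rewrite patchE /boxed /= !indicE yE; case: ifPn => xD.
    by rewrite !mulr1.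
  by rewrite mulr0 mul0r.
rewrite integral0_eq// => x _; rewrite /boxed /= [\1_E _]indicE (negbTE yE).
by rewrite mulr0.
Qed.

Lemma tonelli_box D E k : measurable D -> measurable E -> measurable_fun setT k ->
  (forall x y, D x -> E y -> 0 <= k (x, y)) ->
  (\int[mu]_(x in D) \int[mu]_(y in E) (k (x, y))%:E =
   \int[mu]_(y in E) \int[mu]_(x in D) (k (x, y))%:E)%E.
Proof.
move=> mD mE mk k0; rewrite -boxed_int1 -boxed_int2.
apply: (@fubini_tonelli _ _ _ _ R mu mu (fun p => (boxed D E k p)%:E)).
  by apply/measurable_EFinP; exact: boxed_measurable.
move=> [x y]; rewrite lee_fin /boxed /= !indicE.
case: (boolP (x \in D)) => xD; last by rewrite mulr0 mul0r.
case: (boolP (y \in E)) => yE; last by rewrite mulr0.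
by rewrite !mulr1 k0//; apply/set_mem.
Qed.

Lemma fubini_box D E k M : measurable D -> measurable E -> measurable_fun setT k ->
  (mu D < +oo)%E -> (mu E < +oo)%E ->
  (forall x y, D x -> E y -> `|k (x, y)| <= M) ->
  mu.-integrable D (fun x => (\int[mu]_(y in E) k (x, y))%:E) /\
  \int[mu]_(x in D) \int[mu]_(y in E) k (x, y) =
  \int[mu]_(y in E) \int[mu]_(x in D) k (x, y).
Proof.
move=> mD mE mk muD muE kM.
have [D0|/set0P[x0 Dx0]] := eqVneq D set0.
  split; first by rewrite D0; exact: integrable_set0.
  rewrite D0 Rintegral_set0; under eq_Rintegral do rewrite Rintegral_set0.
  by rewrite Rintegral_cst// mul0r.
have [E0|/set0P[y0 Ey0]] := eqVneq E set0.
  split.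
    apply: (@eq_integrable _ _ _ mu D mD (cst 0%E)); last exact: integrable0.
    by move=> x _ /=; rewrite E0 Rintegral_set0.
  rewrite E0 Rintegral_set0; under eq_Rintegral do rewrite Rintegral_set0.
  by rewrite Rintegral_cst// mul0r.
have M0 : 0 <= M by apply: le_trans (kM _ _ Dx0 Ey0).
have bD x y : `|boxed D E k (x, y)| <= M * \1_D x * \1_E y.
  rewrite /boxed /= !indicE.
  case: (boolP (x \in D)) => xD; last by rewrite !mulr0 !mul0r normr0.
  case: (boolP (y \in E)) => yE; last by rewrite !mulr0 normr0.
  by rewrite !mulr1 kM//; apply/set_mem.
have mb := boxed_measurable mD mE mk.
have intb : (mu \x mu)%E.-integrable setT (fun p => (boxed D E k p)%:E).
  apply/integrable12ltyP; first exact/measurable_EFinP.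
  apply: (@le_lt_trans _ _ (\int[mu]_x \int[mu]_y (boxed D E (cst M) (x, y))%:E)%E).
    apply: ge0_le_integral => //=.
    - by move=> x _; apply: integral_ge0 => y _; rewrite lee_fin.
    - apply: (@measurable_fun_fubini_tonelli_F _ _ _ _ R mu (fun p => (`|boxed D E k p|)%:E)) => //.
      by apply/measurable_EFinP; apply: measurableT_comp.
    - apply: (@measurable_fun_fubini_tonelli_F _ _ _ _ R mu (fun p => (boxed D E (cst M) p)%:E)).
        by apply/measurable_EFinP; exact: boxed_measurable.
      by move=> p; rewrite lee_fin /boxed !indicE !mulr_ge0.
    - move=> x _; apply: ge0_le_integral => //=.
      + apply/measurable_EFinP; apply: measurableT_comp => //.
        by apply: (measurableT_comp mb); exact: pair1_measurable.
      + apply/measurable_EFinP.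
        apply: (measurableT_comp (boxed_measurable mD mE (@measurable_cst _ _ _ _ setT M))).
        exact: pair1_measurable.
      + by move=> y _; rewrite lee_fin.
  rewrite boxed_int1/=; under eq_integral do rewrite integral_cst//.
  rewrite integral_cst//.
  by rewrite lte_mul_pinfty ?mule_ge0 ?lee_fin// ge0_fin_numE ?mule_ge0// lte_mul_pinfty ?lee_fin.
have fin1 x : D x -> (\int[mu]_(y in E) (k (x, y))%:E)%E \is a fin_num.
  move=> Dx; apply: integrable_fin_num => //.
  apply: (@le_integrable _ _ _ mu E mE _ (cst M%:E)).
  - apply/measurable_EFinP; apply: (measurable_funTS (f := fun y => k (x, y))).
    by apply: (measurableT_comp mk); exact: pair1_measurable.
  - by move=> y Ey /=; rewrite lee_fin (ger0_norm M0); exact: kM.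
  - by apply/integrableP; split => //=; rewrite integral_cst// lte_mul_pinfty// lee_fin.
have fin2 y : E y -> (\int[mu]_(x in D) (k (x, y))%:E)%E \is a fin_num.
  move=> Ey; apply: integrable_fin_num => //.
  apply: (@le_integrable _ _ _ mu D mD _ (cst M%:E)).
  - apply/measurable_EFinP; apply: (measurable_funTS (f := fun x => k (x, y))).
    by apply: (measurableT_comp mk); exact: pair2_measurable.
  - by move=> x Dx /=; rewrite lee_fin (ger0_norm M0); exact: kM.
  - by apply/integrableP; split => //=; rewrite integral_cst// lte_mul_pinfty// lee_fin.
split.
  have := @integrable_fubini_F _ _ _ _ R mu mu _ intb.
  rewrite /fubini_F boxed_int1' => h0.
  have h : mu.-integrable D (fun x => \int[mu]_(y in E) (k (x, y))%:E)%E.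
    by apply/integrable_mkcond.
  by apply: eq_integrable h => // x /set_mem Dx; rewrite /Rintegral fineK// fin1.
rewrite /Rintegral; congr fine.
under eq_integral => x /set_mem Dx do rewrite fineK ?fin1//.
under [in RHS]eq_integral => y /set_mem Ey do rewrite fineK ?fin2//.
by rewrite -boxed_int1 -boxed_int2; exact: (@Fubini _ _ _ _ R mu mu _ intb).
Qed.

Lemma measurable_partial_integral E k : measurable E -> measurable_fun setT k ->
  (forall p, 0 <= k p) ->
  measurable_fun setT (fun x => \int[mu]_(y in E) (k (x, y))%:E)%E.
Proof.
move=> mE mk k0.
rewrite (_ : (fun x => _) = (fun x => \int[mu]_y (k (x, y) * \1_E y)%:E)%E); last first.
  apply/funext => x; rewrite integral_mkcond; apply: eq_integral => y _.
  by rewrite patchE indicE; case: ifPn => _; rewrite ?mulr1 ?mulr0.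
apply: (@measurable_fun_fubini_tonelli_F _ _ _ _ R mu (fun p => (k p * \1_E p.2)%:E)).
  apply/measurable_EFinP; apply: measurable_funM => //.
  exact: (measurableT_comp (measurable_indic mE) measurable_snd).
by move=> p; rewrite lee_fin mulr_ge0// indicE.
Qed.

End FubiniOnBoxes.

(** * Boundary functions of square-integrable harmonic functions *)

Section CircleMeans.
Variable R : realType.
Local Notation mu := (@lebesgue_measure R).
Local Notation T := (`[0, 2 * pi]%classic : set R).
Implicit Types (t x r s p u v : R) (k : R -> R).

Lemma pi2_ge0 : 0 <= 2 * pi :> R.
Proof. by rewrite mulr_ge0 ?pi_ge0. Qed.

Lemma pi2_gt0 : 0 < 2 * pi :> R.
Proof. by rewrite mulr_gt0 ?pi_gt0. Qed.

Lemma continuous_contin a b k : continuous k -> contin a b k.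
Proof. by move=> ck x _; exact: ck. Qed.

Lemma contin_bounded a b k : a <= b -> contin a b k ->
  exists M : R, forall x, a <= x <= b -> `|k x| <= M.
Proof.
move=> ab ck; have [] := @EVT_max R (fun x => `|k x|) a b ab.
  apply: contin_within => x xab; apply: (@continuous_comp _ _ _ k Num.norm); first exact: ck.
  exact: norm_continuous.
move=> c _ H; exists `|k c| => x xab; apply: H; by rewrite in_itv.
Qed.

(* The Poisson kernel $P_p(x)$ of the circle of radius [p]. *)
Definition PP p x : R := (1 - p ^+ 2) / (1 + p ^+ 2 - 2 * p * cos x).

Lemma PP_den_ge p x : 0 <= p -> (1 - p) ^+ 2 <= 1 + p ^+ 2 - 2 * p * cos x.
Proof. by move=> p0; have := cos_le1 x; nra. Qed.

Lemma PP_den_gt0 p x : 0 <= p < 1 -> 0 < 1 + p ^+ 2 - 2 * p * cos x.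
Proof.
move=> /andP[p0 p1]; apply: lt_le_trans (PP_den_ge x p0).
by rewrite exprn_gt0// subr_gt0.
Qed.

Lemma PP_ge0 p x : 0 <= p < 1 -> 0 <= PP p x.
Proof.
move=> p01; rewrite divr_ge0 ?(ltW (PP_den_gt0 _ p01))//.
by move: p01 => /andP[p0 p1]; rewrite subr_ge0 expr_le1// ltW.
Qed.

Lemma PP_le p x : 0 <= p < 1 -> PP p x <= (1 - p ^+ 2) / (1 - p) ^+ 2.
Proof.
move=> p01; have D0 := PP_den_gt0 x p01; move: p01 => /andP[p0 p1].
rewrite /PP ler_wpM2l ?subr_ge0 ?expr_le1 ?(ltW p1)//.
by rewrite lef_pV2 ?posrE ?PP_den_ge// exprn_gt0// subr_gt0.
Qed.

Lemma PP_sym p t s : PP p (t - s) = PP p (s - t).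
Proof. by rewrite /PP -(cosN (t - s)) opprB. Qed.

Lemma Pk_PP p t s : Pk (p * cos t) (p * sin t) (cos s) (sin s) = PP p (t - s).
Proof.
rewrite /Pk /PP cosB.
have -> : 1 - (p * cos t) ^+ 2 - (p * sin t) ^+ 2 = 1 - p ^+ 2 * (cos t ^+ 2 + sin t ^+ 2).
  by ring.
have -> : (cos s - p * cos t) ^+ 2 + (sin s - p * sin t) ^+ 2 =
  (cos s ^+ 2 + sin s ^+ 2) + p ^+ 2 * (cos t ^+ 2 + sin t ^+ 2)
   - 2 * p * (cos t * cos s + sin t * sin s) by ring.
by rewrite !cos2Dsin2 mulr1.
Qed.

Lemma PP_continuous p : 0 <= p < 1 -> continuous (PP p).
Proof.
move=> p01 x; apply: cvgM; first exact: cvg_cst.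
apply: cvgV; first by rewrite lt0r_neq0// PP_den_gt0.
apply: cvgB; first exact: cvg_cst.
by apply: cvgM; [exact: cvg_cst|exact: continuous_cos].
Qed.

Lemma disc_polar p t : 0 <= p < 1 -> (p * cos t) ^+ 2 + (p * sin t) ^+ 2 < 1.
Proof.
move=> /andP[p0 p1]; rewrite !exprMn -mulrDr cos2Dsin2 mulr1.
by rewrite expr_lt1.
Qed.

Lemma PP_int p t : 0 <= p < 1 -> \int[mu]_(s in T) PP p (t - s) = 2 * pi.
Proof.
move=> p01; apply: etrans (Pk_int (disc_polar t p01)).
by apply: eq_Rintegral => s _; rewrite Pk_PP.
Qed.

Lemma mu_T : mu T = (2 * pi)%:E.
Proof.
have E := lebesgue_measure_itv `[0, 2 * pi :> R].
by apply: (etrans E); rewrite /= lte_fin pi2_gt0 oppr0 addr0.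
Qed.

(** * Square means on circles of a function reproduced by the Poisson kernel *)

Section harmonic.
Variable U : R * R -> R.
Hypothesis cU : forall x y : R, x ^+ 2 + y ^+ 2 < 1 -> {for (x, y), continuous U}.
Hypothesis pU : forall u v r, u ^+ 2 + v ^+ 2 < 1 -> 0 <= r < 1 ->
  \int[mu]_(t in T) (Pk u v (cos t) (sin t) * U (r * cos t, r * sin t))
    = U (r * u, r * v) * (2 * pi).

Definition circ r t := U (r * cos t, r * sin t).

Lemma circ_continuous r : 0 <= r < 1 -> continuous (circ r).
Proof.
move=> r01 t; apply: (@continuous_comp _ _ _ (fun t => (r * cos t, r * sin t)) U); last first.
  by apply: cU; exact: disc_polar.
have c1 : {for t, continuous (fun t => r * cos t)}.
  by apply: cvgM; [exact: cvg_cst|exact: continuous_cos].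
have c2 : {for t, continuous (fun t => r * sin t)}.
  by apply: cvgM; [exact: cvg_cst|exact: continuous_sin].
exact: (cvg_pair c1 c2).
Qed.

Lemma circ_poisson p r t : 0 <= p < 1 -> 0 <= r < 1 ->
  \int[mu]_(s in T) (PP p (t - s) * circ r s) = circ (r * p) t * (2 * pi).
Proof.
move=> p01 r01; rewrite /circ -!mulrA; apply: etrans (pU (disc_polar t p01) r01).
by apply: eq_Rintegral => s _; rewrite Pk_PP.
Qed.

Definition mean2 r := \int[mu]_(t in T) (circ r t) ^+ 2.

Let PPs_continuous p t : 0 <= p < 1 -> continuous (fun s => PP p (t - s)).
Proof.
move=> p01 s; apply: (@continuous_comp _ _ _ (fun s => t - s) (PP p)).
  by apply: cvgB; [exact: cvg_cst|exact: cvg_id].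
exact: PP_continuous.
Qed.

Let circ2_continuous r : 0 <= r < 1 -> continuous (fun t => circ r t ^+ 2).
Proof.
move=> r01 t; rewrite (_ : (fun t => _) = circ r \* circ r); last first.
  by apply/funext => s; rewrite /= expr2.
by apply: cvgM; exact: circ_continuous.
Qed.

Let cM k l : continuous k -> continuous l -> continuous (fun t => k t * l t).
Proof. by move=> ck cl t; apply: cvgM; [exact: ck|exact: cl]. Qed.

Let cD k l : continuous k -> continuous l -> continuous (fun t => k t + l t).
Proof. by move=> ck cl t; apply: cvgD; [exact: ck|exact: cl]. Qed.

Let cint k : continuous k -> mu.-integrable T (EFin \o k).
Proof. by move=> ck; apply: contin_integrable; exact: continuous_contin. Qed.

Let RZl k (c : R) : continuous k ->
  \int[mu]_(t in T) (c * k t) = c * \int[mu]_(t in T) k t.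
Proof. by move=> ck; rewrite RintegralZl//; exact: cint. Qed.

Let RZr k (c : R) : continuous k ->
  \int[mu]_(t in T) (k t * c) = (\int[mu]_(t in T) k t) * c.
Proof. by move=> ck; rewrite RintegralZr//; exact: cint. Qed.

(** Expansion of the nonnegative integral of PP (circ r - c)^2, where c is the Poisson mean of
    [circ r] and the kernel has total mass 2 pi. *)
Lemma circ_jensen p r t : 0 <= p < 1 -> 0 <= r < 1 ->
  circ (r * p) t ^+ 2 * (2 * pi) <= \int[mu]_(s in T) (PP p (t - s) * circ r s ^+ 2).
Proof.
move=> p01 r01; set c := circ (r * p) t.
have I1 := cint (cM (@PPs_continuous p t p01) (circ2_continuous r01)).
have I2 := cint (cM (@PPs_continuous p t p01) (circ_continuous r01)).
have I3 := cint (@PPs_continuous p t p01).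
have : 0 <= \int[mu]_(s in T) (PP p (t - s) * (circ r s - c) ^+ 2).
  by apply: Rintegral_ge0 => s _; rewrite mulr_ge0 ?PP_ge0 ?sqr_ge0.
have -> : \int[mu]_(s in T) (PP p (t - s) * (circ r s - c) ^+ 2) =
  \int[mu]_(s in T) (PP p (t - s) * circ r s ^+ 2 +
     ((- 2 * c) * (PP p (t - s) * circ r s) + c ^+ 2 * PP p (t - s))).
  by apply: eq_Rintegral => s _; ring.
have c2 : continuous (fun s => - 2 * c * (PP p (t - s) * circ r s)).
  by apply: cM; [exact: cst_continuous|exact: cM (@PPs_continuous p t p01) (circ_continuous r01)].
have c3 : continuous (fun s => c ^+ 2 * PP p (t - s)).
  by apply: cM; [exact: cst_continuous|exact: PPs_continuous].
have I2' := cint c2; have I3' := cint c3.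
rewrite RintegralD//; last exact: cint (cD c2 c3).
rewrite RintegralD// (RZl (-2 * c) (cM (@PPs_continuous p t p01) (circ_continuous r01))).
rewrite (RZl (c ^+ 2) (@PPs_continuous p t p01)) circ_poisson// PP_int// -/c.
by lra.
Qed.

Let mPP p : 0 <= p < 1 -> measurable_fun setT (fun q : R * R => PP p (q.1 - q.2)).
Proof.
move=> p01; apply: (measurableT_comp (continuous_measurable_fun (PP_continuous p01))).
by apply: measurable_funB; [exact: measurable_fst|exact: measurable_snd].
Qed.

(* The operator with kernel [PP p (t - s)] is self-adjoint and maps [circ r] to
   [circ (r * p)]. *)
Let fubini_PP p (k l : R -> R) : 0 <= p < 1 -> continuous k -> continuous l ->
  mu.-integrable T (fun t => (\int[mu]_(s in T) (k t * (PP p (t - s) * l s)))%:E) /\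
  \int[mu]_(t in T) (\int[mu]_(s in T) (k t * (PP p (t - s) * l s))) =
  \int[mu]_(s in T) (l s * \int[mu]_(t in T) (PP p (s - t) * k t)).
Proof.
move=> p01 ck cl.
have [Mk HMk] := contin_bounded pi2_ge0 (continuous_contin ck).
have [Ml HMl] := contin_bounded pi2_ge0 (continuous_contin cl).
have [|||x y|H1 H2] := @fubini_box R T T (fun q => k q.1 * (PP p (q.1 - q.2) * l q.2))
  (Mk * ((1 - p ^+ 2) / (1 - p) ^+ 2 * Ml)) (measurable_itv _) (measurable_itv _).
- apply: measurable_funM.
    exact: (measurableT_comp (continuous_measurable_fun ck) measurable_fst).
  apply: measurable_funM; first exact: mPP.
  exact: (measurableT_comp (continuous_measurable_fun cl) measurable_snd).
- by rewrite mu_T ltry.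
- by rewrite mu_T ltry.
- rewrite /= !in_itv/= => xT yT; rewrite (normrM (k x)) (normrM (PP p (x - y))).
  apply: ler_pM; rewrite ?mulr_ge0 ?HMk//.
  apply: ler_pM; rewrite ?HMl//.
  by rewrite ger0_norm ?PP_ge0// PP_le.
split; first exact: H1.
rewrite H2; apply: eq_Rintegral => s _.
rewrite -(RZl (l s) (cM (@PPs_continuous p s p01) ck)).
by apply: eq_Rintegral => t _ /=; rewrite (PP_sym p t s); ring.
Qed.

Let mul_lt1 p r : 0 <= p < 1 -> 0 <= r < 1 -> 0 <= r * p < 1.
Proof.
move=> /andP[p0 p1] /andP[r0 r1]; rewrite mulr_ge0//=.
by rewrite (le_lt_trans _ r1)// ler_piMr// ltW.
Qed.

(** Integrate [circ_jensen] in t and exchange the integrals; the kernel has mass 2 pi in either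
    variable. *)
Lemma mean2_le p r : 0 <= p < 1 -> 0 <= r < 1 -> mean2 (r * p) <= mean2 r.
Proof.
move=> p01 r01.
rewrite -(ler_pM2r pi2_gt0) /mean2 -(RZr (2 * pi) (circ2_continuous (mul_lt1 p01 r01))).
have c1 : continuous (fun _ : R => 1 : R) by exact: cst_continuous.
have [I E] := fubini_PP p01 c1 (circ2_continuous r01).
have -> : (\int[mu]_(t in T) circ r t ^+ 2) * (2 * pi) =
    \int[mu]_(t in T) (circ r t ^+ 2 * \int[mu]_(s in T) (PP p (t - s) * 1)).
  rewrite -(RZr (2 * pi) (circ2_continuous r01)).
  apply: eq_Rintegral => t _; congr (_ * _).
  by apply: esym; apply: etrans (PP_int t p01); apply: eq_Rintegral => s _; rewrite mulr1.
rewrite -E; apply: le_Rintegral => //.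
  apply: (cint (k := fun t => circ (r * p) t ^+ 2 * (2 * pi))).
  by apply: cM; [apply: circ2_continuous; exact: mul_lt1|exact: cst_continuous].
move=> t _; apply: le_trans (circ_jensen t p01 r01) _.
by under [leRHS]eq_Rintegral do rewrite mul1r.
Qed.

Let inner r s := \int[mu]_(t in T) (circ r t * circ s t).

Let inner_shift p r s : 0 <= p < 1 -> 0 <= r < 1 -> 0 <= s < 1 ->
  inner r (s * p) = inner (r * p) s.
Proof.
move=> p01 r01 s01; apply: (mulIf (lt0r_neq0 pi2_gt0)).
have cc q : 0 <= q < 1 -> forall q', 0 <= q' < 1 -> continuous (fun t => circ q t * circ q' t).
  by move=> q01 q' q'01; apply: cM; exact: circ_continuous.
rewrite /inner -(RZr (2 * pi) (cc _ r01 _ (mul_lt1 p01 s01))).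
rewrite -(RZr (2 * pi) (cc _ (mul_lt1 p01 r01) _ s01)).
have [_ E] := fubini_PP p01 (circ_continuous r01) (circ_continuous s01).
transitivity (\int[mu]_(t in T) (\int[mu]_(s0 in T) (circ r t * (PP p (t - s0) * circ s s0)))).
  apply: eq_Rintegral => t _; rewrite (RZl (circ r t) (cM (@PPs_continuous p t p01) (circ_continuous s01))).
  by rewrite circ_poisson//; ring.
rewrite E; apply: eq_Rintegral => t _; rewrite circ_poisson//; ring.
Qed.

(** In the expansion of the square, symmetry of the kernel makes the inner product of the circles r
    and r p^2 equal to [mean2 (r * p)], which is at least [mean2 (r * p * p)] by monotonicity. This
    replaces an expansion in Fourier series. *)
Lemma circ_dist p r : 0 <= p < 1 -> 0 <= r < 1 ->
  \int[mu]_(t in T) (circ r t - circ (r * p * p) t) ^+ 2 <= mean2 r - mean2 (r * p * p).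
Proof.
move=> p01 r01; have rp01 := mul_lt1 p01 r01; have rpp01 := mul_lt1 p01 rp01.
have Ir := cint (circ2_continuous r01); have Is := cint (circ2_continuous rpp01).
have Irs := cint (cM (circ_continuous r01) (circ_continuous rpp01)).
have -> : \int[mu]_(t in T) (circ r t - circ (r * p * p) t) ^+ 2 =
  \int[mu]_(t in T) (circ r t ^+ 2 + (circ (r * p * p) t ^+ 2
    + (- 2) * (circ r t * circ (r * p * p) t))).
  by apply: eq_Rintegral => t _; ring.
have crs : continuous (fun t => - 2 * (circ r t * circ (r * p * p) t)).
  by apply: cM; [exact: cst_continuous|exact: cM (circ_continuous r01) (circ_continuous rpp01)].
have Irs' := cint crs.
rewrite RintegralD//; last exact: cint (cD (circ2_continuous rpp01) crs).
rewrite RintegralD// (RZl (-2) (cM (circ_continuous r01) (circ_continuous rpp01))) -/(mean2 r) -/(mean2 (r * p * p)).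
rewrite -/(inner r (r * p * p)) inner_shift//.
have -> : inner (r * p) (r * p) = mean2 (r * p).
  by apply: eq_Rintegral => t _; rewrite expr2.
by have := mean2_le p01 rp01; lra.
Qed.

Lemma mean2_ge0 r : 0 <= mean2 r.
Proof. by apply: Rintegral_ge0 => t _; exact: sqr_ge0. Qed.

End harmonic.
End CircleMeans.

Lemma Pk_continuous (R : realType) (u v : R) : u ^+ 2 + v ^+ 2 < 1 ->
  continuous (fun t : R => Pk u v (cos t) (sin t)).
Proof.
move=> uv t; apply: cvgM; first exact: cvg_cst.
apply: cvgV; first by rewrite lt0r_neq0// chord_gt0 ?cos2Dsin2.
have sq (h : R -> R) (w : R) : continuous h -> continuous (fun t => (h t - w) ^+ 2).
  move=> ch s; rewrite (_ : (fun t => _) = (h \- cst w) \* (h \- cst w)); last first.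
    by apply/funext => x; rewrite expr2.
  by apply: cvgM; apply: cvgB; [exact: ch|exact: cvg_cst|exact: ch|exact: cvg_cst].
by apply: cvgD; apply: sq; [exact: continuous_cos|exact: continuous_sin].
Qed.

(** * Construction of the boundary function from bounded square means *)

Section BoundaryFunction.
Variable R : realType.
Local Notation mu := (@lebesgue_measure R).
Local Notation T := (`[0, 2 * pi]%classic : set R).
Implicit Types (t x r s p u v : R).

Variable U : R * R -> R.
Hypothesis cU : forall x y : R, x ^+ 2 + y ^+ 2 < 1 -> {for (x, y), continuous U}.
Hypothesis pU : forall u v r, u ^+ 2 + v ^+ 2 < 1 -> 0 <= r < 1 ->
  \int[mu]_(t in T) (Pk u v (cos t) (sin t) * U (r * cos t, r * sin t))
    = U (r * u, r * v) * (2 * pi).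

Lemma mean2_homo s r : 0 <= s -> s <= r -> r < 1 -> mean2 U s <= mean2 U r.
Proof.
move=> s0; rewrite le_eqVlt => /predU1P[->//|sr] r1.
have r0 : 0 < r by apply: le_lt_trans sr.
rewrite (_ : s = r * (s / r)); last by rewrite mulrCA divff ?mulr1// lt0r_neq0.
apply: mean2_le => //; last by rewrite (ltW r0).
by rewrite divr_ge0 ?(ltW r0)//= ltr_pdivrMr// mul1r.
Qed.

Lemma circ_dist_le s r : 0 <= s -> s < r -> r < 1 ->
  \int[mu]_(t in T) (circ U r t - circ U s t) ^+ 2 <= mean2 U r - mean2 U s.
Proof.
move=> s0 sr r1; have r0 : 0 < r by apply: le_lt_trans sr.
have sr0 : 0 <= s / r by rewrite divr_ge0 ?(ltW r0).
have E : s = r * Num.sqrt (s / r) * Num.sqrt (s / r).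
  by rewrite -mulrA -expr2 sqr_sqrtr// mulrCA divff ?mulr1// lt0r_neq0.
rewrite [in leLHS]E [in leRHS]E; apply: circ_dist => //; last by rewrite (ltW r0).
rewrite sqrtr_ge0/= -[ltRHS]sqrtr1 ltr_sqrt//.
by rewrite ltr_pdivrMr// mul1r.
Qed.

Variable M : R.
Hypothesis mU : forall r, 0 <= r < 1 -> mean2 U r <= M.

(** The means increase to their supremum, so by [circ_dist_le] consecutive circles are close in
    square mean once the n-th mean is within 4^-n of it. *)
Lemma good_radii : exists r : nat -> R, [/\ forall n, 0 <= r n < 1,
  r n @[n --> \oo] --> (1 : R) &
  forall n, \int[mu]_(t in T) (circ U (r n.+1) t - circ U (r n) t) ^+ 2 <= (4 ^+ n)^-1].
Proof.
pose A := [set mean2 U r | r in [set r | 0 <= r < 1]].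
have supA : has_sup A.
  split; first by exists (mean2 U 0), 0 => //=; rewrite lexx ltr01.
  by exists M => _ [r /mU ? <-].
have rhoP n : exists rho : R, 0 <= rho < 1 /\ sup A - (4 ^+ n)^-1 < mean2 U rho.
  have e0 : 0 < (4 ^+ n)^-1 :> R by rewrite invr_gt0 exprn_gt0.
  have [_ [rho rho01 <-] H] := sup_adherent e0 supA.
  by exists rho; split.
have [rho rhoE] := choice rhoP.
(* The radius [rho n] secures the mean; the midpoint with 1 forces strict growth and convergence to
   1. *)
pose fix r (n : nat) : R := if n is m.+1 then Num.max (rho m.+1) ((1 + r m) / 2) else rho 0.
have r01 n : 0 <= r n < 1.
  elim: n => [|n /andP[IH1 IH2]] /=; first by have [] := rhoE 0.
  have [/andP[a b] _] := rhoE n.+1.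
  by rewrite le_max a/= gt_max b/= ltr_pdivrMr//; lra.
have rinc n : (1 + r n) / 2 <= r n.+1 by rewrite /= le_max lexx orbT.
have rrho n : rho n <= r n by case: n => [|n] //=; rewrite le_max lexx.
exists r; split => //.
- have H n : 1 - r n <= (2 ^+ n)^-1.
    elim: n => [|n IH]; first by rewrite expr0 invr1; have := r01 0; lra.
    rewrite exprS invfM; have := rinc n; lra.
  apply/cvgrPdist_le => e e0; near=> n.
  rewrite ger0_norm ?subr_ge0; last by have /andP[_ /ltW] := r01 n.
  apply: le_trans (H n) _.
  have : (geometric 1 (2^-1 : R) n) <= e.
    near: n; have /cvgrPdist_le /(_ _ e0) := @cvg_geometric R 1 2^-1 ltac:(by rewrite ger0_norm ?invr_ge0// invf_lt1 ?ltr1n).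
    by apply: filterS => n; rewrite sub0r normrN => /(le_trans (ler_norm _)).
  by rewrite /geometric/= mul1r exprVn.
- move=> n; have /andP[r0 r1] := r01 n; have /andP[_ r1'] := r01 n.+1.
  apply: le_trans (circ_dist_le r0 _ r1') _.
    by apply: lt_le_trans (rinc n); rewrite ltr_pdivlMr//; lra.
  have H1 : mean2 U (r n.+1) <= sup A by apply: ub_le_sup; [exact: supA.2|exists (r n.+1) => //; exact: r01].
  have [/andP[a0 a1] H2] := rhoE n.
  have := mean2_homo a0 (rrho n) r1.
  by lra.
Unshelve. all: by end_near. Qed.

Let cint k : continuous k -> mu.-integrable T (EFin \o k).
Proof. by move=> ck; apply: contin_integrable; exact: continuous_contin. Qed.

(** Along the good radii the differences of consecutive circles have integrable sum, so the circles
    converge almost everywhere under an integrable majorant. Fatou's lemma bounds the square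
    integral, and dominated convergence carries Poisson's formula from radius r n to the
    boundary. *)
Theorem boundary_function : exists phi : R -> R, [/\ measurable_fun setT phi,
  forall t, phi (t + 2 * pi) = phi t,
  (\int[mu]_(t in T) ((phi t) ^+ 2)%:E <= M%:E)%E,
  mu.-integrable T (EFin \o phi) &
  forall u v, u ^+ 2 + v ^+ 2 < 1 ->
    \int[mu]_(t in T) (Pk u v (cos t) (sin t) * phi t) = U (u, v) * (2 * pi)].
Proof.
have [r [r01 rcvg rdist]] := good_radii.
pose f n t := circ U (r n) t.
have cf n : continuous (f n) by exact: circ_continuous.
pose d n t := `|f n.+1 t - f n t|.
have cd n : continuous (d n).
  by move=> t; apply: cvg_norm; apply: cvgB; exact: cf.
have d0 n t : (0 <= (d n t)%:E)%E by rewrite lee_fin /d.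
pose g t := (\sum_(0 <= n <oo) (d n t)%:E)%E.
have g0 t : (0 <= g t)%E by apply: nneseries_ge0 => n _ _; exact: d0.
have md n : measurable_fun setT (fun t => (d n t)%:E).
  by apply/measurable_EFinP; exact: continuous_measurable_fun.
have mg : measurable_fun setT g.
  apply: (@ge0_emeasurable_sum _ _ R setT (fun n t => (d n t)%:E) xpredT).
    by move=> n t _ _; exact: d0.
  by move=> n _; exact: md.
have intg : (\int[mu]_(t in T) g t < +oo)%E.
  rewrite integral_nneseries//; last first.
    by move=> n; apply: measurable_funTS; exact: md.
  (* From X <= 2^-n / 2 + 2^n X^2 / 2 and the choice of radii the integral is at most (pi + 1/2) /
     2^n; the bound is written in the shape of the geometric series with ratio 1/2 summed below. *)
  have dn n : (\int[mu]_(t in T) (d n t)%:E <= ((pi + 1/2) * 2 / (2 ^ (n + 1))%:R)%:E)%E.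
    have I1 := cint (cd n).
    have c2 : continuous (fun t => 2 ^- n / 2 + 2 ^+ n / 2 * (f n.+1 t - f n t) ^+ 2).
      move=> t; apply: cvgD; first exact: cvg_cst.
      apply: cvgM; first exact: cvg_cst.
      rewrite (_ : (fun t => _) = (f n.+1 \- f n) \* (f n.+1 \- f n)); last first.
        by apply/funext => s; rewrite expr2.
      by apply: cvgM; apply: cvgB; exact: cf.
    have c1 : continuous (fun t => (f n.+1 t - f n t) ^+ 2).
      move=> t; rewrite (_ : (fun t => _) = (f n.+1 \- f n) \* (f n.+1 \- f n)); last first.
        by apply/funext => s; rewrite expr2.
      by apply: cvgM; apply: cvgB; exact: cf.
    rewrite -[leLHS]fineK; last exact: integrable_fin_num.
    rewrite lee_fin -/(Rintegral mu T (d n)).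
    have p2 : 0 < 2 ^+ n :> R by rewrite exprn_gt0.
    apply: (@le_trans _ _ (\int[mu]_(t in T) (2 ^- n / 2 + 2 ^+ n / 2 * (f n.+1 t - f n t) ^+ 2))).
      apply: (le_Rintegral _ I1 (cint c2)) => // t _.
      rewrite /d -[X in _ + _ * X](@real_normK _ (f n.+1 t - f n t)) ?num_real//.
      set X := `|_|; rewrite -subr_ge0.
      rewrite (_ : _ - _ = 2 ^+ n / 2 * (X - 2 ^- n) ^+ 2); last by field; rewrite lt0r_neq0.
      by rewrite mulr_ge0 ?sqr_ge0// divr_ge0// ltW.
    have c3 : continuous (fun t => 2 ^+ n / 2 * (f n.+1 t - f n t) ^+ 2).
      by move=> t; apply: cvgM; [exact: cvg_cst|exact: c1].
    rewrite RintegralD//; [|exact: (contin_integrable (@contin_cst R 0 (2 * pi) (2 ^- n / 2)))|exact: cint c3].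
    rewrite (@RintegralZl _ _ _ mu T _ (2 ^+ n / 2) (measurable_itv _) (cint c1)).
    rewrite Rintegral_itv_cst ?pi2_ge0// subr0.
    have : 2 ^+ n / 2 * \int[mu]_(t in T) (f n.+1 t - f n t) ^+ 2 <= 2 ^+ n / 2 * (4 ^+ n)^-1.
      by rewrite ler_wpM2l ?divr_ge0 ?(ltW p2)//; exact: rdist.
    have -> : 2 ^+ n / 2 * (4 ^+ n)^-1 = 2 ^- n / 2 :> R.
      rewrite (_ : 4 = 2 ^+ 2 :> R); last by rewrite -natrX.
      by rewrite exprAC expr2; field; rewrite lt0r_neq0.
    rewrite addn1 natrX exprS (_ : (pi + 1 / 2) * 2 / (2 * 2 ^+ n) = (pi + 1 / 2) * 2 ^- n).
      by lra.
    by field; rewrite lt0r_neq0.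
  apply: (@le_lt_trans _ _ (\sum_(0 <= n <oo) ((pi + 1/2) * 2 / (2 ^ (n + 1))%:R)%:E)%E).
    by apply: lee_nneseries => [n _ _|n _]; [apply: integral_ge0 => t _; exact: d0|exact: dn].
  have H := @cvg_geometric_eseries_half R ((pi + 1/2) * 2) 0.
  by rewrite (cvg_lim _ H)// ltry.
pose E := [set t | (g t < +oo)%E].
have mE : measurable E.
  have := mg measurableT _ (emeasurable_itv `]-oo, +oo%E[); rewrite setTI.
  by congr measurable; apply/seteqP; split=> t /=; rewrite in_itv /E/= ?ltNye_eq.
have fg n t : ((`|f n t|)%:E <= (`|f 0 t|)%:E + g t)%E.
  apply: (@le_trans _ _ ((`|f 0 t|)%:E + \sum_(0 <= k < n) (d k t)%:E)%E).
    rewrite sumEFin -EFinD lee_fin; elim: n => [|n IH].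
      by rewrite big_geq// addr0.
    rewrite big_nat_recr//= addrA; apply: le_trans (lerD IH (lexx _)).
    by rewrite -lerBlDl; apply: le_trans (lerB_dist _ _).
  by rewrite leeD2l//; apply: nneseries_lim_ge => k _ _; exact: d0.
(* Cut off outside E, the sequence converges at every point, so that its limit is measurable on the
   whole line and inherits the period. *)
pose fE n t := f n t * \1_E t.
have cvgf t : E t -> cvgn (fun n => f n t).
  move=> Et; rewrite (_ : (fun n => f n t) = (fun n => f 0 t + series (telescope (f ^~ t)) n)); last first.
    by apply/funext => n; exact: (eq_sum_telescope (f ^~ t)).
  apply: is_cvgD; first exact: is_cvg_cst.
  apply: normed_cvg; apply: (@nnseries_is_cvg R (d ^~ t)); last exact: Et.
  by move=> n; rewrite /d.
pose phi t := limn (fun n => fE n t).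
have cvgE t : fE n t @[n --> \oo] --> phi t.
  apply/cvg_ex; have [Et|Et] := pselect (E t).
    exists (limn (fun n => f n t)); rewrite (_ : (fun n => fE n t) = f ^~ t); first exact: cvgf.
    by apply/funext => n; rewrite /fE indicE mem_set// mulr1.
  exists 0; rewrite (_ : (fun n => fE n t) = fun=> 0); first exact: cvg_cst.
  by apply/funext => n; rewrite /fE indicE memNset// mulr0.
have cvgphi t : E t -> f n t @[n --> \oo] --> phi t.
  move=> Et; have := cvgE t; rewrite (_ : (fun n => fE n t) = f ^~ t)//.
  by apply/funext => n; rewrite /fE indicE mem_set// mulr1.
have mfE n : measurable_fun setT (fE n).
  by apply: measurable_funM; [exact: continuous_measurable_fun|exact: measurable_indic].
have mfE2 n : measurable_fun setT (fun t => fE n t ^+ 2).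
  rewrite (_ : (fun t => _) = fE n \* fE n); last by apply/funext => s; rewrite expr2.
  exact: measurable_funM.
have mphi : measurable_fun setT phi.
  by apply: (@measurable_fun_cvg _ _ R setT fE) => // t _; exact: cvgE.
have intgT : mu.-integrable T g.
  apply/integrableP; split; first exact: measurable_funTS.
  by under eq_integral do rewrite gee0_abs//.
have aeE : {ae mu, forall t, T t -> E t}.
  have := @integrable_ae _ _ R mu T (measurable_itv _) g intgT.
  apply: filterS => t /= H Tt; have := H Tt.
  by rewrite /E/= fin_numE => /andP[_]; rewrite ltey.
(* Used with k = 1 for the integrability of phi and with k the Poisson kernel for the representation
   of U. *)
have dom (k : R -> R) : continuous k -> mu.-integrable T (fun t => (k t * phi t)%:E) /\
    (\int[mu]_(t in T) (k t * f n t)%:E)%E @[n --> \oo] --> (\int[mu]_(t in T) (k t * phi t)%:E)%E.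
  move=> ck; have [K HK] := contin_bounded (pi2_ge0 R) (continuous_contin (a := 0) (b := 2 * pi) ck).
  have K0 : 0 <= K by apply: le_trans (HK 0 _); rewrite ?lexx ?pi2_ge0.
  have [|||||H1 _ H2] := @dominated_convergence _ _ R mu T (measurable_itv _)
    (fun n t => (k t * f n t)%:E) (fun t => (k t * phi t)%:E)
    (fun t => K%:E * ((`|f 0 t|)%:E + g t))%E.
  - move=> n; apply/measurable_EFinP; apply: measurable_funTS.
    by apply: measurable_funM; exact: continuous_measurable_fun.
  - apply/measurable_EFinP; apply: measurable_funTS.
    by apply: measurable_funM => //; exact: continuous_measurable_fun.
  - have [N [mN N0 HN]] := aeE; exists N; split => // t /= nH; apply: HN => /= H; apply: nH => Tt.
    apply: cvg_EFin; first by apply: nearW.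
    by apply: cvgM; [exact: cvg_cst|exact: cvgphi (H Tt)].
  - apply: integrableZl => //; apply: integrableD => //.
    apply: (cint (k := fun t => `|f 0 t|)) => t.
    by apply: cvg_norm; exact: cf.
  - apply: aeW => t n Tt; rewrite /= normrM EFinM.
    apply: (lee_pmul _ _ _ (fg n t)); rewrite ?lee_fin//.
    by apply: HK; move: Tt; rewrite /= in_itv.
  by split.
exists phi; split => //.
- move=> t; rewrite /phi; congr (limn _); apply/funext => n.
  have fp m : f m (t + 2 * pi) = f m t.
    by rewrite /f /circ mulr_natl cosD2pi sinD2pi.
  rewrite /fE fp; congr (_ * _); rewrite !indicE; congr (_ _)%:R.
  have dp m : d m (t + 2 * pi) = d m t by rewrite /d !fp.
  have gp : g (t + 2 * pi) = g t by apply: eq_eseriesr => m _; rewrite dp.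
  apply/idP/idP => /set_mem H; apply/mem_set; by move: H; rewrite /E /= gp.
- apply: (@le_trans _ _ (\int[mu]_(t in T) limn_einf (fun n => (fE n t ^+ 2)%:E))%E).
    rewrite le_eqVlt; apply/orP; left; apply/eqP; apply: eq_integral => t _.
    apply/esym; have /cvg_limn_einf_sup[-> _]// : (fE n t ^+ 2)%:E @[n --> \oo] --> (phi t ^+ 2)%:E.
    apply: cvg_EFin; first exact: nearW.
    rewrite (_ : _ \o _ = (fE^~ t) \* (fE^~ t)); last by apply/funext => n; rewrite /= expr2.
    by rewrite expr2; apply: cvgM; exact: cvgE.
  apply: le_trans (fatou _ _ _ _) _ => //.
  + by move=> n; apply: measurable_funTS; apply/measurable_EFinP; exact: mfE2.
  + by move=> n t _; rewrite lee_fin sqr_ge0.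
  have H n : (\int[mu]_(t in T) (fE n t ^+ 2)%:E <= M%:E)%E.
    have c2 : continuous (fun t => f n t ^+ 2).
      move=> t; rewrite (_ : (fun t => _) = f n \* f n); last by apply/funext => s; rewrite expr2.
      by apply: cvgM; exact: cf.
    apply: (@le_trans _ _ (\int[mu]_(t in T) (f n t ^+ 2)%:E)%E).
      apply: ge0_le_integral => //.
      * by move=> t _; rewrite lee_fin sqr_ge0.
      * by apply: measurable_funTS; apply/measurable_EFinP; exact: mfE2.
      * by apply: measurable_funTS; apply/measurable_EFinP; exact: continuous_measurable_fun.
      * move=> t _; rewrite lee_fin /fE indicE exprMn; case: (_ \in _); first by rewrite expr1n mulr1.
        by rewrite expr0n/= mulr0 sqr_ge0.
    rewrite -[leLHS]fineK; last exact: integrable_fin_num (cint c2).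
    by rewrite lee_fin; exact: mU.
  rewrite limn_einf_lim (cvg_lim _ (@cvg_einfs_sup _ _))//; apply: ge_ereal_sup => _ [n _ <-].
  by apply: le_trans (H n); apply: ereal_inf_lbound; exists n => /=.
- have c1 : continuous (fun _ : R => 1 : R) by move=> t; exact: cvg_cst.
  have [I _] := dom _ c1.
  by apply: eq_integrable I => // t _; rewrite /= mul1r.
- move=> u v uv.
  pose k t := Pk u v (cos t) (sin t).
  have ck : continuous k.
    exact: Pk_continuous.
  have [I1 I2] := dom _ ck.
  have I3 : (\int[mu]_(t in T) (k t * f n t)%:E)%E @[n --> \oo] --> (U (u, v) * (2 * pi))%:E.
    rewrite (_ : (fun n => _) = (fun n => (U (r n * u, r n * v) * (2 * pi))%:E)); last first.
      apply/funext => n; rewrite -(pU uv (r01 n)) /Rintegral fineK//.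
      apply: integrable_fin_num => //.
      apply: (cint (k := fun t => k t * f n t)) => t.
      by apply: cvgM; [exact: ck|exact: cf].
    apply: cvg_EFin; first exact: nearW.
    apply: cvgM; last exact: cvg_cst.
    have c1 (w : R) : r n * w @[n --> \oo] --> w.
      by rewrite -[X in _ --> X]mul1r; apply: cvgM; [exact: rcvg|exact: cvg_cst].
    have cr : (r n * u, r n * v) @[n --> \oo] --> (u, v).
      exact: (cvg_pair (c1 u) (c1 v)).
    exact: (continuous_cvg _ (cU uv) cr).
  rewrite /Rintegral (_ : (\int[mu]_(t in T) (k t * phi t)%:E)%E = (U (u, v) * (2 * pi))%:E)//.
  exact: cvg_unique I2 I3.
Qed.

End BoundaryFunction.

(** * Nontangential limits *)

Section FatouTheorem.
Variable R : realType.
Local Notation mu := (@lebesgue_measure R).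
Local Notation T := (`[0, 2 * pi]%classic : set R).
Implicit Types (t x y r s u v : R).

Lemma chord_cos s t : (cos s - cos t) ^+ 2 + (sin s - sin t) ^+ 2 = 2 - 2 * cos (s - t).
Proof.
rewrite cosB.
transitivity ((cos s ^+ 2 + sin s ^+ 2) + (cos t ^+ 2 + sin t ^+ 2)
  - 2 * (cos s * cos t + sin s * sin t)); first by ring.
by rewrite !cos2Dsin2; ring.
Qed.

(** 2 - 2 cos x = 4 sin(x/2)^2, and differentiability of sin at 0 gives |sin y| >= |y| / 2 for small
    y. *)
Lemma cos_near0 : exists2 x0 : R, 0 < x0 & forall x, `|x| < x0 -> x ^+ 2 / 4 <= 2 - 2 * cos x.
Proof.
have hs := hasgrad_comp1 (hasgrad_snd (0, 0)) (is_derive_sin (0 : R)).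
have h2 : 0 < 1 / 2 :> R by lra.
have [d d0 H] := hasgrad_eps hs h2.
exists d => // x xd.
have yd : `|x / 2| < d.
  rewrite normrM [`|2^-1|]gtr0_norm ?invr_gt0//; have := normr_ge0 x; lra.
have /= := H 0 (x / 2); rewrite !subr0 normr0 => /(_ d0 yd).
rewrite cos0 sin0 subr0 mulr0 add0r mulr1 mul1r add0r => K.
have -> : 2 - 2 * cos x = 4 * sin (x / 2) ^+ 2.
  have -> : cos x = cos (x / 2 *+ 2) by rewrite -mulr_natr mulfVK.
  rewrite cos_mulr2n sin2cos2 -mulr_natr; ring.
have K2 : `|x| / 4 <= `|sin (x / 2)|.
  have := lerB_dist (x / 2) (x / 2 - sin (x / 2)); rewrite subKr.
  rewrite [`|x / 2|]normrM [`|2^-1|]gtr0_norm ?invr_gt0// in K *.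
  have -> : `|x / 2 - sin (x / 2)| = `|sin (x / 2) - x / 2| by rewrite distrC.
  by lra.
have : (`|x| / 4) ^+ 2 <= `|sin (x / 2)| ^+ 2.
  by rewrite ler_pXn2r// nnegrE divr_ge0.
by rewrite expr_div_n !real_normK ?num_real//; lra.
Qed.

Lemma cos_far (r x : R) : 0 < r -> r <= `|x| -> `|x| <= 2 * pi - r ->
  cos x <= cos r.
Proof.
move=> r0 rx xr; rewrite -(cos_norm x).
have le_cos : {in `[0, pi] &, forall x y : R, x <= y -> cos y <= cos x}.
  move=> a b aI bI; rewrite le_eqVlt => /predU1P[->//|ab].
  by apply: ltW; rewrite ltr_cos.
have rpi : r <= pi by lra.
have [xpi|xpi] := leP `|x| pi.
  by apply: le_cos => //; rewrite in_itv/=; apply/andP; split => //; rewrite ltW.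
have -> : cos `|x| = cos (2 * pi - `|x|).
  have := cosD2pi (`|x| - pi *+ 2); rewrite subrK => ->.
  by rewrite -cosN opprB mulr_natl.
by apply: le_cos; rewrite ?in_itv/=; try apply/andP; try split; lra.
Qed.

Variables (U : R * R -> R) (phi : R -> R).
Hypothesis mphi : measurable_fun setT phi.
Hypothesis iphi : mu.-integrable T (EFin \o phi).
Hypothesis Uphi : forall u v, u ^+ 2 + v ^+ 2 < 1 ->
  \int[mu]_(t in T) (Pk u v (cos t) (sin t) * phi t) = U (u, v) * (2 * pi).

Section at_point.
Variable t0 : R.
Hypothesis t0T : 0 < t0 < 2 * pi.

Let psi y := `|phi y - phi t0|.

Let psi_ge0 y : 0 <= psi y. Proof. exact: normr_ge0. Qed.

Let mpsi : measurable_fun setT psi.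
Proof.
apply: measurableT_comp => //; apply: measurable_funB => //.
Qed.

Let J (A : set R) := (\int[mu]_(y in A) (psi y)%:E)%E.

(** As t0 is interior to T, small balls around it stay in T, where the restriction of phi agrees
    with phi. *)
Lemma lebesgue_pt_avg : lebesgue_pt (phi \_ T) t0 -> forall e : R, 0 < e ->
  exists2 r0 : R, 0 < r0 & forall r, 0 < r -> r < r0 ->
   (J (ball t0 r) <= (2 * r * e)%:E)%E.
Proof.
move=> L e e0; have /andP[t1 t2] := t0T.
have : \forall r \near 0^'+, (davg (phi \_ T) t0 r < e%:E)%E.
  have /fine_cvgP[L1 /cvgr0Pnorm_lt /(_ _ e0) L2] := L.
  near=> r; rewrite -[davg _ _ _]fineK; last by near: r.
  rewrite lte_fin; apply: le_lt_trans (ler_norm _) _; by near: r.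
move=> [d /= d0 H].
exists (Num.min d (Num.min t0 (2 * pi - t0))).
  by rewrite !lt_min d0 t1 subr_gt0.
move=> r r0; rewrite !lt_min => /andP[rd /andP[rt0 rt1]].
have : (davg (phi \_ T) t0 r < e%:E)%E.
  by apply: H => //=; rewrite sub0r normrN gtr0_norm.
have mub : mu (ball t0 r) = (2 * r)%:E.
  have := lebesgue_measure_ball t0 (ltW r0); rewrite mulr_natl; exact.
rewrite /davg /iavg mub => /ltW.
rewrite inver gt_eqF ?mulr_gt0// lee_pdivrMl ?mulr_gt0// -EFinM.
apply: le_trans; rewrite le_eqVlt; apply/orP; left; apply/eqP.
have inT y : ball t0 r y -> y \in T.
  rewrite /ball/= distrC ltr_norml => /andP[y1 y2]; apply/mem_set => /=.
  by rewrite in_itv/=; apply/andP; split; lra.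
apply: eq_integral => y /set_mem yB /=.
rewrite !patchE inT// inT//; exact: ballxx.
Unshelve. all: by end_near. Qed.

Let I u v (A : set R) := (\int[mu]_(y in A) (Pk u v (cos y) (sin y) * psi y)%:E)%E.

Let mPk u v : u ^+ 2 + v ^+ 2 < 1 -> measurable_fun setT (fun y => Pk u v (cos y) (sin y)).
Proof. by move=> uv; apply: continuous_measurable_fun; exact: Pk_continuous. Qed.

Let mI u v : u ^+ 2 + v ^+ 2 < 1 ->
  measurable_fun setT (fun y => (Pk u v (cos y) (sin y) * psi y)%:E).
Proof. by move=> uv; apply/measurable_EFinP; apply: measurable_funM => //; exact: mPk. Qed.

Let I_ge0 u v y : u ^+ 2 + v ^+ 2 < 1 -> (0 <= (Pk u v (cos y) (sin y) * psi y)%:E)%E.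
Proof.
by move=> uv; rewrite lee_fin mulr_ge0// ltW// Pk_gt0// cos2Dsin2.
Qed.

Let I_le u v (A : set R) (c : R) : u ^+ 2 + v ^+ 2 < 1 -> measurable A -> 0 <= c ->
  (forall y, A y -> Pk u v (cos y) (sin y) <= c) -> (I u v A <= c%:E * J A)%E.
Proof.
move=> uv mA c0 Pc; rewrite /I /J -ge0_integralZl//; last 2 first.
- by apply: measurable_funTS; apply/measurable_EFinP.
- by move=> y _; rewrite lee_fin.
apply: ge0_le_integral => //.
- by move=> y _; exact: I_ge0.
- by apply: measurable_funTS; exact: mI.
- by apply: measurable_funTS; apply/measurable_EFinP; apply: measurable_funM.
- by move=> y Ay; rewrite -EFinM lee_fin ler_wpM2r// Pc.
Qed.

Let J_le (A B : set R) : measurable A -> measurable B -> A `<=` B -> (J A <= J B)%E.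
Proof.
move=> mA mB AB; apply: ge0_subset_integral => //.
- by apply: measurable_funTS; apply/measurable_EFinP.
- by move=> y _; rewrite lee_fin.
Qed.

Let I_split u v (A B : set R) : u ^+ 2 + v ^+ 2 < 1 -> measurable A -> measurable B ->
  A `<=` B -> I u v B = (I u v A + I u v (B `\` A))%E.
Proof.
move=> uv mA mB AB; rewrite /I -ge0_integral_setU//.
- by rewrite setDUK.
- exact: measurableD.
- by apply: measurable_funTS; exact: mI.
- by move=> y _; exact: I_ge0.
- by apply/disj_setPS => y [? [_]].
Qed.

(** |a - b|^2 <= 2 |a|^2 + 2 |b|^2 through the point z, whose distance to e^{i t0} is at most K (1 -
    |z|^2). *)
Let chord_triangle u v y (K : R) :
  (cos t0 - u) ^+ 2 + (sin t0 - v) ^+ 2 <= K ^+ 2 * (1 - u ^+ 2 - v ^+ 2) ^+ 2 ->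
  2 - 2 * cos (y - t0) <= 2 * ((cos y - u) ^+ 2 + (sin y - v) ^+ 2)
    + 2 * K ^+ 2 * (1 - u ^+ 2 - v ^+ 2) ^+ 2.
Proof.
move=> H; rewrite -chord_cos.
have h1 := sqr_ge0 (cos y - u + (cos t0 - u)).
have h2 := sqr_ge0 (sin y - v + (sin t0 - v)).
nra.
Qed.

(** Dyadic decomposition around t0 at scale lam n = 2^n 4 K del. On the central ball the kernel is
    at most 4 / del, which yields 32 K e. On the ring between lam n and lam (n+1) it is at most 16
    del / lam(n)^2, while the mass of psi is at most 4 lam(n) e; the product is 16 2^-n e / K, and
    the sum of 16 2^-k for k < n is 32 (1 - 2^-n). *)
Lemma poisson_near u v (K e r0 : R) : u ^+ 2 + v ^+ 2 < 1 -> 1 <= K -> 0 < e ->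
  (cos t0 - u) ^+ 2 + (sin t0 - v) ^+ 2 <= K ^+ 2 * (1 - u ^+ 2 - v ^+ 2) ^+ 2 ->
  (forall x, `|x| < r0 -> x ^+ 2 / 4 <= 2 - 2 * cos x) ->
  (forall r, 0 < r -> r < r0 -> (J (ball t0 r) <= (2 * r * e)%:E)%E) ->
  forall n : nat, 2 ^+ n * (4 * K * (1 - u ^+ 2 - v ^+ 2)) < r0 ->
  (I u v (ball t0 (2 ^+ n * (4 * K * (1 - u ^+ 2 - v ^+ 2))))
    <= ((32 * K + 32 * (1 - 2 ^- n)) * e)%:E)%E.
Proof.
move=> uv K1 e0 zt cosb HJ.
have K0 : 0 < K by lra.
set del := 1 - u ^+ 2 - v ^+ 2.
have del0 : 0 < del by rewrite /del; have := uv; lra.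
pose lam (n : nat) := 2 ^+ n * (4 * K * del).
have lam0 n : 0 < lam n by rewrite /lam mulr_gt0 ?exprn_gt0// mulr_gt0// mulr_gt0.
have lamS n : lam n.+1 = 2 * lam n by rewrite /lam exprS; ring.
elim => [|n IH] lamr0.
  apply: le_trans (@I_le u v _ (4 / del) uv (measurable_ball _ _) _ _) _.
  - by rewrite divr_ge0// ltW.
  - move=> y _; have := chord_ge (ltW uv) (cos2Dsin2 y); rewrite -/del => H.
    rewrite /Pk -/del ler_pdivrMr ?chord_gt0 ?cos2Dsin2//.
    rewrite mulrAC ler_pdivlMr// -expr2; lra.
  - have := HJ _ (lam0 0%N) lamr0; rewrite -/(lam 0%N) => H.
    apply: le_trans (lee_wpmul2l _ H) _; first by rewrite lee_fin divr_ge0// ltW.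
    rewrite -EFinM lee_fin /lam !expr0 invr1 subrr mulr0 addr0 mul1r.
    by rewrite (_ : 4 / del * _ = 32 * K * e)//; field; rewrite lt0r_neq0.
have lamr : lam n < r0 by move: lamr0; rewrite -/(lam n.+1) lamS; have := lam0 n; lra.
have {}IH := IH lamr; rewrite -/(lam n) in IH.
rewrite -/(lam n.+1) in lamr0 *.
have SB : (ball t0 (lam n) : set R) `<=` ball t0 (lam n.+1).
  by apply: le_ball; rewrite lamS; have := lam0 n; lra.
rewrite (I_split uv (measurable_ball _ _) (measurable_ball _ _) SB).
have -> : ((32 * K + 32 * (1 - 2 ^- n.+1)) * e)%:E =
    (((32 * K + 32 * (1 - 2 ^- n)) * e)%:E + (16 * 2 ^- n * e)%:E)%E.
  rewrite -EFinD; congr EFin; rewrite exprS invfM; field.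
  by rewrite expf_neq0.
apply: leeD => //.
have mD : measurable (ball t0 (lam n.+1) `\` ball t0 (lam n) : set R).
  by apply: measurableD; exact: measurable_ball.
(* The factor 4 K in the scale serves here: the term 2 K^2 del^2 of [chord_triangle] is at most
   lam(n)^2 / 8, half of the lower bound lam(n)^2 / 4 for the chord. *)
apply: le_trans (@I_le u v _ (16 * del / lam n ^+ 2) uv mD _ _) _.
- by rewrite divr_ge0 ?sqr_ge0// mulr_ge0// ltW.
- move=> y [yB /negP yB']; move: yB yB'; rewrite /ball/= -leNgt => yB yB'.
  rewrite distrC in yB yB'.
  have yr0 : `|y - t0| < r0 by apply: lt_trans lamr0.
  have := chord_triangle y zt; rewrite -/del.
  have := cosb _ yr0.
  set D := _ ^+ 2 + (sin y - v) ^+ 2; set x2 := (y - t0) ^+ 2 => h1 h2.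
  have x2l : lam n ^+ 2 <= x2.
    by rewrite /x2 -[leRHS]real_normK ?num_real// ler_pXn2r// nnegrE ltW.
  have lamd : (4 * K * del) ^+ 2 <= lam n ^+ 2.
    rewrite ler_pXn2r ?nnegrE ?(ltW (lam0 n))//; last by rewrite !mulr_ge0// ltW.
    by rewrite /lam ler_peMl ?exprn_ege1 ?ler1n// !mulr_ge0// ltW.
  have lamd' : (4 * K * del) ^+ 2 = 16 * (K ^+ 2 * del ^+ 2) by ring.
  have D16 : lam n ^+ 2 / 16 <= D by rewrite lamd' in lamd; lra.
  have l20 : 0 < lam n ^+ 2 by rewrite exprn_gt0.
  have D0 : 0 < D by lra.
  rewrite /Pk -/del -/D ler_pdivrMr// mulrAC ler_pdivlMr//.
  have := ler_wpM2l (ltW del0) D16; lra.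
- have := HJ _ (lam0 n.+1) lamr0 => H.
  have JD : (J (ball t0 (lam n.+1) `\` ball t0 (lam n)) <= (2 * lam n.+1 * e)%:E)%E.
    by apply: le_trans H; apply: J_le => //; exact: measurable_ball.
  apply: le_trans (lee_wpmul2l _ JD) _.
    by rewrite lee_fin divr_ge0 ?sqr_ge0// mulr_ge0// ltW.
  rewrite -EFinM lee_fin lamS.
  have -> : 16 * del / lam n ^+ 2 * (2 * (2 * lam n) * e) = (16 * 2 ^- n * e) / K.
    rewrite /lam; field.
    by rewrite !lt0r_neq0 ?exprn_gt0.
  by rewrite ler_pdivrMr// ler_peMr// !mulr_ge0 ?invr_ge0 ?exprn_ge0// ltW.
Qed.

Let J_fin : exists2 C : R, 0 < C & (J T <= C%:E)%E.
Proof.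
have H : mu.-integrable T (fun y => (psi y)%:E).
  apply: (@le_integrable _ _ _ mu T (measurable_itv _) _ (fun y => (`|phi y|)%:E + (`|phi t0|)%:E)%E).
  - by apply: measurable_funTS; apply/measurable_EFinP.
  - move=> y _ /=; rewrite lee_fin ger0_norm// [leRHS]ger0_norm ?addr_ge0//.
    exact: ler_normB.
  - apply: integrableD => //; first by have := integrable_abse iphi.
    exact: (contin_integrable (@contin_cst R 0 (2 * pi) `|phi t0|)).
have F : (J T \is a fin_num)%E by apply: integrable_fin_num.
exists (fine (J T) + 1).
  by rewrite ltr_wpDl// fine_ge0// integral_ge0// => y _; rewrite lee_fin.
by rewrite -[leLHS]fineK// lee_fin lerDl.
Qed.

(** The kernel is positive with mass 2 pi, so U(z) - phi(t0) is the Poisson mean of phi -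
    phi(t0). *)
Let P_int u v : u ^+ 2 + v ^+ 2 < 1 ->
  ((`|U (u, v) - phi t0| * (2 * pi))%:E <= I u v T)%E.
Proof.
move=> uv.
have cP := @continuous_contin R 0 (2 * pi) _ (Pk_continuous uv).
have [C HC] := contin_bounded (pi2_ge0 R) cP.
have iP := contin_integrable cP.
have iPphi : mu.-integrable T (EFin \o (fun t => Pk u v (cos t) (sin t) * phi t)).
  apply: (@le_integrable _ _ _ mu T (measurable_itv _) _ (fun t => C%:E * (phi t)%:E)%E).
  - apply/measurable_EFinP; apply: measurable_funTS; apply: measurable_funM => //.
    exact: mPk.
  - move=> y yT /=; rewrite lee_fin (normrM (Pk u v _ _)) (normrM C) ler_wpM2r//.
    by rewrite (le_trans (HC _ _)) ?ler_norm//; move: yT; rewrite /= in_itv.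
  - exact: integrableZl.
have iPc : mu.-integrable T (EFin \o (fun t => Pk u v (cos t) (sin t) * phi t0)).
  apply: (contin_integrable (k := fun t => Pk u v (cos t) (sin t) * phi t0)).
  exact: (continM cP (@contin_cst R 0 (2 * pi) (phi t0))).
have E : (U (u, v) - phi t0) * (2 * pi) =
  \int[mu]_(t in T) (Pk u v (cos t) (sin t) * phi t - Pk u v (cos t) (sin t) * phi t0).
  by rewrite RintegralB// Uphi// RintegralZr// Pk_int// mulrBl [phi t0 * _]mulrC.
have E' : `|U (u, v) - phi t0| * (2 * pi) = `|(U (u, v) - phi t0) * (2 * pi)|.
  by rewrite normrM (ger0_norm (pi2_ge0 R)).
rewrite E' E.
have iB : mu.-integrable T (EFin \o (fun t => Pk u v (cos t) (sin t) * phi t - Pk u v (cos t) (sin t) * phi t0)).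
  have h := @integrableB _ _ _ mu T (measurable_itv _) _ _ iPphi iPc.
  by apply: eq_integrable h => // y _; rewrite /= EFinB.
rewrite (@EFin_normr_Rintegral _ _ _ mu T _ (measurable_itv _) iB).
apply: (le_trans (le_abse_integral _ _ _)) => //; first exact: (measurable_int mu iB).
rewrite /I le_eqVlt; apply/orP; left; apply/eqP; apply: eq_integral => y _ /=.
by rewrite -mulrBr normrM ger0_norm// ltW// Pk_gt0// cos2Dsin2.
Qed.

(** Near t0 the dyadic estimate applies up to a fixed radius between r0 / 2 and r0; away from t0 the
    kernel tends to 0 with 1 - |z|^2, uniformly. *)
Theorem fatou_nontangential (K e : R) : lebesgue_pt (phi \_ T) t0 -> 1 <= K -> 0 < e ->
  exists2 eta : R, 0 < eta & forall u v, u ^+ 2 + v ^+ 2 < 1 ->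
    (cos t0 - u) ^+ 2 + (sin t0 - v) ^+ 2 <= K ^+ 2 * (1 - u ^+ 2 - v ^+ 2) ^+ 2 ->
    1 - u ^+ 2 - v ^+ 2 < eta -> `|U (u, v) - phi t0| <= e.
Proof.
move=> L K1 e0; have /andP[t1 t2] := t0T; have K0 : 0 < K by lra.
(* The near part costs at most (32 K + 32) e' <= 64 K e', the far part e'. *)
pose e' : R := e / (64 * K + 1).
have K64 : 0 < 64 * K + 1 by lra.
have e'0 : 0 < e' by rewrite divr_gt0.
have [r1 r10 H1] := cos_near0; have [r2 r20 H2] := lebesgue_pt_avg L e'0.
pose r0 : R := Num.min (Num.min r1 r2) (Num.min t0 (2 * pi - t0)).
have r00 : 0 < r0 by rewrite !lt_min r10 r20 t1 subr_gt0.
have [ra [rb [rc rd]]] : r0 <= r1 /\ r0 <= r2 /\ r0 <= t0 /\ r0 <= 2 * pi - t0.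
  by rewrite /r0 !ge_min !lexx ?orbT.
pose c0 : R := 2 - 2 * cos (r0 / 2).
have c00 : 0 < c0.
  apply: lt_le_trans (H1 _ _); first by rewrite !divr_gt0// exprn_gt0// divr_gt0.
  by rewrite gtr0_norm ?divr_gt0//; lra.
have [C C0 JC] := J_fin.
(* The four bounds give in turn del^2 <= del, a central ball of radius below r0, a chord with square
   at least c0 / 4 away from t0, and a far part of at most e'. *)
pose eta : R := Num.min (Num.min 1 (r0 / (4 * K))) (Num.min (c0 / (4 * K ^+ 2)) (e' * c0 / (4 * C))).
exists eta.
  have p1 : 0 < r0 / (4 * K) by apply: divr_gt0 => //; apply: mulr_gt0.
  have p2 : 0 < c0 / (4 * K ^+ 2) by apply: divr_gt0 => //; apply: mulr_gt0 => //; exact: exprn_gt0.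
  have p3 : 0 < e' * c0 / (4 * C) by apply: divr_gt0; apply: mulr_gt0.
  by rewrite !lt_min ltr01 p1 p2 p3.
move=> u v uv zt; set del := 1 - u ^+ 2 - v ^+ 2.
have del0 : 0 < del by rewrite /del; have := uv; lra.
rewrite !lt_min => /andP[/andP[del1 delr] /andP[delc dele]].
rewrite ltr_pdivlMr ?mulr_gt0// in delr.
rewrite ltr_pdivlMr ?mulr_gt0 ?exprn_gt0// in delc.
rewrite ltr_pdivlMr ?mulr_gt0// in dele.
pose lam (n : nat) := 2 ^+ n * (4 * K * del).
have lam00 : 0 < 4 * K * del by rewrite mulr_gt0 ?mulr_gt0.
have exn : exists n, r0 <= lam n.
  exists (Num.bound (r0 / (4 * K * del))); rewrite /lam -ler_pdivrMr//.
  apply: ltW; apply: lt_trans (archi_boundP _) _; first by rewrite divr_ge0 ?ltW.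
  by rewrite -natrX ltr_nat; exact: ltn_expl.
(* Minimality of n+1 puts the n-th radius in [r0 / 2, r0). *)
case: (ex_minnP exn) => -[|n] rn minn.
  by move: rn; rewrite /lam expr0 mul1r; lra.
have lamn : lam n < r0 by rewrite ltNge; apply/negP => /minn; rewrite ltnn.
have lamn2 : r0 / 2 <= lam n.
  by move: rn; rewrite /lam exprS; move: (lamn); rewrite /lam; lra.
have lamn0 : 0 < lam n by rewrite mulr_gt0// exprn_gt0.
have I1 := @poisson_near u v K e' r0 uv K1 e'0 zt
  (fun x h => H1 x (lt_le_trans h ra)) (fun r h h' => H2 r h (lt_le_trans h' rb)) n lamn.
rewrite -/del -/(lam n) in I1.
have ballT : (ball t0 (lam n) : set R) `<=` T.
  move=> y; rewrite /ball/= distrC ltr_norml => /andP[y1 y2].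
  by rewrite in_itv/=; apply/andP; split; lra.
have mD : measurable (T `\` ball t0 (lam n) : set R).
  by apply: measurableD; [exact: measurable_itv|exact: measurable_ball].
have I2 : (I u v (T `\` ball t0 (lam n)) <= e'%:E)%E.
  apply: le_trans (@I_le u v _ (4 * del / c0) uv mD _ _) _.
  - by rewrite divr_ge0 ?ltW// mulr_gt0.
  - move=> y [yT /negP yB]; move: yT yB; rewrite /ball/= -leNgt in_itv/=.
    move=> /andP[y0 y2] yB; rewrite distrC in yB.
    have yc : cos (y - t0) <= cos (r0 / 2).
      apply: cos_far; first by rewrite divr_gt0.
      - exact: le_trans yB.
      - by rewrite ler_norml; apply/andP; split; lra.
    have := chord_triangle y zt; rewrite -/del; set D := _ ^+ 2 + (sin y - v) ^+ 2 => h.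
    have dd : K ^+ 2 * del ^+ 2 <= c0 / 4.
      have : K ^+ 2 * del ^+ 2 <= K ^+ 2 * del.
        by rewrite ler_wpM2l ?sqr_ge0// expr2 ler_piMr// ltW.
      by lra.
    have Dc : c0 / 4 <= D by rewrite /c0 in dd *; lra.
    have D0 : 0 < D by lra.
    rewrite /Pk -/del -/D ler_pdivrMr// mulrAC ler_pdivlMr//.
    by have := ler_wpM2l (ltW del0) Dc; lra.
  - have JD : (J (T `\` ball t0 (lam n)) <= C%:E)%E.
      by apply: le_trans JC; apply: J_le.
    apply: le_trans (lee_wpmul2l _ JD) _.
      by rewrite lee_fin divr_ge0 ?ltW// mulr_gt0.
    by rewrite -EFinM lee_fin mulrAC ler_pdivrMr//; lra.
have := P_int uv; rewrite (I_split uv (measurable_ball _ _) (measurable_itv _) ballT).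
move=> /le_trans/(_ (leeD I1 I2)); rewrite -EFinD lee_fin => H.
have n0 : 0 <= 2 ^- n :> R by rewrite invr_ge0 exprn_ge0.
have H' : `|U (u, v) - phi t0| * (2 * pi) <= e.
  apply: le_trans H _.
  have -> : e = (64 * K + 1) * e' by rewrite /e' mulrC divfK// lt0r_neq0.
  rewrite -[X in _ + X]mul1r -mulrDl ler_wpM2r ?(ltW e'0)//; lra.
have p1 : 1 <= 2 * pi :> R by have := pi_ge2 R; lra.
by apply: le_trans H'; rewrite ler_peMr.
Qed.

End at_point.
End FatouTheorem.

(** * Moebius transformations of the disc *)

Section ExpansiveMaps.
Variable R : realType.
Local Notation mu := (@lebesgue_measure R).
Variables (s : R -> R) (c : R).
Hypothesis c0 : 0 < c.
Hypothesis ms : measurable_fun setT s.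
Hypothesis exps : forall x y : R, c * `|x - y| <= `|s x - s y|.

Let mpre (A : set R) : measurable A -> measurable (s @^-1` A).
Proof. by move=> mA; rewrite -[X in measurable X]setTI; exact: ms. Qed.

(** The preimage has diameter at most (b - a) / c, so it lies in an interval of that length starting
    at its infimum. *)
Let pre_itv (a b : R) : a <= b -> (c%:E * mu (s @^-1` `]a, b]%classic) <= (b - a)%:E)%E.
Proof.
move=> ab; set S := s @^-1` _.
have SS x y : S x -> S y -> `|x - y| <= (b - a) / c.
  rewrite /S/= !in_itv/= => /andP[x1 x2] /andP[y1 y2].
  rewrite ler_pdivlMr// mulrC; apply: le_trans (exps x y) _.
  by rewrite ler_norml; apply/andP; split; lra.
have [S0|/set0P[x0 Sx0]] := eqVneq S set0.
  by rewrite S0 measure0 mule0 lee_fin subr_ge0.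
have hS : has_inf S.
  split; first by exists x0.
  exists (x0 - (b - a) / c) => y Sy; have := SS _ _ Sx0 Sy.
  by rewrite ler_norml => /andP[_]; lra.
have Sitv : S `<=` `[inf S, inf S + (b - a) / c]%classic.
  move=> x Sx /=; rewrite in_itv/=; apply/andP; split; first exact: (ge_inf hS.2).
  rewrite -lerBlDr; apply: lb_le_inf; first exact: hS.1.
  by move=> y Sy; have := SS _ _ Sx Sy; rewrite ler_norml => /andP[_]; lra.
have d0 : 0 <= (b - a) / c by rewrite divr_ge0 ?subr_ge0// ltW.
have mI : mu `[inf S, inf S + (b - a) / c]%classic = ((b - a) / c)%:E.
  have E := lebesgue_measure_itv `[inf S, inf S + (b - a) / c].
  apply: (etrans E); rewrite /= lte_fin; case: ifPn => [_|]; first by rewrite -EFinD addrAC subrr add0r.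
  by rewrite -leNgt gerDl => h; congr EFin; apply: le_anti; rewrite d0 h.
have H : (mu S <= ((b - a) / c)%:E)%E.
  rewrite -mI; apply: le_measure; rewrite ?inE//.
  by apply: mpre; exact: measurable_itv.
apply: (@le_trans _ _ (c%:E * ((b - a) / c)%:E)%E).
  by apply: lee_wpmul2l => //; rewrite lee_fin ltW.
by rewrite -EFinM lee_fin mulrC divfK// lt0r_neq0.
Qed.

(** Lebesgue measure is the infimum over countable covers by half-open intervals, and preimages of
    those are controlled by [pre_itv]. *)
Lemma expansive_measure (A : set R) : measurable A ->
  (mu (s @^-1` A) <= (c^-1)%:E * mu A)%E.
Proof.
move=> mA.
suff : (c%:E * mu (s @^-1` A) <= mu A)%E.
  by rewrite -lee_pdivrMl ?invr_gt0// invrK.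
rewrite [X in (_ <= X)%E]/lebesgue_measure /lebesgue_stieltjes_measure /measure_extension /mu_ext.
apply: le_ereal_inf_tmp => _ [F [mF AF] <-].
have mF' k : measurable (F k : set R).
  by have := mF k; rewrite /measurable/=; exact: sub_sigma_algebra.
have H1 : (mu (s @^-1` A) <= \sum_(k <oo) mu (s @^-1` (F k)))%E.
  apply: measure_sigma_subadditive.
  - by move=> k; exact: mpre.
  - exact: mpre.
  - by move=> x /AF[k _ Fx]; exists k.
apply: le_trans (lee_wpmul2l _ H1) _; first by rewrite lee_fin ltW.
rewrite -nneseriesZl//; apply: lee_nneseries => [k _ _|k _].
  by rewrite mule_ge0// lee_fin ltW.
have := mF k; rewrite /measurable/= => /ocitvP[->|[[a b] /= ab ->]].
  by rewrite preimage_set0 measure0 mule0 wlength0.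
apply: le_trans (pre_itv (ltW ab)) _.
by rewrite wlength_itv_bnd// ltW.
Qed.

Lemma expansive_null (A : set R) : measurable A -> mu A = 0 -> mu (s @^-1` A) = 0.
Proof.
move=> mA A0; apply/eqP; rewrite eq_le measure_ge0 andbT.
by apply: le_trans (expansive_measure mA) _; rewrite A0 mule0.
Qed.

(** The pushforward of Lebesgue measure under s is dominated by 1 / c times Lebesgue measure. *)
Lemma expansive_integral (D : set R) (h : R -> \bar R) : measurable D ->
  measurable_fun setT h -> (forall x, (0 <= h x)%E) ->
  (\int[mu]_(x in s @^-1` D) h (s x) <= (c^-1)%:E * \int[mu]_(x in D) h x)%E.
Proof.
move=> mD mh h0.
have ci : 0 <= c^-1 by rewrite invr_ge0 ltW.
have ms' : @measurable_fun _ _ (measurableTypeR R) (measurableTypeR R) setT s := ms.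
have := @ge0_integral_pushforward _ _ (measurableTypeR R) (measurableTypeR R) R s ms' mu D h mD (measurable_funTS mh).
move=> /(_ (fun x _ => h0 x)) <-.
rewrite -[(c^-1)]/((NngNum ci)%:num) -ge0_integral_mscale//; last exact: measurable_funTS.
apply: ge0_le_measure_integral => // S mS /=.
exact: expansive_measure.
Qed.

End ExpansiveMaps.

(** * The map T in real coordinates, inside the disc and on the circle *)

Section Moebius.
Variable R : realType.
Implicit Types (p q u v x y t r : R).

(* $T_a(z) = (z + a) / (1 + \bar a z)$ for $a = p + iq$ *)
Definition mob_x p q (z : R * R) : R :=
  (z.1 + p) * cinv_x (- p) (- q) z - (z.2 + q) * cinv_y (- p) (- q) z.
Definition mob_y p q (z : R * R) : R :=
  (z.1 + p) * cinv_y (- p) (- q) z + (z.2 + q) * cinv_x (- p) (- q) z.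

(* $|1 + \bar a z|^2$ for $a = p + iq$ and $z = u + iv$ *)
Definition mden p q u v : R := (1 + (p * u + q * v)) ^+ 2 + (p * v - q * u) ^+ 2.

Lemma mdenE p q u v :
  cden_x (- p) (- q) (u, v) ^+ 2 + cden_y (- p) (- q) (u, v) ^+ 2 = mden p q u v.
Proof. by rewrite /cden_x /cden_y /mden /=; ring. Qed.

Section parameter.
Variables p q : R.
Hypothesis pq : p ^+ 2 + q ^+ 2 < 1.
Local Notation da := (1 - p ^+ 2 - q ^+ 2).

Let pqN : (- p) ^+ 2 + (- q) ^+ 2 < 1. Proof. by rewrite !sqrrN. Qed.

Let da_gt0 : 0 < da. Proof. by have := pq; lra. Qed.

Let cs_sqr u v : (p * u + q * v) ^+ 2 <= (p ^+ 2 + q ^+ 2) * (u ^+ 2 + v ^+ 2).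
Proof. by have := sqr_ge0 (p * v - q * u); lra. Qed.

(** As in [chord_ge]: |1 + conj(a) z|^2 |1 - conj(a) z|^2 >= (1 - |a|^2 |z|^2)^2, where the second
    factor is at most 4 and |z| <= 1. *)
Lemma mden_ge u v : u ^+ 2 + v ^+ 2 <= 1 -> da ^+ 2 / 4 <= mden p q u v.
Proof.
move=> uv; have cs := cs_sqr u v; set s := p * u + q * v in cs.
have -> : mden p q u v = 1 + 2 * s + (p ^+ 2 + q ^+ 2) * (u ^+ 2 + v ^+ 2).
  by rewrite /mden /s; ring.
set M := (p ^+ 2 + q ^+ 2) * (u ^+ 2 + v ^+ 2) in cs *.
have A0 : 0 <= p ^+ 2 + q ^+ 2 by rewrite addr_ge0 ?sqr_ge0.
have B0 : 0 <= u ^+ 2 + v ^+ 2 by rewrite addr_ge0 ?sqr_ge0.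
have M1 : M <= p ^+ 2 + q ^+ 2 by rewrite /M ler_piMr.
have M0 : 0 <= M by rewrite mulr_ge0.
have H : (1 - M) ^+ 2 <= (1 + M - 2 * s) * (1 + M + 2 * s) by nra.
have s1 : s <= 1 by have := pq; nra.
have s2 : - 1 <= s by have := pq; nra.
have X0 : 0 <= 1 + M + 2 * s by have := sqr_ge0 (1 + s); nra.
have H2 : (1 + M - 2 * s) * (1 + M + 2 * s) <= 4 * (1 + M + 2 * s).
  by rewrite ler_wpM2r//; have := pq; lra.
have H3 : da ^+ 2 <= (1 - M) ^+ 2.
  by rewrite ler_pXn2r ?nnegrE//; have := pq; lra.
lra.
Qed.

Lemma mden_gt0 u v : u ^+ 2 + v ^+ 2 <= 1 -> 0 < mden p q u v.
Proof.
move=> uv; apply: lt_le_trans (mden_ge uv).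
by rewrite divr_gt0// exprn_gt0.
Qed.

Lemma mden_le u v : u ^+ 2 + v ^+ 2 <= 1 -> mden p q u v <= 4.
Proof.
move=> uv; have cs := cs_sqr u v; set s := p * u + q * v in cs.
have -> : mden p q u v = 1 + 2 * s + (p ^+ 2 + q ^+ 2) * (u ^+ 2 + v ^+ 2).
  by rewrite /mden /s; ring.
set M := (p ^+ 2 + q ^+ 2) * (u ^+ 2 + v ^+ 2) in cs *.
have A0 : 0 <= p ^+ 2 + q ^+ 2 by rewrite addr_ge0 ?sqr_ge0.
have M1 : M <= p ^+ 2 + q ^+ 2 by rewrite /M ler_piMr.
have s1 : s <= 1 by have := pq; nra.
by have := pq; lra.
Qed.

Lemma CR_mob u v : u ^+ 2 + v ^+ 2 <= 1 -> CR (mob_x p q) (mob_y p q) (u, v).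
Proof.
move=> uv; apply: CR_mul; last exact: CR_cinv.
by apply: CR_eq (CR_affine 1 0 p q _) => z; rewrite /=; ring.
Qed.

Lemma mobE u v : u ^+ 2 + v ^+ 2 <= 1 ->
  mob_x p q (u, v) = ((u + p) * (1 + (p * u + q * v)) + (v + q) * (p * v - q * u)) / mden p q u v
  /\ mob_y p q (u, v) = ((v + q) * (1 + (p * u + q * v)) - (u + p) * (p * v - q * u)) / mden p q u v.
Proof.
move=> uv; rewrite /mob_x /mob_y /cinv_x /cinv_y mdenE /cden_x /cden_y /=.
by split; rewrite !mulrA -?mulrBl -?mulrDl; congr (_ / _); ring.
Qed.

Lemma mob_sqr u v : u ^+ 2 + v ^+ 2 <= 1 ->
  1 - mob_x p q (u, v) ^+ 2 - mob_y p q (u, v) ^+ 2 =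
  da * (1 - u ^+ 2 - v ^+ 2) / mden p q u v.
Proof.
move=> uv; have [-> ->] := mobE uv; have N0 := lt0r_neq0 (mden_gt0 uv).
by rewrite /mden in N0 *; field.
Qed.

Lemma mob_disc u v : u ^+ 2 + v ^+ 2 < 1 ->
  mob_x p q (u, v) ^+ 2 + mob_y p q (u, v) ^+ 2 < 1.
Proof.
move=> uv; have := mob_sqr (ltW uv).
have : 0 < da * (1 - u ^+ 2 - v ^+ 2) / mden p q u v.
  by rewrite divr_gt0 ?mden_gt0 ?(ltW uv)// mulr_gt0//; lra.
lra.
Qed.

Lemma mob_circle x y : x ^+ 2 + y ^+ 2 = 1 ->
  mob_x p q (x, y) ^+ 2 + mob_y p q (x, y) ^+ 2 = 1.
Proof.
move=> xy; have xy1 : x ^+ 2 + y ^+ 2 <= 1 by rewrite xy.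
have := mob_sqr xy1; rewrite (_ : 1 - x ^+ 2 - y ^+ 2 = 0); last by lra.
by rewrite mulr0 mul0r; lra.
Qed.

Lemma mob_dist u v x y : u ^+ 2 + v ^+ 2 <= 1 -> x ^+ 2 + y ^+ 2 <= 1 ->
  (mob_x p q (x, y) - mob_x p q (u, v)) ^+ 2 + (mob_y p q (x, y) - mob_y p q (u, v)) ^+ 2 =
  ((x - u) ^+ 2 + (y - v) ^+ 2) * da ^+ 2 / (mden p q u v * mden p q x y).
Proof.
move=> uv xy; have [-> ->] := mobE uv; have [-> ->] := mobE xy.
have N0 := lt0r_neq0 (mden_gt0 uv); have M0 := lt0r_neq0 (mden_gt0 xy).
by rewrite /mden in N0 M0 *; field; rewrite N0 M0.
Qed.

(** Conformal covariance of the Poisson kernel; [mden p q x y / da] is 1 / |T'| at the boundary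
    point. *)
Lemma Pk_mob u v x y : u ^+ 2 + v ^+ 2 < 1 -> x ^+ 2 + y ^+ 2 = 1 ->
  Pk (mob_x p q (u, v)) (mob_y p q (u, v)) (mob_x p q (x, y)) (mob_y p q (x, y)) =
  Pk u v x y * (mden p q x y / da).
Proof.
move=> uv xy; have xy1 : x ^+ 2 + y ^+ 2 <= 1 by rewrite xy.
rewrite /Pk mob_sqr ?(ltW uv)// mob_dist ?(ltW uv)//.
have N0 := lt0r_neq0 (mden_gt0 (ltW uv)); have M0 := lt0r_neq0 (mden_gt0 xy1).
have D0 := lt0r_neq0 (chord_gt0 uv xy); have d0 := lt0r_neq0 da_gt0.
by field; rewrite N0 M0 D0 d0.
Qed.

(** By [mob_sqr] and [mob_dist] the right side is the left side times 16 (1 + r)^2 M / (N da^2),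
    which is at least 1 because N <= 4 and M >= da^2 / 4. *)
Lemma mob_nontangential t r : 0 < r < 1 ->
  (mob_x p q (cos t, sin t) - mob_x p q (r * cos t, r * sin t)) ^+ 2
  + (mob_y p q (cos t, sin t) - mob_y p q (r * cos t, r * sin t)) ^+ 2
  <= (4 / da) ^+ 2 * (1 - mob_x p q (r * cos t, r * sin t) ^+ 2
                        - mob_y p q (r * cos t, r * sin t) ^+ 2) ^+ 2.
Proof.
move=> /andP[r0 r1].
have r01 : 0 <= r < 1 by rewrite ltW.
have cs1 : cos t ^+ 2 + sin t ^+ 2 <= 1 by rewrite cos2Dsin2.
have rcs := ltW (disc_polar t r01).
rewrite mob_dist// mob_sqr//.
have N0 := mden_gt0 rcs; have M0 := mden_gt0 cs1.
set N := mden _ _ (r * _) _ in N0 *; set M := mden _ _ _ _ in M0 *.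
have -> : (cos t - r * cos t) ^+ 2 + (sin t - r * sin t) ^+ 2 = (1 - r) ^+ 2.
  transitivity ((1 - r) ^+ 2 * (cos t ^+ 2 + sin t ^+ 2)); first by ring.
  by rewrite cos2Dsin2 mulr1.
have -> : 1 - (r * cos t) ^+ 2 - (r * sin t) ^+ 2 = 1 - r ^+ 2.
  transitivity (1 - r ^+ 2 * (cos t ^+ 2 + sin t ^+ 2)); first by ring.
  by rewrite cos2Dsin2 mulr1.
have d0 := lt0r_neq0 da_gt0.
have -> : (4 / da) ^+ 2 * (da * (1 - r ^+ 2) / N) ^+ 2 =
   (1 - r) ^+ 2 * da ^+ 2 / (N * M) * (16 * (1 + r) ^+ 2 * M / (N * da ^+ 2)).
  by field; rewrite d0 !lt0r_neq0.
apply: ler_peMr.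
  by apply: divr_ge0; [rewrite mulr_ge0 ?sqr_ge0|rewrite mulr_ge0 ?(ltW N0) ?(ltW M0)].
rewrite ler_pdivlMr ?mulr_gt0 ?exprn_gt0// mul1r.
have h1 := mden_le rcs; have h2 := mden_ge cs1; rewrite -/N in h1; rewrite -/M in h2.
have dd0 : 0 <= da ^+ 2 by exact: sqr_ge0.
apply: (@le_trans _ _ (4 * da ^+ 2)); first by rewrite ler_wpM2r.
apply: (@le_trans _ _ (16 * M)); first by lra.
rewrite ler_wpM2r ?(ltW M0)//; apply: ler_peMr => //.
by rewrite exprn_ege1//; lra.
Qed.

(* $T_a(e^{it}) = e^{it} c / \bar c$ with $c = 1 + a e^{-it}$, and $\arg c$ is an arctangent
   since $\mathrm{Re}\, c > 0$. *)
Definition mtau t := t + 2 * atan ((q * cos t - p * sin t) / (1 + (p * cos t + q * sin t))).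

Lemma mtau_den_gt0 t : 0 < 1 + (p * cos t + q * sin t).
Proof.
have := cs_sqr (cos t) (sin t); rewrite cos2Dsin2 mulr1 => h.
by have := pq; nra.
Qed.

Lemma mden_cs t : mden p q (cos t) (sin t) =
  (1 + (p * cos t + q * sin t)) ^+ 2 + (q * cos t - p * sin t) ^+ 2.
Proof. by rewrite /mden; congr (_ + _); ring. Qed.

Lemma cos_sin_2atan x : cos (2 * atan x) = (1 - x ^+ 2) / (1 + x ^+ 2)
  /\ sin (2 * atan x) = 2 * x / (1 + x ^+ 2).
Proof.
have x1 : 0 < 1 + x ^+ 2 by rewrite ltr_pwDl ?sqr_ge0.
have h : cos (atan x) ^+ 2 = (1 + x ^+ 2)^-1.
  by rewrite cos_atan exprVn sqr_sqrtr// ltW.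
have c0 : cos (atan x) != 0 by rewrite cos_atan invr_neq0// sqrtr_eq0 -ltNge.
have s : sin (atan x) = x * cos (atan x).
  have h' := atanK x; rewrite /tan in h'.
  by rewrite -[X in _ = X * _]h' divfK.
rewrite mulr_natl cos_mulr2n sin_mulr2n s -mulr_natl -[(_ * _) *+ 2]mulr_natl.
rewrite (_ : cos (atan x) * (x * cos (atan x)) = x * cos (atan x) ^+ 2); last by ring.
by rewrite h; split; field; rewrite lt0r_neq0.
Qed.

Lemma mtauE t : cos (mtau t) = mob_x p q (cos t, sin t) /\
  sin (mtau t) = mob_y p q (cos t, sin t).
Proof.
have cs1 : cos t ^+ 2 + sin t ^+ 2 <= 1 by rewrite cos2Dsin2.
have [-> ->] := mobE cs1.
have N0 := lt0r_neq0 (mden_gt0 cs1).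
rewrite /mtau cosD sinD; set w := _ / _; have [-> ->] := cos_sin_2atan w.
have d0 := lt0r_neq0 (mtau_den_gt0 t).
have -> : 1 - w ^+ 2 = ((1 + (p * cos t + q * sin t)) ^+ 2 - (q * cos t - p * sin t) ^+ 2)
  / (1 + (p * cos t + q * sin t)) ^+ 2 by rewrite /w; field.
have -> : 1 + w ^+ 2 = mden p q (cos t) (sin t) / (1 + (p * cos t + q * sin t)) ^+ 2.
  by rewrite mden_cs /w; field.
have -> : 2 * w = 2 * (q * cos t - p * sin t) * (1 + (p * cos t + q * sin t))
  / (1 + (p * cos t + q * sin t)) ^+ 2 by rewrite /w; field.
have E2 (X : R) : X / (1 + (p * cos t + q * sin t)) ^+ 2 /
  (mden p q (cos t) (sin t) / (1 + (p * cos t + q * sin t)) ^+ 2) = X / mden p q (cos t) (sin t).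
  by field; rewrite d0 N0.
rewrite !E2 !mulrA -mulrBl -mulrDl; split; congr (_ / _).
- transitivity (((cos t + p) * (1 + (p * cos t + q * sin t)) + (sin t + q) * (p * sin t - q * cos t))
   + (cos t ^+ 2 + sin t ^+ 2 - 1) * (p * (1 + (p * cos t + q * sin t))
       - q * (q * cos t - p * sin t))); last first.
    by rewrite cos2Dsin2 subrr mul0r addr0.
  by ring.
- transitivity (((sin t + q) * (1 + (p * cos t + q * sin t)) - (cos t + p) * (p * sin t - q * cos t))
   + (cos t ^+ 2 + sin t ^+ 2 - 1) * (p * (q * cos t - p * sin t)
       + q * (1 + (p * cos t + q * sin t)))); last first.
    by rewrite cos2Dsin2 subrr mul0r addr0.
  by ring.
Qed.

(** The derivative is |T'(e^{it})|. *)
Lemma is_derive_mtau t : is_derive t 1 mtau (da / mden p q (cos t) (sin t)).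
Proof.
have d0 := lt0r_neq0 (mtau_den_gt0 t).
pose n (t : R) := q * cos t - p * sin t.
pose d (t : R) := 1 + (p * cos t + q * sin t).
have dn : is_derive t 1 n (1 - d t).
  apply: is_derive_eq; rewrite /d /GRing.scale/=; ring.
have dd : is_derive t 1 d (n t).
  apply: is_derive_eq; rewrite /n /GRing.scale/=; ring.
have dV : is_derive t 1 (fun t => (d t)^-1) (- (d t) ^- 2 * n t).
  exact: (@is_deriveV R d t (n t) 1 d0 dd).
have dq : is_derive t 1 (fun t => n t / d t) (n t * (- (d t) ^- 2 * n t) + (d t)^-1 * (1 - d t)).
  exact: is_deriveM.
have datan : is_derive (n t / d t) 1 (@atan R) (1 + (n t / d t) ^+ 2)^-1.
  exact: is_derive1_atan.
have dc := @is_derive1_comp R (@atan R) (fun t => n t / d t) t _ _ datan dq.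
have := is_deriveD (@is_derive_id R R t 1) (is_deriveZ 2 dc).
move=> h; apply: (@is_derive_eq _ _ _ _ _ _ _ _ h).
have cs1 : cos t ^+ 2 + sin t ^+ 2 <= 1 by rewrite cos2Dsin2.
have N0 := lt0r_neq0 (mden_gt0 cs1).
have NE : mden p q (cos t) (sin t) = d t ^+ 2 + n t ^+ 2 by rewrite mden_cs.
(* For c = 1 + a e^{-it}, |c|^2 = 2 Re c - (1 - |a|^2); this eliminates da from the identity to be
   checked. *)
have NE' : mden p q (cos t) (sin t) = 2 * d t - da.
  transitivity (2 * d t - da + (p ^+ 2 + q ^+ 2) * (cos t ^+ 2 + sin t ^+ 2 - 1)).
    by rewrite /mden /d; ring.
  by rewrite cos2Dsin2 subrr mulr0 addr0.
rewrite (_ : da = 2 * d t - mden p q (cos t) (sin t)); last by rewrite NE'; ring.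
rewrite NE in N0 *; rewrite /GRing.scale/=; field.
by rewrite N0.
Qed.

Lemma mtau_period t : mtau (t + 2 * pi) = mtau t + 2 * pi.
Proof. by rewrite /mtau [2 * pi]mulr_natl cosD2pi sinD2pi; ring. Qed.

Lemma mtau_continuous : continuous mtau.
Proof.
move=> t; apply: differentiable_continuous; apply/derivable1_diffP.
by case: (is_derive_mtau t).
Qed.

(** On the circle [mden] lies between da^2 / 4 and 4, so tau' lies between da / 4 and 4 / da. *)
Lemma mtau_MVT x y : x <= y ->
  da / 4 * (y - x) <= mtau y - mtau x <= 4 / da * (y - x).
Proof.
rewrite le_eqVlt => /predU1P[->|xy]; first by rewrite !subrr !mulr0 lexx.
have [|c _ ->] := @MVT R mtau (fun t => da / mden p q (cos t) (sin t)) x y xy (fun t _ => is_derive_mtau t).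
  by apply: continuous_subspaceT; exact: mtau_continuous.
have cs1 : cos c ^+ 2 + sin c ^+ 2 <= 1 by rewrite cos2Dsin2.
have N0 := mden_gt0 cs1; have N1 := mden_ge cs1; have N2 := mden_le cs1.
rewrite !ler_wpM2r ?subr_ge0 ?(ltW xy)//=.
- rewrite ler_pdivrMr// mulrAC ler_pdivlMr//.
  have := da_gt0; nra.
- by rewrite ler_wpM2l ?(ltW da_gt0)// lef_pV2 ?posrE.
Qed.

Lemma mtau_expansive x y : da / 4 * `|x - y| <= `|mtau x - mtau y|.
Proof.
wlog xy : x y / x <= y.
  by move=> H; case: (leP x y) => [/H//|/ltW/H]; rewrite distrC (distrC (mtau y)).
have /andP[h _] := mtau_MVT xy.
rewrite distrC (ger0_norm (_ : 0 <= y - x)) ?subr_ge0// distrC.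
exact: le_trans h (ler_norm _).
Qed.

End parameter.
End Moebius.

(** * Circle means of a Poisson integral composed with T *)

Section HardyMoebius.
Variable R : realType.
Local Notation mu := (@lebesgue_measure R).
Local Notation T := (`[0, 2 * pi]%classic : set R).
Implicit Types (p q u v x y t s r : R).

(** On the circle T_a inverts T_{-a}. *)
Lemma mobK p q u v : p ^+ 2 + q ^+ 2 < 1 -> u ^+ 2 + v ^+ 2 = 1 ->
  mob_x p q (mob_x (- p) (- q) (u, v), mob_y (- p) (- q) (u, v)) = u /\
  mob_y p q (mob_x (- p) (- q) (u, v), mob_y (- p) (- q) (u, v)) = v.
Proof.
move=> pq uv1; have uv : u ^+ 2 + v ^+ 2 <= 1 by rewrite uv1.
have pqN : (- p) ^+ 2 + (- q) ^+ 2 < 1 by rewrite !sqrrN.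
set wx := mob_x (- p) (- q) (u, v); set wy := mob_y (- p) (- q) (u, v).
have w1 : wx ^+ 2 + wy ^+ 2 = 1 by apply: mob_circle.
have w1' : wx ^+ 2 + wy ^+ 2 <= 1 by rewrite w1.
have [-> ->] := mobE p q w1'.
have [Ex Ey] := mobE (- p) (- q) uv; rewrite -/wx -/wy in Ex Ey.
have N0 := lt0r_neq0 (mden_gt0 pqN uv).
(* [H1] and [H2] are the two parts of w + a = z (1 + conj(a) w) for w = T_{-a}(z). *)
have H1 : wx + p = u * (1 + (p * wx + q * wy)) - v * (p * wy - q * wx).
  by rewrite Ex Ey; rewrite /mden in N0 *; field.
have H2 : wy + q = u * (p * wy - q * wx) + v * (1 + (p * wx + q * wy)).
  by rewrite Ex Ey; rewrite /mden in N0 *; field.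
have M0 := lt0r_neq0 (mden_gt0 pq w1'); rewrite H1 H2.
by rewrite /mden in M0 *; split; field.
Qed.

Variables (U : R * R -> R) (phi : R -> R) (M : R).
Hypothesis cU : forall x y, x ^+ 2 + y ^+ 2 < 1 -> {for (x, y), continuous U}.
Hypothesis mphi : measurable_fun setT phi.
Hypothesis iphi : mu.-integrable T (EFin \o phi).
Hypothesis phi2 : (\int[mu]_(t in T) ((phi t) ^+ 2)%:E <= M%:E)%E.
Hypothesis Uphi : forall u v, u ^+ 2 + v ^+ 2 < 1 ->
  \int[mu]_(t in T) (Pk u v (cos t) (sin t) * phi t) = U (u, v) * (2 * pi).

Let mphi2 : measurable_fun setT (fun t => phi t ^+ 2).
Proof.
rewrite (_ : (fun t => _) = phi \* phi); last by apply/funext => t; rewrite expr2.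
exact: measurable_funM.
Qed.

Let iphi2 : mu.-integrable T (EFin \o (fun t => phi t ^+ 2)).
Proof.
apply/integrableP; split; first by apply/measurable_EFinP; exact: measurable_funTS.
under eq_integral do rewrite /= ger0_norm ?sqr_ge0//.
by apply: le_lt_trans phi2 _; rewrite ltry.
Qed.

Let integrable_boundedM (k l : R -> R) : continuous k -> mu.-integrable T (EFin \o l) ->
  mu.-integrable T (EFin \o (fun t => k t * l t)).
Proof.
move=> ck il; have [C HC] := contin_bounded (pi2_ge0 R) (@continuous_contin R 0 (2 * pi) _ ck).
have ml : measurable_fun T l by apply/measurable_EFinP; exact: (measurable_int mu il).
apply: (@le_integrable _ _ _ mu T (measurable_itv _) _ (fun t => C%:E * (l t)%:E)%E).
- apply/measurable_EFinP; apply: measurable_funM => //.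
  by apply: measurable_funTS; exact: continuous_measurable_fun.
- move=> y yT /=; rewrite lee_fin (normrM (k y)) (normrM C) ler_wpM2r//.
  by rewrite (le_trans (HC _ _)) ?ler_norm//; move: yT; rewrite /= in_itv.
- exact: integrableZl.
Qed.

(** Same expansion of a square as for [circ_jensen], now against the boundary function. *)
Lemma poisson_jensen u v : u ^+ 2 + v ^+ 2 < 1 ->
  ((U (u, v) ^+ 2 * (2 * pi))%:E <=
   \int[mu]_(s in T) (Pk u v (cos s) (sin s) * phi s ^+ 2)%:E)%E.
Proof.
move=> uv; set c := U (u, v).
have cP := Pk_continuous uv.
have I1 := integrable_boundedM cP iphi2.
have I2 := integrable_boundedM cP iphi.
have I3 := contin_integrable (@continuous_contin R 0 (2 * pi) _ cP).
rewrite -[leRHS]fineK; last exact: (integrable_fin_num _ I1).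
rewrite lee_fin -/(Rintegral mu T _).
have : 0 <= \int[mu]_(s in T) (Pk u v (cos s) (sin s) * (phi s - c) ^+ 2).
  by apply: Rintegral_ge0 => s _; rewrite mulr_ge0 ?sqr_ge0// ltW// Pk_gt0// cos2Dsin2.
have -> : \int[mu]_(s in T) (Pk u v (cos s) (sin s) * (phi s - c) ^+ 2) =
  \int[mu]_(s in T) (Pk u v (cos s) (sin s) * phi s ^+ 2 +
     ((- 2 * c) * (Pk u v (cos s) (sin s) * phi s) + c ^+ 2 * Pk u v (cos s) (sin s))).
  by apply: eq_Rintegral => s _; ring.
have cc (d : R) : continuous (fun _ : R => d) by move=> x; exact: cvg_cst.
have J2 := integrable_boundedM (cc (- 2 * c)) I2.
have J3 := integrable_boundedM (cc (c ^+ 2)) I3.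
have J23 : mu.-integrable T (EFin \o (fun s => (- 2 * c) * (Pk u v (cos s) (sin s) * phi s)
   + c ^+ 2 * Pk u v (cos s) (sin s))).
  have h := @integrableD _ _ _ mu T (measurable_itv _) _ _ J2 J3.
  by apply: eq_integrable h => // y _; rewrite /= EFinD.
rewrite RintegralD// RintegralD//.
rewrite (@RintegralZl _ _ _ mu T _ (-2 * c) (measurable_itv _) I2).
rewrite (@RintegralZl _ _ _ mu T _ (c ^+ 2) (measurable_itv _) I3) Pk_int// Uphi// -/c.
by lra.
Qed.

(* The Poisson kernel at [T z], seen from $e^{is}$, is the kernel at [z] seen from
   $T^{-1} e^{is} = e^{i \sigma(s)}$ times a bounded factor. *)
Lemma moebius_hardy p q r (e : bool) : p ^+ 2 + q ^+ 2 < 1 -> 0 <= r < 1 ->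
  let z t := (r * cos t, r * sin ((-1) ^+ e * t)) in
  (\int[mu]_(t in T) (U (mob_x p q (z t), mob_y p q (z t)) ^+ 2)%:E
    <= (4 / (1 - p ^+ 2 - q ^+ 2) * M)%:E)%E.
Proof.
move=> pq r01; set z := fun t : R => _; cbv zeta.
have pqN : (- p) ^+ 2 + (- q) ^+ 2 < 1 by rewrite !sqrrN.
set da := 1 - p ^+ 2 - q ^+ 2.
have da0 : 0 < da by rewrite /da; lra.
(* The sign covers both a point and its conjugate, the two points at which the slice extension
   evaluates the function. *)
pose sg t : R := (-1) ^+ e * t.
pose sigma := mtau (- p) (- q).
have csg t : cos (sg t) = cos t by rewrite /sg; case: e {z sg}; rewrite ?mulN1r ?cosN ?mul1r.
have zE t : z t = (r * cos (sg t), r * sin (sg t)) by rewrite csg.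
have zd t : (z t).1 ^+ 2 + (z t).2 ^+ 2 < 1 by rewrite zE; exact: disc_polar.
have PE t s : Pk (mob_x p q (z t)) (mob_y p q (z t)) (cos s) (sin s) =
    PP r (sg t - sigma s) * (mden p q (cos (sigma s)) (sin (sigma s)) / da).
  have [c1 c2] := mtauE pqN s.
  have [k1 k2] := mobK pq (cos2Dsin2 s).
  have k1' : cos s = mob_x p q (cos (sigma s), sin (sigma s)) by rewrite c1 c2 k1.
  have k2' : sin s = mob_y p q (cos (sigma s), sin (sigma s)) by rewrite c1 c2 k2.
  rewrite [X in Pk _ _ X _]k1' [X in Pk _ _ _ X]k2'.
  by rewrite zE Pk_mob ?cos2Dsin2 ?disc_polar// Pk_PP.
have csigma : continuous sigma by exact: mtau_continuous.
have cc : continuous (fun s => cos (sigma s)).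
  by move=> s; apply: (@continuous_comp _ _ _ sigma (@cos R)); [exact: csigma|exact: continuous_cos].
have cs : continuous (fun s => sin (sigma s)).
  by move=> s; apply: (@continuous_comp _ _ _ sigma (@sin R)); [exact: csigma|exact: continuous_sin].
have cmden : continuous (fun s => mden p q (cos (sigma s)) (sin (sigma s)) / da).
  pose h s := 1 + (p * cos (sigma s) + q * sin (sigma s)).
  pose k s := p * sin (sigma s) - q * cos (sigma s).
  have ch : continuous h.
    move=> s; apply: cvgD; first exact: cvg_cst.
    by apply: cvgD; apply: cvgM; [exact: cvg_cst|exact: cc|exact: cvg_cst|exact: cs].
  have ck : continuous k.
    by move=> s; apply: cvgB; apply: cvgM; [exact: cvg_cst|exact: cs|exact: cvg_cst|exact: cc].
  rewrite (_ : (fun s => _) = (fun s => (h s * h s + k s * k s) / da)); last first.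
    by apply/funext => s; rewrite /mden !expr2.
  move=> s; apply: cvgM; last exact: cvg_cst.
  by apply: cvgD; apply: cvgM; [exact: ch|exact: ch|exact: ck|exact: ck].
have csg' : continuous sg by move=> t; apply: cvgM; [exact: cvg_cst|exact: cvg_id].
have mk : measurable_fun setT (fun w : R * R => PP r (sg w.1 - sigma w.2) *
    (mden p q (cos (sigma w.2)) (sin (sigma w.2)) / da) * phi w.2 ^+ 2).
  apply: measurable_funM; last exact: (measurableT_comp mphi2 measurable_snd).
  apply: measurable_funM; last first.
    exact: (measurableT_comp (continuous_measurable_fun cmden) measurable_snd).
  apply: (measurableT_comp (continuous_measurable_fun (PP_continuous r01))).
  apply: measurable_funB.
  - exact: (measurableT_comp (continuous_measurable_fun csg') measurable_fst).
  - exact: (measurableT_comp (continuous_measurable_fun csigma) measurable_snd).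
have k0 t s : 0 <= PP r (sg t - sigma s) *
    (mden p q (cos (sigma s)) (sin (sigma s)) / da) * phi s ^+ 2.
  rewrite mulr_ge0 ?sqr_ge0// mulr_ge0 ?PP_ge0// divr_ge0 ?(ltW da0)//.
  by rewrite ltW// mden_gt0// cos2Dsin2.
have p2 : 0 < 2 * pi :> R := pi2_gt0 R.
have mU2 : measurable_fun setT (fun t => U (mob_x p q (z t), mob_y p q (z t)) ^+ 2).
  have cUz : continuous (fun t => U (mob_x p q (z t), mob_y p q (z t))).
    move=> t.
    have zt1 : (z t).1 ^+ 2 + (z t).2 ^+ 2 <= 1 by rewrite ltW.
    have cz : {for t, continuous z}.
      have k1 : {for t, continuous (fun t => r * cos t)}.
        by apply: cvgM; [exact: cvg_cst|exact: continuous_cos].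
      have k2 : {for t, continuous (fun t => r * sin (sg t))}.
        apply: cvgM; first exact: cvg_cst.
        by apply: (@continuous_comp _ _ _ sg (@sin R)); [exact: csg'|exact: continuous_sin].
      exact: (cvg_pair k1 k2).
    have [cx cy] := CR_continuous (CR_mob pq zt1).
    have cx' : {for t, continuous (fun t => mob_x p q (z t))}.
      by apply: (@continuous_comp _ _ _ z (mob_x p q)).
    have cy' : {for t, continuous (fun t => mob_y p q (z t))}.
      by apply: (@continuous_comp _ _ _ z (mob_y p q)).
    apply: (@continuous_comp _ _ _ (fun t => (mob_x p q (z t), mob_y p q (z t))) U).
      exact: (cvg_pair cx' cy').
    by apply: cU; exact: (mob_disc pq (zd t)).
  have mUz := continuous_measurable_fun cUz.
  rewrite (_ : (fun t => _) = (fun t => U (mob_x p q (z t), mob_y p q (z t))) \*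
     (fun t => U (mob_x p q (z t), mob_y p q (z t)))).
    exact: measurable_funM.
  by apply/funext => t; rewrite expr2.
suff : ((2 * pi)%:E * \int[mu]_(t in T) (U (mob_x p q (z t), mob_y p q (z t)) ^+ 2)%:E
    <= (2 * pi)%:E * (4 / da * M)%:E)%E.
  by rewrite lee_pmul2l// lte_fin.
rewrite -ge0_integralZl//; last 3 first.
- by apply: measurable_funTS; apply/measurable_EFinP.
- by move=> t _; rewrite lee_fin sqr_ge0.
- by rewrite lee_fin ltW.
apply: (@le_trans _ _ (\int[mu]_(t in T) \int[mu]_(s in T)
   (PP r (sg t - sigma s) * (mden p q (cos (sigma s)) (sin (sigma s)) / da) * phi s ^+ 2)%:E)%E).
  apply: ge0_le_integral => //.
  - by move=> t _; rewrite mule_ge0 ?lee_fin ?sqr_ge0// ltW.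
  - apply: measurable_funeM; apply: measurable_funTS; exact/measurable_EFinP.
  - apply: measurable_funTS.
    by apply: (measurable_partial_integral (measurable_itv _) mk) => w; exact: k0.
  - move=> t _; rewrite -EFinM mulrC.
    apply: le_trans (poisson_jensen (mob_disc pq (zd t))) _.
    rewrite le_eqVlt; apply/orP; left; apply/eqP; apply: eq_integral => s _.
    by rewrite -PE.
rewrite (@tonelli_box R T T (fun w => PP r (sg w.1 - sigma w.2) *
    (mden p q (cos (sigma w.2)) (sin (sigma w.2)) / da) * phi w.2 ^+ 2) (measurable_itv _) (measurable_itv _))//=.
(* The kernel is even and has mass 2 pi around any centre, so either sign gives the same integral in
   t. *)
have PPsg s : (\int[mu]_(t in T) PP r (sg t - sigma s)) = 2 * pi.
  rewrite /sg; case: e {z sg csg zE zd PE csg' mk k0 mU2} => /=.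
    apply: etrans (PP_int (- sigma s) r01); apply: eq_Rintegral => t _.
    by rewrite expr1 mulN1r addrC.
  apply: etrans (PP_int (sigma s) r01); apply: eq_Rintegral => t _.
  by rewrite expr0 mul1r PP_sym.
rewrite (_ : (\int[mu]_(y in T) _)%E =
  (\int[mu]_(s in T) (2 * pi * (mden p q (cos (sigma s)) (sin (sigma s)) / da) * phi s ^+ 2)%:E)%E); last first.
  apply: eq_integral => s _.
  have cPP : continuous (fun t => PP r (sg t - sigma s)).
    move=> t; apply: (@continuous_comp _ _ _ (fun t => sg t - sigma s) (PP r)).
      by apply: cvgB; [exact: csg'|exact: cvg_cst].
    exact: PP_continuous.
  pose C := mden p q (cos (sigma s)) (sin (sigma s)) / da * phi s ^+ 2.
  under eq_integral do rewrite -mulrA -/C.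
  have I1 := contin_integrable (@continuous_contin R 0 (2 * pi) _ cPP).
  have I2 : mu.-integrable T (EFin \o (fun t => PP r (sg t - sigma s) * C)).
    apply: (contin_integrable (k := fun t => PP r (sg t - sigma s) * C)).
    by apply: continuous_contin => t; apply: cvgM; [exact: cPP|exact: cvg_cst].
  rewrite -[LHS]fineK; last exact: (integrable_fin_num _ I2).
  congr EFin; apply: etrans (@RintegralZr _ _ _ mu T _ C (measurable_itv _) I1) _.
  by rewrite PPsg /C; ring.
apply: (@le_trans _ _ (\int[mu]_(s in T) ((2 * pi * (4 / da))%:E * (phi s ^+ 2)%:E))%E); last first.
  rewrite ge0_integralZl//; last 3 first.
  - by apply: measurable_funTS; apply/measurable_EFinP.
  - by move=> t _; rewrite lee_fin sqr_ge0.
  - by rewrite lee_fin mulr_ge0 ?(ltW p2)// divr_ge0 ?(ltW da0).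
  rewrite [leRHS](_ : _ = ((2 * pi * (4 / da))%:E * M%:E)%E); last first.
    by rewrite -!EFinM; congr EFin; ring.
  apply: lee_wpmul2l => //.
  by rewrite lee_fin mulr_ge0 ?(ltW p2)// divr_ge0 ?(ltW da0).
have md0 s : 0 < mden p q (cos (sigma s)) (sin (sigma s)) by rewrite mden_gt0// cos2Dsin2.
apply: ge0_le_integral => //.
- by move=> s _; rewrite lee_fin mulr_ge0 ?sqr_ge0// mulr_ge0 ?(ltW p2)// divr_ge0 ?(ltW da0) ?(ltW (md0 _)).
- apply: measurable_funTS; apply/measurable_EFinP; apply: measurable_funM => //.
  by apply: measurable_funM => //; exact: continuous_measurable_fun.
- by apply: measurable_funeM; apply: measurable_funTS; exact/measurable_EFinP.
- move=> s _; rewrite -EFinM lee_fin ler_wpM2r ?sqr_ge0// ler_wpM2l ?(ltW p2)//.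
  by rewrite ler_wpM2r ?invr_ge0 ?(ltW da0)// mden_le// cos2Dsin2.
Qed.

End HardyMoebius.

(** * Slices of the quaternions and slice regularity *)

Section QuaternionAlgebra.
Variable R : realType.
Local Notation H := (quat R).
Implicit Types (x y z i j m : H) (u v r t : R).

Lemma q0_1 : q0 (1 : H) = 1. Proof. exact: q0E. Qed.
Lemma q1_1 : q1 (1 : H) = 0. Proof. exact: q1E. Qed.
Lemma q2_1 : q2 (1 : H) = 0. Proof. exact: q2E. Qed.
Lemma q3_1 : q3 (1 : H) = 0. Proof. exact: q3E. Qed.
Lemma q0N x : q0 (- x) = - q0 x. Proof. by rewrite /q0 mxE. Qed.
Lemma q1N x : q1 (- x) = - q1 x. Proof. by rewrite /q1 mxE. Qed.
Lemma q2N x : q2 (- x) = - q2 x. Proof. by rewrite /q2 mxE. Qed.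
Lemma q3N x : q3 (- x) = - q3 x. Proof. by rewrite /q3 mxE. Qed.
Lemma q0M x y : q0 (x * y) = q0 x * q0 y - q1 x * q1 y - q2 x * q2 y - q3 x * q3 y.
Proof. exact: q0E. Qed.
Lemma q1M x y : q1 (x * y) = q0 x * q1 y + q1 x * q0 y + q2 x * q3 y - q3 x * q2 y.
Proof. exact: q1E. Qed.
Lemma q2M x y : q2 (x * y) = q0 x * q2 y - q1 x * q3 y + q2 x * q0 y + q3 x * q1 y.
Proof. exact: q2E. Qed.
Lemma q3M x y : q3 (x * y) = q0 x * q3 y + q1 x * q2 y - q2 x * q1 y + q3 x * q0 y.
Proof. exact: q3E. Qed.
Definition qsimp := (@qD R, @qZ R, (q0N, q1N, q2N, q3N), (q0M, q1M, q2M, q3M),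
  (q0_1, q1_1, q2_1, q3_1), @qE R).

Lemma qsqnorm_ge0 x : 0 <= qsqnorm x.
Proof. by rewrite !addr_ge0 ?sqr_ge0. Qed.

Lemma qnorm_sqr x : qnorm x ^+ 2 = qsqnorm x.
Proof. by rewrite /qnorm sqr_sqrtr// qsqnorm_ge0. Qed.

Lemma qsqnormM x y : qsqnorm (x * y) = qsqnorm x * qsqnorm y.
Proof. by rewrite /qsqnorm !qsimp; ring. Qed.

Lemma qsqnormZ r x : qsqnorm (r *: x) = r ^+ 2 * qsqnorm x.
Proof. by rewrite /qsqnorm !qsimp; ring. Qed.

Lemma qsqnormD x y : qsqnorm (x + y) <= 2 * qsqnorm x + 2 * qsqnorm y.
Proof.
rewrite /qsqnorm !qsimp.
have := sqr_ge0 (q0 x - q0 y); have := sqr_ge0 (q1 x - q1 y).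
have := sqr_ge0 (q2 x - q2 y); have := sqr_ge0 (q3 x - q3 y).
nra.
Qed.

Lemma SphP i : Sph i -> q0 i = 0 /\ q1 i ^+ 2 + q2 i ^+ 2 + q3 i ^+ 2 = 1.
Proof.
move=> [i0 i1]; split => //; have := qnorm_sqr i.
by rewrite i1 expr1n /qsqnorm i0 expr0n/= add0r => <-.
Qed.

Lemma Sph_sqr i : Sph i -> i * i = -1.
Proof.
move=> /SphP[i0 i1]; apply: quatP; rewrite !qsimp i0; try by ring.
by rewrite -i1; ring.
Qed.

Definition slice i u v : H := u%:A + v *: i.

Lemma Sph_qsqnorm i : Sph i -> qsqnorm i = 1.
Proof. by move=> [_ i1]; rewrite -qnorm_sqr i1 expr1n. Qed.

Lemma Sph_e1 : Sph (mkq 0 1 0 0 : H).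
Proof.
split; first by rewrite qE.
by rewrite /qnorm /qsqnorm !qE expr0n expr1n/= !addr0 add0r sqrtr1.
Qed.

Lemma qsqnorm_slice i u v : Sph i -> qsqnorm (slice i u v) = u ^+ 2 + v ^+ 2.
Proof.
move=> /SphP[i0 i1]; rewrite /qsqnorm /slice !qsimp i0.
transitivity (u ^+ 2 + v ^+ 2 * (q1 i ^+ 2 + q2 i ^+ 2 + q3 i ^+ 2)); first by ring.
by rewrite i1 mulr1.
Qed.

Lemma Dball_slice i u v : Sph i -> Dball (slice i u v) <-> u ^+ 2 + v ^+ 2 < 1.
Proof.
move=> Si; rewrite -(qsqnorm_slice _ _ Si) -qnorm_sqr /Dball/=.
have n0 : 0 <= qnorm (slice i u v) by exact: sqrtr_ge0.
by rewrite expr_lt1.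
Qed.

Lemma rpart_slice i u v : Sph i -> rpart (slice i u v) = u.
Proof. by move=> [i0 _]; rewrite /rpart /slice !qsimp i0; ring. Qed.

Lemma slice_im i u v : Sph i -> slice i u v - (rpart (slice i u v))%:A = v *: i.
Proof. by move=> Si; rewrite rpart_slice// /slice addrC addKr. Qed.

Lemma ipart_slice i u v : Sph i -> ipart (slice i u v) = `|v|.
Proof.
move=> Si; rewrite /ipart slice_im// /qnorm qsqnormZ Sph_qsqnorm// mulr1.
by rewrite sqrtr_sqr.
Qed.

Lemma iunit_slice i u v : Sph i -> v != 0 -> iunit (slice i u v) = Num.sg v *: i.
Proof.
move=> Si v0; rewrite /iunit ipart_slice// normr_eq0 (negbTE v0) slice_im// scalerA.
by congr (_ *: _); rewrite [X in _ * X]numEsg mulrC mulfK// normr_eq0.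
Qed.

Lemma slice_rpart x : x = slice (iunit x) (rpart x) (ipart x).
Proof.
rewrite /slice /iunit; case: eqVneq => [h|h]; last first.
  by rewrite scalerA divff// scale1r addrC subrK.
rewrite h scale0r addr0; apply/eqP; rewrite -subr_eq0 -qsqnorm_eq0 -qnorm_sqr.
by rewrite -/(ipart x) h expr0n.
Qed.

Lemma iunit_Sph x : Sph (iunit x).
Proof.
rewrite /iunit; case: eqVneq => [h|h]; first exact: Sph_e1.
split; first by rewrite q0Z !qsimp /rpart; ring.
have ip : 0 <= ipart x by exact: sqrtr_ge0.
rewrite /qnorm qsqnormZ -qnorm_sqr -/(ipart x) -exprMn mulVf// expr1n.
by rewrite sqrtr1.
Qed.

Lemma ipart_ge0 x : 0 <= ipart x. Proof. exact: sqrtr_ge0. Qed.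

(* [m] stands for [j * i], a product of two imaginary units. *)
Definition mix m x y : H := 2^-1 *: ((1 - m) * x) + 2^-1 *: ((1 + m) * y).

Lemma mix_same m x : mix m x x = x.
Proof. by apply: quatP; rewrite /mix !qsimp; field. Qed.

(** For v < 0 the canonical unit of the point is -j and its imaginary part is -v, which exchanges
    the two summands; at v = 0 both values coincide and the choice of unit is immaterial. *)
Lemma ext_slice i j u v h : Sph i -> Sph j ->
  ext i h (slice j u v) = mix (j * i) (h (slice i u v)) (h (slice i u (- v))).
Proof.
move=> Si Sj; rewrite /ext rpart_slice// ipart_slice//.
have E w : u%:A + w *: i = slice i u w by [].
rewrite -scaleNr !E.
have [->|v0] := eqVneq v 0.
  by rewrite normr0 oppr0 -!/(mix _ _ _) !mix_same.
rewrite /mix iunit_slice//; case: (ltgtP v 0) v0 => // v0 _.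
- rewrite ltr0_sg// ltr0_norm// opprK scaleN1r mulNr opprK addrC.
  by congr (_ *: (_ * _) + _ *: (_ * _)).
- by rewrite gtr0_sg// gtr0_norm// scale1r.
Qed.

Lemma ext_same i u v h : Sph i -> ext i h (slice i u v) = h (slice i u v).
Proof.
move=> Si; rewrite ext_slice// /mix Sph_sqr// opprK subrr mul0r scaler0 addr0.
by rewrite mulrDl mul1r; apply: quatP; rewrite !qsimp; lra.
Qed.

Lemma qcisE j t r : r *: qcis j t = slice j (r * cos t) (r * sin t).
Proof. by rewrite /qcis /slice scalerDr !scalerA. Qed.

Lemma slice_inj_Ci i a : Di i a -> Sph i -> exists p q, a = slice i p q /\ p ^+ 2 + q ^+ 2 < 1.
Proof.
move=> [Da [p [q aE]]] Si; exists p, q; split => //.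
by apply/(Dball_slice _ _ Si); rewrite /slice -aE.
Qed.

Lemma moebiusC_slice i p q u v : Sph i -> p ^+ 2 + q ^+ 2 < 1 -> u ^+ 2 + v ^+ 2 <= 1 ->
  moebiusC (slice i p q) (slice i u v) = slice i (mob_x p q (u, v)) (mob_y p q (u, v)).
Proof.
move=> Si pq uv; have [-> ->] := mobE p q uv; have N0 := lt0r_neq0 (mden_gt0 pq uv).
have [i0 i1] := SphP Si.
have cE : qconj (slice i p q) = slice i p (- q).
  by apply: quatP; rewrite /slice /qconj !qsimp ?i0; ring.
have ME (a b c d : R) : slice i a b * slice i c d = slice i (a * c - b * d) (a * d + b * c).
  apply: quatP; rewrite /slice !qsimp ?i0; try by ring.
  transitivity (a * c - b * d * (q1 i ^+ 2 + q2 i ^+ 2 + q3 i ^+ 2)); first by ring.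
  by rewrite i1; ring.
rewrite /moebiusC cE ME.
have -> : 1 + slice i (p * u - - q * v) (p * v + - q * u) =
    slice i (1 + (p * u + q * v)) (p * v - q * u).
  by apply: quatP; rewrite /slice !qsimp ?i0; ring.
have -> : slice i u v + slice i p q = slice i (u + p) (v + q).
  by apply: quatP; rewrite /slice !qsimp ?i0; ring.
set d := slice i (1 + _) _.
have dn : qsqnorm d = mden p q u v by rewrite qsqnorm_slice.
have d0 : d != 0 by rewrite -qsqnorm_eq0 dn.
have ud : d \is a GRing.unit by [].
apply: (mulIr ud); rewrite divrK// /d ME; congr slice; rewrite /mden in N0 *; field => //.
Qed.

End QuaternionAlgebra.

(** * Componentwise differentiation of quaternion-valued functions *)

Section SliceDerivative.
Variable R : realType.
Local Notation H := (quat R).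
Implicit Types (x y z i j d e : H) (u v r t : R) (p : R * R) (G : R * R -> H).

Definition co (k : 'I_4) x : R := x ord0 k.

Lemma coD k x y : co k (x + y) = co k x + co k y. Proof. by rewrite /co mxE. Qed.
Lemma coN k x : co k (- x) = - co k x. Proof. by rewrite /co mxE. Qed.
Lemma coZ k r x : co k (r *: x) = r * co k x. Proof. by rewrite /co mxE. Qed.

Lemma co_inj x y : (forall k, co k x = co k y) -> x = y.
Proof. by move=> h; apply/rowP => k; exact: h. Qed.

Lemma co_sum x : x = \sum_(l < 4) co l x *: (delta_mx 0 l : H).
Proof. exact: row_sum_delta. Qed.

(** Left multiplication by a fixed quaternion is real linear with constant coefficients, so
    real-variable calculus applies to each coordinate. *)
Lemma coM k x y : co k (x * y) = \sum_(l < 4) co k (x * (delta_mx 0 l : H)) * co l y.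
Proof.
rewrite {1}(co_sum y) mulr_sumr /co summxE; apply: eq_bigr => l _.
by rewrite -scalerAr mxE mulrC.
Qed.

Lemma coMr k x y : co k (x * y) = \sum_(l < 4) co l x * co k ((delta_mx 0 l : H) * y).
Proof.
rewrite {1}(co_sum x) mulr_suml /co summxE; apply: eq_bigr => l _.
by rewrite -scalerAl mxE.
Qed.

Section coordinates.
Variable V : normedModType R.
Implicit Types (g h : V -> H) (w : V).

Lemma differentiable_co g w k : differentiable g w -> differentiable (co k \o g) w.
Proof.
move=> dg; apply: (differentiable_comp dg).
exact: (@differentiable_coord R 1 4 (g w) ord0 k).
Qed.

Lemma differentiable_quat g w : (forall k, differentiable (co k \o g) w) ->
  differentiable g w.
Proof.
move=> dg.
have -> : g = \sum_(l < 4) (fun y : V => co l (g y) *: (delta_mx 0 l : H)).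
  by apply/funext => y; rewrite fct_sumE; exact: co_sum.
by apply: differentiable_sum => l; apply: differentiableZl; exact: dg.
Qed.

Lemma differentiable_qmul g h w : differentiable g w -> differentiable h w ->
  differentiable (fun y : V => g y * h y) w.
Proof.
move=> dg dh; apply: differentiable_quat => k.
have -> : co k \o (fun y : V => g y * h y) =
    \sum_(l < 4) ((co l \o g) * (fun y : V => co k ((delta_mx 0 l : H) * h y))).
  by apply/funext => y; rewrite fct_sumE /= coMr.
apply: differentiable_sum => l; apply: differentiableM; first exact: differentiable_co.
have -> : (fun y : V => co k ((delta_mx 0 l : H) * h y)) =
    \sum_(m < 4) (fun y : V => co k ((delta_mx 0 l : H) * (delta_mx 0 m : H)) * co m (h y)).
  by apply/funext => y; rewrite fct_sumE coM.
apply: differentiable_sum => m; apply: differentiableM => //.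
exact: differentiable_co.
Qed.

End coordinates.

Lemma hasgrad_partial1 (A : R * R -> R) u v (a b : R) : hasgrad A (u, v) a b ->
  is_derive u 1 (fun s => A (s, v)) a.
Proof.
move=> hA; have hw := is_diff_pair (is_diff_id u) (is_diff_cst v u).
have [dd dE] := @is_diff_comp _ _ _ _ (fun s => (s, v)) _ A _ u hw hA.
split; first exact: diff_derivable.
by rewrite deriveE// dE/= mulr1 mulr0 addr0.
Qed.

Lemma hasgrad_partial2 (A : R * R -> R) u v (a b : R) : hasgrad A (u, v) a b ->
  is_derive v 1 (fun t => A (u, t)) b.
Proof.
move=> hA; have hw := is_diff_pair (is_diff_cst u v) (is_diff_id v).
have [dd dE] := @is_diff_comp _ _ _ _ (fun t => (u, t)) _ A _ v hw hA.
split; first exact: diff_derivable.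
by rewrite deriveE// dE/= mulr1 mulr0 add0r.
Qed.

Lemma diff_hasgrad (A : R * R -> R) p : differentiable A p ->
  hasgrad A p ('d A p (1, 0)) ('d A p (0, 1)).
Proof.
move=> dA; apply: (is_diff_eq (differentiableP dA)); apply/funext => -[h k] /=.
have {1}-> : (h, k) = h *: (1, 0) + k *: (0, 1) :> R * R.
  by congr pair; rewrite /= /GRing.scale/=; ring.
rewrite linearD !linearZ /GRing.scale/=.
by congr (_ + _); exact: mulrC.
Qed.

Lemma hasgrad_sum n (A : 'I_n -> R * R -> R) p (a b : 'I_n -> R) :
  (forall l, hasgrad (A l) p (a l) (b l)) ->
  hasgrad (fun q => \sum_(l < n) A l q) p (\sum_(l < n) a l) (\sum_(l < n) b l).
Proof.
elim: n A a b => [|n IH] A a b h.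
  have -> : (fun q => \sum_(l < 0) A l q) = cst 0 by apply/funext => q; rewrite big_ord0.
  by rewrite !big_ord0; exact: hasgrad_cst.
have -> : (fun q => \sum_(l < n.+1) A l q) =
    (fun q => \sum_(l < n) A (widen_ord (leqnSn n) l) q + A ord_max q).
  by apply/funext => q; rewrite big_ord_recr.
by rewrite !big_ord_recr/=; apply: hasgradD => //; apply: IH.
Qed.

Definition hgrad G p d e := forall k, hasgrad (co k \o G) p (co k d) (co k e).

Lemma hgrad_val G p d e d' e' : hgrad G p d e -> d = d' -> e = e' -> hgrad G p d' e'.
Proof. by move=> ? <- <-. Qed.

Lemma hgradD G G' p d e d' e' : hgrad G p d e -> hgrad G' p d' e' ->
  hgrad (fun q => G q + G' q) p (d + d') (e + e').
Proof.
move=> h h' k; rewrite !coD.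
have -> : co k \o (fun q => G q + G' q) = (fun q => (co k \o G) q + (co k \o G') q).
  by apply/funext => q; rewrite /= coD.
exact: hasgradD.
Qed.

Lemma hgrad_lmul x G p d e : hgrad G p d e -> hgrad (fun q => x * G q) p (x * d) (x * e).
Proof.
move=> h k; rewrite !coM.
have -> : co k \o (fun q => x * G q) =
    (fun q => \sum_(l < 4) co k (x * (delta_mx 0 l : H)) * co l (G q)).
  by apply/funext => q; rewrite /= coM.
apply: hasgrad_sum => l; apply: hasgrad_val.
  by apply: hasgradM; [exact: hasgrad_cst|exact: h].
- by rewrite mulr0 addr0.
- by rewrite mulr0 addr0.
Qed.

Lemma hgradZ r G p d e : hgrad G p d e -> hgrad (fun q => r *: G q) p (r *: d) (r *: e).
Proof.
have E x : r *: x = r%:A * x by rewrite -scalerAl mul1r.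
move=> /(hgrad_lmul r%:A); rewrite -(E d) -(E e).
by have <- : (fun q => r *: G q) = (fun q => r%:A * G q) by apply/funext => q; exact: E.
Qed.

Lemma hgrad_comp G (w1 w2 : R * R -> R) p d e a1 b1 a2 b2 :
  hgrad G (w1 p, w2 p) d e -> hasgrad w1 p a1 b1 -> hasgrad w2 p a2 b2 ->
  hgrad (fun q => G (w1 q, w2 q)) p (a1 *: d + a2 *: e) (b1 *: d + b2 *: e).
Proof.
move=> h h1 h2 k; apply: (hasgrad_val (hasgrad_comp2 (h k) h1 h2)).
- by rewrite coD !coZ; ring.
- by rewrite coD !coZ; ring.
Qed.

Lemma hgrad_differentiable G p d e : hgrad G p d e -> differentiable G p.
Proof. by move=> h; apply: differentiable_quat => k; have [] := h k. Qed.

Lemma differentiable_hgrad G p : differentiable G p -> exists d e, hgrad G p d e.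
Proof.
move=> dG; exists (\row_k ('d (co k \o G) p (1, 0))), (\row_k ('d (co k \o G) p (0, 1))) => k.
rewrite /co !mxE; apply: diff_hasgrad; exact: differentiable_co.
Qed.

Lemma is_derive_coP (g : R -> H) u d :
  is_derive u 1 g d <-> forall k, is_derive u 1 (co k \o g) (co k d).
Proof.
split=> [[dg gd] k|h].
  have dk : derivable (co k \o g) u 1 by apply: (derivable_mxP _ _ _).1 dg _ _.
  split => //; rewrite -gd derive_mx// /co mxE; reflexivity.
have dg : derivable g u 1.
  by apply/derivable_mxP => a k; rewrite (ord1 a); have [] := h k.
split => //; rewrite derive_mx//; apply: co_inj => k; rewrite /co mxE.
by have [] := h k.
Qed.

Lemma hgrad_partial1 G u v d e : hgrad G (u, v) d e -> is_derive u 1 (fun s => G (s, v)) d.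
Proof. by move=> h; apply/is_derive_coP => k; exact: hasgrad_partial1 (h k). Qed.

Lemma hgrad_partial2 G u v d e : hgrad G (u, v) d e -> is_derive v 1 (fun t => G (u, t)) e.
Proof. by move=> h; apply/is_derive_coP => k; exact: hasgrad_partial2 (h k). Qed.

Lemma is_derive_lmul x (g : R -> H) u d : is_derive u 1 g d ->
  is_derive u 1 (fun s => x * g s) (x * d).
Proof.
move=> /is_derive_coP h; apply/is_derive_coP => k; rewrite coM.
have -> : co k \o (fun q => x * g q) =
    \sum_(l < 4) (co k (x * (delta_mx 0 l : H)) *: (co l \o g)).
  by apply/funext => q; rewrite fct_sumE /= coM.
by apply: is_derive_sum => l; apply: is_deriveZ; exact: h.
Qed.

Lemma is_derive_uniq (g : R -> H) u d e : is_derive u 1 g d -> is_derive u 1 g e -> d = e.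
Proof. by move=> [_ <-] [_ <-]. Qed.

End SliceDerivative.

(** * Slice hyperholomorphic functions as holomorphic functions on one slice *)

Section SliceExtension.
Variable R : realType.
Local Notation H := (quat R).
Implicit Types (x y z i j d e : H) (u v r s t : R) (p : R * R) (G : R * R -> H)
  (f h : H -> H).

Lemma disc_near1 u v : u ^+ 2 + v ^+ 2 < 1 -> \forall s \near u, s ^+ 2 + v ^+ 2 < 1.
Proof.
have c : (fun s => s * s + v ^+ 2) @ u --> u * u + v ^+ 2.
  by apply: cvgD; [apply: cvgM; exact: cvg_id|exact: cvg_cst].
by rewrite expr2 => /(cvgr_lt _ c); apply: filterS => s; rewrite expr2.
Qed.

Lemma disc_near2 u v : u ^+ 2 + v ^+ 2 < 1 -> \forall s \near v, u ^+ 2 + s ^+ 2 < 1.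
Proof.
by rewrite addrC => /disc_near1; apply: filterS => s; rewrite addrC.
Qed.

(** The parity of alpha and beta extends the representation to both signs of v and gives beta(u, 0)
    = 0, so that it holds for every unit i. *)
Lemma SHL_slice f : SHL f -> exists alpha beta : R -> R -> H, forall u v,
  u ^+ 2 + v ^+ 2 < 1 ->
  (forall i, Sph i -> f (slice i u v) = alpha u v + i * beta u v) /\
  exists d e, [/\ is_derive u 1 (alpha^~ v) d, is_derive u 1 (beta^~ v) e,
     is_derive v 1 (alpha u) (- e) & is_derive v 1 (beta u) d].
Proof.
move=> [_ [alpha [beta [fE ab]]]]; exists alpha, beta => u v uv; split.
  move=> i Si; have [ae be _ _ _] := ab _ _ uv.
  rewrite fE; last exact/Dball_slice.
  rewrite rpart_slice// ipart_slice//.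
  have [v0|v0] := eqVneq v 0.
    have b0 : beta u 0 = 0.
      move: be; rewrite v0 oppr0 => h; apply: co_inj => k.
      have -> : co k (0 : H) = 0 by rewrite /co mxE.
      have := congr1 (co k) h; rewrite coN; lra.
    by rewrite v0 normr0 b0 !mulr0.
  rewrite iunit_slice//; case: (ltgtP v 0) v0 => // v0 _.
  - by rewrite ltr0_sg// ltr0_norm// ae be scaleN1r mulrNN.
  - by rewrite gtr0_sg// gtr0_norm// scale1r.
have [_ _ [a1 a2] [b1 b2] [c1 c2]] := ab _ _ uv.
exists ('D_1 (alpha^~ v) u), ('D_1 (beta^~ v) u).
have D (g : R -> H) (w : R) (dg : derivable g w 1) : is_derive w 1 g ('D_1 g w) by exact: derivableP.
split; [exact: D|exact: D| |].
- by rewrite c2 opprK; exact: D.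
- by rewrite c1; exact: D.
Qed.

Lemma slice_differentiable i p : differentiable (fun q : R * R => slice i q.1 q.2) p.
Proof.
apply: differentiable_quat => k.
have -> : co k \o (fun q : R * R => slice i q.1 q.2) =
    (fun q : R * R => q.1 * cst (co k (1 : H)) q + q.2 * cst (co k i) q).
  by apply/funext => q; rewrite /= /slice coD !coZ.
have [] := hasgradD (hasgradM (hasgrad_fst p) (hasgrad_cst (co k (1 : H)) p))
  (hasgradM (hasgrad_snd p) (hasgrad_cst (co k i) p)).
by [].
Qed.

(** Total differentiability comes from f; the equations for alpha and beta identify the two partial
    derivatives as a + i b and -b + i a, and the second is i times the first. *)
Lemma SHL_hgrad f i u v : SHL f -> Sph i -> u ^+ 2 + v ^+ 2 < 1 ->
  exists d, hgrad (fun q => f (slice i q.1 q.2)) (u, v) d (i * d).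
Proof.
move=> Sf Si uv; have [alpha [beta ab]] := SHL_slice Sf.
have dF : differentiable (fun q : R * R => f (slice i q.1 q.2)) (u, v).
  apply: (@differentiable_comp _ _ _ _ (fun q : R * R => slice i q.1 q.2) f).
    exact: slice_differentiable.
  by case: Sf => + _; apply; exact/Dball_slice.
have [d [e de]] := differentiable_hgrad dF.
have [_ [a [b [a1 b1 a2 b2]]]] := ab _ _ uv.
have h1 : d = a + i * b.
  apply: (is_derive_uniq (hgrad_partial1 de)) => /=.
  apply: (near_eq_is_derive (f := (fun s => alpha s v + i * beta s v))).
    by apply: filterS (disc_near1 uv) => s sv; have [->] := ab _ _ sv.
  exact: is_deriveD (is_derive_lmul i b1).
have h2 : e = - b + i * a.
  apply: (is_derive_uniq (hgrad_partial2 de)) => /=.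
  apply: (near_eq_is_derive (f := (fun s => alpha u s + i * beta u s))).
    by apply: filterS (disc_near2 uv) => s sv; have [->] := ab _ _ sv.
  exact: is_deriveD (is_derive_lmul i b2).
exists d; apply: (hgrad_val de) => //.
by rewrite h1 h2 mulrDr mulrA Sph_sqr// mulN1r addrC.
Qed.

Lemma co_le_norm (k : 'I_4) x : `|co k x| <= `|x|.
Proof.
rewrite [leRHS]/Num.Def.normr/= mx_normrE.
exact: (le_bigmax _ (fun ij : 'I_1 * 'I_4 => `|x ij.1 ij.2|) (ord0, k)).
Qed.

Lemma co_sqr_le (k : 'I_4) x : co k x ^+ 2 <= qsqnorm x.
Proof.
have s0 := sqr_ge0 (q0 x); have s1 := sqr_ge0 (q1 x).
have s2 := sqr_ge0 (q2 x); have s3 := sqr_ge0 (q3 x).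
rewrite /co /qsqnorm; case: k => -[|[|[|[|//]]]] k4; rewrite (bool_irrelevance k4 isT).
- rewrite -/(q0 x); lra.
- rewrite -/(q1 x); lra.
- rewrite -/(q2 x); lra.
- rewrite -/(q3 x); lra.
Qed.

Lemma qsqnorm_co_le x (c : R) : 0 <= c -> (forall k, `|co k x| <= c) -> qsqnorm x <= 4 * c ^+ 2.
Proof.
move=> c0 h.
have S k : co k x ^+ 2 <= c ^+ 2 by rewrite -(real_normK (num_real (co k x))) lerXn2r ?nnegrE.
have := S (@Ordinal 4 0 isT); have := S (@Ordinal 4 1 isT).
have := S (@Ordinal 4 2 isT); have := S (@Ordinal 4 3 isT).
rewrite /qsqnorm /q0 /q1 /q2 /q3 /co; lra.
Qed.

Lemma qsqnorm_le_norm x : qsqnorm x <= 4 * `|x| ^+ 2.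
Proof. by apply: qsqnorm_co_le => // k; exact: co_le_norm. Qed.

Lemma differentiable_flat (V : normedModType R) (A : V -> R) (x : V) :
  (forall e : R, 0 < e -> \forall y \near x, `|A y - A x| <= e * `|y - x|) ->
  differentiable A x.
Proof.
move=> Ax; pose l : {linear V -> R} := \0.
have lc : continuous l by move=> y; exact: cvg_cst.
have E : A \o shift x = cst (A x) + l +o_ 0 id.
  apply/eqaddoP => e e0; have := Ax e e0.
  rewrite (near_shift 0) subr0; apply: filterS => y.
  by rewrite !fctE /= addrK addr0.
apply/diff_locallyP; rewrite (diff_unique lc E); split => //.
Qed.

Lemma differentiable_near (V : normedModType R) (A B : V -> R) (x : V) :
  (\forall y \near x, A y = B y) -> differentiable A x -> differentiable B x.
Proof.
move=> AB dA; have -> : B = A + (B - A) by rewrite addrC subrK.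
apply: differentiableD => //; apply: differentiable_flat => e e0.
have ABx : A x = B x by exact: nbhs_singleton AB.
by apply: filterS AB => y ABy; rewrite !fctE ABy ABx !subrr normr0 mulr_ge0// ltW.
Qed.

Lemma Dball_qsqnorm x : Dball x <-> qsqnorm x < 1.
Proof.
rewrite -qnorm_sqr /Dball/=; have n0 : 0 <= qnorm x by exact: sqrtr_ge0.
by rewrite expr_lt1.
Qed.

Lemma Dball_near x : Dball x -> \forall y \near x, Dball y.
Proof.
move=> /Dball_qsqnorm x1.
have c : {for x, continuous (@qsqnorm R)}.
  have h k : differentiable ((co k : H -> R) * co k) x.
    by apply: differentiableM; exact: (@differentiable_coord R 1 4 x ord0 k).
  apply: differentiable_continuous.
  exact: (differentiableD (differentiableD (differentiableD (h (@Ordinal 4 0 isT))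
    (h (@Ordinal 4 1 isT))) (h (@Ordinal 4 2 isT))) (h (@Ordinal 4 3 isT))).
have N := @cvgr_lt R H (nbhs x) (nbhs_filter x) (@qsqnorm R) (qsqnorm x) c 1 x1.
apply: (@filterS _ (nbhs x) (nbhs_filter x) _ _ _ N) => y.
exact: (Dball_qsqnorm y).2.
Qed.

Lemma ipart_differentiable x : ipart x != 0 -> differentiable (@ipart R) x.
Proof.
move=> x0; have E : @ipart R = Num.sqrt \o (fun y => q1 y * q1 y + q2 y * q2 y + q3 y * q3 y).
  apply/funext => y; rewrite /ipart /qnorm /=; congr Num.sqrt.
  by rewrite /qsqnorm /rpart !qsimp; ring.
move: (x0); rewrite {1}E /= => x1; rewrite E.
have q k : differentiable (co k : H -> R) x by exact: (@differentiable_coord R 1 4 x ord0 k).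
apply: (@differentiable_comp _ _ _ _ (fun y => q1 y * q1 y + q2 y * q2 y + q3 y * q3 y)).
  by apply: differentiableD (differentiableM (q (@Ordinal 4 3 isT)) (q (@Ordinal 4 3 isT)));
   apply: differentiableD (differentiableM (q (@Ordinal 4 2 isT)) (q (@Ordinal 4 2 isT)));
   exact: (differentiableM (q (@Ordinal 4 1 isT)) (q (@Ordinal 4 1 isT))).
apply/derivable1_diffP; apply: ex_derive; apply: is_derive1_sqrt.
by rewrite ltNge; apply: contra x1 => /ler0_sqrtr ->.
Qed.

End SliceExtension.

(** * Error estimates for the extension at a real point *)

Section ExtensionBounds.
Variable R : realType.
Local Notation H := (quat R).
Implicit Types (x y z j d e m X W : H) (u v r s t : R) (p : R * R) (G : R * R -> H).

Lemma hgrad_eps G p d e (eps : R) : hgrad G p d e -> 0 < eps ->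
  exists2 del : R, 0 < del & forall s t, `|s - p.1| < del -> `|t - p.2| < del ->
    qsqnorm (G (s, t) - G p - ((s - p.1) *: d + (t - p.2) *: e))
      <= 4 * (eps * (`|s - p.1| + `|t - p.2|)) ^+ 2.
Proof.
move=> hG e0; have h k := hasgrad_eps (hG k) e0.
have [r0 r0p R0] := h (@Ordinal 4 0 isT); have [r1 r1p R1] := h (@Ordinal 4 1 isT).
have [r2 r2p R2] := h (@Ordinal 4 2 isT); have [r3 r3p R3] := h (@Ordinal 4 3 isT).
exists (Num.min (Num.min r0 r1) (Num.min r2 r3)); first by rewrite !lt_min r0p r1p r2p.
move=> s t; rewrite !lt_min => /andP[/andP[s0 s1] /andP[s2 s3]] /andP[/andP[t0 t1] /andP[t2 t3]].
apply: qsqnorm_co_le; first by rewrite mulr_ge0 ?addr_ge0// ltW.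
move=> k; rewrite !(coD, coN, coZ) (mulrC _ (co k d)) (mulrC _ (co k e)).
case: k => -[|[|[|[|//]]]] k4; rewrite (bool_irrelevance k4 isT).
- exact: R0.
- exact: R1.
- exact: R2.
- exact: R3.
Qed.

Lemma mixB m x y x' y' : mix m (x - x') (y - y') = mix m x y - mix m x' y'.
Proof. by apply: quatP; rewrite /mix !qsimp; ring. Qed.

Lemma mix_opp m x : mix m x (- x) = - (m * x).
Proof. by apply: quatP; rewrite /mix !qsimp; field. Qed.

Lemma qsqnorm_mix m x y : qsqnorm m = 1 ->
  qsqnorm (mix m x y) <= 2 * (qsqnorm x + qsqnorm y).
Proof.
move=> m1; apply: (le_trans (qsqnormD _ _)).
rewrite !qsqnormZ !qsqnormM.
have o1 : qsqnorm (1 : H) = 1 by rewrite /qsqnorm !qsimp expr1n expr0n/= !addr0.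
have a1 := qsqnormD 1 (- m); have a2 := qsqnormD 1 m.
have n1 : qsqnorm (- m) = 1 by rewrite -m1 /qsqnorm !qsimp !sqrrN.
rewrite o1 n1 in a1; rewrite o1 m1 in a2.
have x0 := qsqnorm_ge0 x; have y0 := qsqnorm_ge0 y.
have b1 : qsqnorm (1 - m) * qsqnorm x <= 4 * qsqnorm x by rewrite ler_wpM2r//; lra.
have b2 : qsqnorm (1 + m) * qsqnorm y <= 4 * qsqnorm y by rewrite ler_wpM2r//; lra.
have -> : (2^-1 : R) ^+ 2 = 4^-1 by field.
lra.
Qed.

(** Since i i = -1, mixing the first-order parts r d + s i d and r d - s i d yields (r + s j) d: the
    linear part of the extension at a real point is right multiplication by d, for every j. *)
Lemma mix_expansion i j d x y z r s : Sph i ->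
  mix (j * i) (x - z - (r *: d + s *: (i * d))) (y - z - (r *: d - s *: (i * d))) =
  mix (j * i) x y - z - slice j r s * d.
Proof.
move=> Si; set W := s *: _.
have -> : x - z - (r *: d + W) = x - (z + r *: d) - W by rewrite !opprD !addrA.
have -> : y - z - (r *: d - W) = y - (z + r *: d) - - W by rewrite !opprD !addrA.
rewrite !mixB mix_same mix_opp.
have -> : j * i * W = - (s *: (j * d)).
  by rewrite /W -scalerAr mulrA -(mulrA j i i) Sph_sqr// mulrN1 mulNr scalerN.
rewrite /slice mulrDl -!scalerAl mul1r.
by apply: co_inj => l; rewrite !(coD, coN); ring.
Qed.

Lemma sqr_norm_sum_le r s t : r ^+ 2 + s ^+ 2 <= t -> (`|r| + s) ^+ 2 <= 2 * t.
Proof.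
move=> rs; have := sqr_ge0 (`|r| - s); have := real_normK (num_real r).
have -> : (`|r| + s) ^+ 2 = 2 * (`|r| ^+ 2 + s ^+ 2) - (`|r| - s) ^+ 2 by ring.
by move=> ->; lra.
Qed.

(** Each of x and y has square modulus at most (t r)^2 / 64, so the mixture has at most (t r)^2 / 16
    <= (t s)^2 / 2; the divisor 16 is chosen for this. *)
Lemma mix_bound m x y r s t (k : 'I_4) : qsqnorm m = 1 -> 0 <= t -> 0 <= s ->
  r ^+ 2 <= 8 * s ^+ 2 ->
  qsqnorm x <= 4 * (t / 16 * r) ^+ 2 -> qsqnorm y <= 4 * (t / 16 * r) ^+ 2 ->
  `|co k (mix m x y)| <= t * s.
Proof.
move=> m1 t0 s0 rs x1 y1; have M0 := co_sqr_le k (mix m x y).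
have M1 := qsqnorm_mix x y m1.
rewrite -(@ler_pXn2r _ 2)// ?nnegrE ?mulr_ge0// real_normK ?num_real//.
have := sqr_ge0 (t * s); have : (t * r) ^+ 2 <= 8 * (t * s) ^+ 2.
  by rewrite !exprMn (mulrCA 8) ler_wpM2l// sqr_ge0.
have E : (t / 16 * r) ^+ 2 = (t * r) ^+ 2 / 256 by field.
rewrite E in x1 y1; lra.
Qed.

End ExtensionBounds.

(** * The extension of a slice-holomorphic function is slice hyperholomorphic *)

Section ExtensionRegular.
Variable R : realType.
Local Notation H := (quat R).
Implicit Types (x y z j d e : H) (u v r s t : R) (p : R * R).
Variables (i : H) (h : H -> H) (G : R * R -> H).
Hypothesis Si : Sph i.
Hypothesis hG : forall u v, u ^+ 2 + v ^+ 2 < 1 -> h (slice i u v) = G (u, v).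
Hypothesis dG : forall u v, u ^+ 2 + v ^+ 2 < 1 -> exists d, hgrad G (u, v) d (i * d).

(** [al] and [be] are obtained by expanding the extension formula in the unit j: al + j be, with al
    even and be odd in v. *)
Let al p : H := 2^-1 *: (G p + G (p.1, - p.2)).
Let be p : H := 2^-1 *: (i * G (p.1, - p.2) + (- i) * G p).

Let discN u v : u ^+ 2 + v ^+ 2 < 1 -> u ^+ 2 + (- v) ^+ 2 < 1.
Proof. by rewrite sqrrN. Qed.

Let grad_ab u v : u ^+ 2 + v ^+ 2 < 1 -> exists d e,
  [/\ hgrad al (u, v) d (- e) & hgrad be (u, v) e d].
Proof.
move=> uv; have [d hd] := dG uv; have [d' hd'] := dG (discN uv).
have hN : hgrad (fun q => G (q.1, - q.2)) (u, v) d' (- (i * d')).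
  apply: hgrad_val (hgrad_comp (p := (u, v)) (w1 := fst) (w2 := fun q => - q.2) hd' (hasgrad_fst _)
    (hasgradN (hasgrad_snd _))) _ _.
  - by rewrite scale1r oppr0 scale0r addr0.
  - by rewrite scale0r add0r scaleN1r.
exists (2^-1 *: (d + d')), (2^-1 *: (i * d' - i * d)); split.
- apply: hgrad_val (hgradZ _ (hgradD hd hN)) _ _ => //.
  by rewrite -scalerN opprB addrC.
- apply: hgrad_val (hgradZ _ (hgradD (hgrad_lmul i hN) (hgrad_lmul (- i) hd))) _ _.
  + by rewrite mulNr.
  + by rewrite mulrN mulNr !mulrA Sph_sqr// !mulN1r !opprK addrC.
Qed.

Let ext_ab x : Dball x -> ext i h x = al (rpart x, ipart x) + iunit x * be (rpart x, ipart x).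
Proof.
move=> Dx; have Sx := iunit_Sph x.
have uv : rpart x ^+ 2 + ipart x ^+ 2 < 1.
  by apply/(Dball_slice _ _ Sx); rewrite -slice_rpart.
rewrite {1}(slice_rpart x) ext_slice// hG// hG ?sqrrN// /al /be /mix/=.
rewrite -scalerAr -!scalerDr; congr (_ *: _).
by rewrite !mulrDl !mul1r mulrDr !mulrA !mulrN addrACA; congr (_ + _); rewrite addrC.
Qed.

Lemma ext_differentiable_nonreal x : Dball x -> ipart x != 0 -> differentiable (ext i h) x.
Proof.
move=> Dx x0; have Sx := iunit_Sph x.
have uv : rpart x ^+ 2 + ipart x ^+ 2 < 1.
  by apply/(Dball_slice _ _ Sx); rewrite -slice_rpart.
have [d [e [ha hb]]] := grad_ab uv.
have dr : differentiable (@rpart R) x.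
  exact: (@differentiable_coord R 1 4 x ord0 (@Ordinal 4 0 isT)).
have di := ipart_differentiable x0.
have [dp _] := is_diff_pair (differentiableP dr) (differentiableP di).
have dZ : differentiable (fun y => y - (rpart y)%:A) x.
  apply: differentiableB => //.
  exact: differentiableZl.
apply: differentiable_quat => k.
(* The replacement has no case distinction on the unit: where [ipart y] is 0 the factor [be]
   vanishes. *)
apply: (@differentiable_near _ _ (co k \o (fun y => al (rpart y, ipart y) +
   (((ipart y)^-1 *: (1 : H)) * (y - (rpart y)%:A)) * be (rpart y, ipart y)))).
  apply: (@filterS _ (nbhs x) (nbhs_filter x) _ _ _ (Dball_near Dx)) => y Dy /=; rewrite ext_ab// /iunit -scalerAl mul1r.
  case: eqVneq => // y0; rewrite y0.
  have -> : be (rpart y, 0) = 0 by rewrite /be/= oppr0 mulNr subrr scaler0.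
  by rewrite !mulr0.
apply: (@differentiable_co _ _ (fun y => al (rpart y, ipart y) +
   (((ipart y)^-1 *: (1 : H)) * (y - (rpart y)%:A)) * be (rpart y, ipart y))).
apply: differentiableD.
  exact: (differentiable_comp dp (hgrad_differentiable ha)).
apply: differentiable_qmul; last first.
  exact: (differentiable_comp dp (hgrad_differentiable hb)).
apply: differentiable_qmul => //.
by apply: differentiableZl; apply: differentiableV.
Qed.

Lemma ext_mix j u v : Sph j -> u ^+ 2 + v ^+ 2 < 1 ->
  ext i h (slice j u v) = mix (j * i) (G (u, v)) (G (u, - v)).
Proof. by move=> Sj uv; rewrite ext_slice// hG// hG// sqrrN. Qed.

(** The unit of y is discontinuous at a real point, so the differential y |-> y d is exhibited
    directly; the error at y is the mixture of the first-order errors of G at (a, b) and (a, -b). *)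
Lemma ext_differentiable_real x : Dball x -> ipart x = 0 -> differentiable (ext i h) x.
Proof.
move=> Dx x0; have Sx := iunit_Sph x; pose s := rpart x.
have s1 : s ^+ 2 + 0 ^+ 2 < 1.
  by apply/(Dball_slice _ _ Sx); rewrite -x0 -slice_rpart.
have [d hd] := dG s1; set G0 := G (s, 0) in hd.
have ext0 : ext i h x = G0.
  by rewrite (slice_rpart x) x0 ext_mix// oppr0 mix_same.
apply: differentiable_quat => k.
have -> : co k \o ext i h = (co k \o (fun y => y * d)) + (co k \o (fun y => ext i h y - y * d)).
  by apply/funext => y; rewrite !fctE/= -coD addrC subrK.
apply: differentiableD.
  by apply: differentiable_co; apply: differentiable_qmul.
apply: differentiable_flat => e e0; have e16 : 0 < e / 16 by rewrite divr_gt0.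
have [del del0 hdel] := hgrad_eps hd e16.
have nb : \forall y \near x, `|y - x| < del / 2.
  have d2 : 0 < del / 2 by rewrite divr_gt0.
  have := nbhsx_ballx x _ d2; apply: (@filterS _ (nbhs x) (nbhs_filter x)) => y.
  by rewrite -ball_normE/= distrC.
apply: (@filterS2 _ (nbhs x) (nbhs_filter x) _ _ _ _ nb (Dball_near Dx)) => y yx Dy.
have Sy := iunit_Sph y; set j := iunit y in Sy; pose a := rpart y - s; pose b := ipart y.
have b0 : 0 <= b by exact: ipart_ge0.
have yE : y = slice j (rpart y) b by exact: slice_rpart.
have uv : rpart y ^+ 2 + b ^+ 2 < 1 by apply/(Dball_slice _ _ Sy); rewrite -yE.
have yxE : y - x = slice j a b.
  rewrite {1}yE {1}(slice_rpart x) x0 /slice scale0r addr0 /a scalerBl -/s.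
  by rewrite addrAC.
(* The factor 4 compares the quaternionic modulus with the sup norm; it becomes the 8 required by
   [mix_bound] after (|a| + b)^2 <= 2 (a^2 + b^2). *)
have N2 : a ^+ 2 + b ^+ 2 <= 4 * `|y - x| ^+ 2.
  by rewrite -(qsqnorm_slice _ _ Sy) -yxE; exact: qsqnorm_le_norm.
set N := `|y - x| in yx N2 *; have N0 : 0 <= N by exact: normr_ge0.
have a2 : `|a| <= 2 * N.
  rewrite -(@ler_pXn2r _ 2)// ?nnegrE ?mulr_ge0//.
  by rewrite real_normK ?num_real// exprMn; have := sqr_ge0 b; lra.
have b2 : b <= 2 * N.
  rewrite -(@ler_pXn2r _ 2)// ?nnegrE ?mulr_ge0//.
  by rewrite exprMn; have := sqr_ge0 a; lra.
have adel : `|rpart y - s| < del by rewrite -/a; lra.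
have bdel : `|b - 0| < del by rewrite subr0 ger0_norm//; lra.
have bdel' : `|- b - 0| < del by rewrite subr0 normrN ger0_norm//; lra.
have E1 := hdel _ _ adel bdel; have E2 := hdel _ _ adel bdel'.
rewrite /= -/a -/G0 subr0 (ger0_norm b0) in E1.
rewrite /= -/a -/G0 subr0 normrN (ger0_norm b0) scaleNr in E2.
set W := b *: (i * d) in E1 E2.
set e1 := _ - (_ + W) in E1; set e2 := _ - (_ - W) in E2.
have errE : ext i h y - y * d - (ext i h x - x * d) = mix (j * i) e1 e2.
  rewrite /e1 /e2 /W mix_expansion// -ext_mix// -yE -yxE ext0 mulrBl !opprB.
  by rewrite addrACA [RHS]addrACA; congr (_ + _); rewrite addrC.
rewrite /= -coN -coD errE.
have ji : qsqnorm (j * i) = 1 by rewrite qsqnormM !Sph_qsqnorm// mulr1.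
apply: (mix_bound _ ji (ltW e0) N0 _ E1 E2).
apply: (le_trans (sqr_norm_sum_le N2)).
by rewrite mulrA -natrM.
Qed.

Lemma ext_SHL : SHL (ext i h).
Proof.
split=> [x Dx|].
  have [x0|x0] := eqVneq (ipart x) 0; first exact: ext_differentiable_real.
  exact: ext_differentiable_nonreal.
exists (fun u v => al (u, v)), (fun u v => be (u, v)); split=> [x Dx|u v uv].
  exact: ext_ab.
have [d [e [ha hb]]] := grad_ab uv.
have [a1 A1] := hgrad_partial1 ha; have [a2 A2] := hgrad_partial2 ha.
have [b1 B1] := hgrad_partial1 hb; have [b2 B2] := hgrad_partial2 hb.
split.
- by rewrite /al/= opprK addrC.
- by rewrite /be/= opprK -scalerN; congr (_ *: _); rewrite opprD !mulNr opprK [RHS]addrC.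
- exact (conj a1 a2).
- exact (conj b1 b2).
- exact (conj (etrans A1 (esym B2))
    (etrans B1 (etrans (esym (opprK e)) (congr1 -%R (esym A2))))).
Qed.

End ExtensionRegular.

(** * Radial limits and mean oscillation *)

Section AlmostEverywhere.
Context d (X : measurableType d) (R : realType) (mu : {measure set X -> \bar R}).
Implicit Types (D N : set X) (f g : X -> \bar R).
Local Open Scope ereal_scope.

(* [f] and [g] may be non-measurable: radial limits are total functions taking junk
   values off the set of convergence. *)
Lemma integral_mono f g : (forall x, 0 <= f x) -> (forall x, f x <= g x) ->
  \int[mu]_x f x <= \int[mu]_x g x.
Proof.
move=> f0 fg; have g0 x : 0 <= g x by exact: le_trans (fg x).
rewrite !ge0_integralTE//; apply: ge_ereal_sup => _ [h hf <-].
by apply: ereal_sup_ubound; exists h => // x; exact: le_trans (fg x).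
Qed.

(** Raising g to +oo on the exceptional null set keeps it measurable, leaves its integral unchanged
    and makes the inequality hold everywhere on D. *)
Lemma ae_integral_le D f g : measurable D -> measurable_fun D g ->
  (forall x, 0 <= f x) -> (forall x, 0 <= g x) ->
  {ae mu, forall x, D x -> f x <= g x} ->
  \int[mu]_(x in D) f x <= \int[mu]_(x in D) g x.
Proof.
move=> mD mg f0 g0 [N [mN N0 fgN]].
pose g' x := if x \in N then +oo else g x.
have g'0 x : 0 <= g' x by rewrite /g'; case: ifP.
have mg' : measurable_fun D g'.
  rewrite -(setUIDK D N).
  have mDN : measurable (D `&` N) by exact: measurableI.
  have mDN' : measurable (D `\` N) by exact: measurableD.
  apply/measurable_funU => //; split.
  - apply: (eq_measurable_fun (cst +oo)) => //.
    by move=> x; rewrite in_setI /g' => /andP[_ ->].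
  - apply: (eq_measurable_fun g); last exact: measurable_funS mg.
    by move=> x; rewrite in_setD /g' => /andP[_ /negbTE ->].
apply: (@le_trans _ _ (\int[mu]_(x in D) g' x)).
  rewrite integral_mkcond [leRHS]integral_mkcond; apply: integral_mono => x.
    by apply: erestrict_ge0.
  apply: lee_restrict => y Dy; rewrite /g'; case: ifPn => [_|/negP yN]; first exact: leey.
  by rewrite leNgt; apply/negP => fg; apply: yN; rewrite inE; apply: fgN => /= /(_ Dy);
    rewrite leNgt fg.
rewrite (ge0_negligible_integral mN)// [leRHS](ge0_negligible_integral mN)//.
rewrite (eq_integral g)// => x; rewrite in_setD /g' => /andP[_ /negbTE ->].
by [].
Qed.

(** Here the measurable function is the smaller one: its integral ignores the exceptional null set,
    off which the inequality holds pointwise. *)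
Lemma ae_integral_ge D f g : measurable D -> measurable_fun D f ->
  (forall x, 0 <= f x) -> (forall x, 0 <= g x) ->
  {ae mu, forall x, D x -> f x <= g x} ->
  \int[mu]_(x in D) f x <= \int[mu]_(x in D) g x.
Proof.
move=> mD mf f0 g0 [N [mN N0 fgN]].
rewrite (ge0_negligible_integral mN)// integral_mkcond [leRHS]integral_mkcond.
apply: integral_mono => x; first exact: erestrict_ge0.
rewrite !patchE in_setD; case: ifPn => [/andP[xD xN]|_]; last by case: ifPn.
rewrite xD leNgt; apply/negP => fg; move/negP: xN; apply; rewrite inE; apply: fgN => /=.
by move=> /(_ (set_mem xD)); rewrite leNgt fg.
Qed.

Lemma ae_Rintegral_eq D (f g : X -> R) : measurable D -> measurable_fun D g ->
  {ae mu, forall x, D x -> f x = g x} ->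
  (\int[mu]_(x in D) f x = \int[mu]_(x in D) g x)%R.
Proof.
move=> mD mg fg; rewrite /Rintegral; congr fine.
have mg' : measurable_fun D (EFin \o g) by exact/measurable_EFinP.
rewrite integralE [RHS]integralE; congr (_ - _); apply/eqP; rewrite eq_le; apply/andP; split.
- apply: ae_integral_le => //; first exact: measurable_funepos.
  by apply: filterS fg => x H Dx; rewrite !funeposE /= H.
- apply: ae_integral_ge => //; first exact: measurable_funepos.
  by apply: filterS fg => x H Dx; rewrite !funeposE /= H.
- apply: ae_integral_le => //; first exact: measurable_funeneg.
  by apply: filterS fg => x H Dx; rewrite !funenegE /= H.
- apply: ae_integral_ge => //; first exact: measurable_funeneg.
  by apply: filterS fg => x H Dx; rewrite !funenegE /= H.
Qed.

End AlmostEverywhere.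

(** * Nontangential limits almost everywhere on the line, and deviation from the mean *)

Section BoundaryAlmostEverywhere.
Variable R : realType.
Local Notation mu := (@lebesgue_measure R).
Local Notation T := (`[0, 2 * pi]%classic : set R).
Implicit Types (t x y r u v c : R).

(** Preimages of null sets under an expansive map are null. *)
Lemma ae_expansive (P : set R) (s : R -> R) c : 0 < c -> measurable_fun setT s ->
  (forall x y, c * `|x - y| <= `|s x - s y|) ->
  {ae mu, forall x, P x} -> {ae mu, forall x, P (s x)}.
Proof.
move=> c0 ms cs [N [mN N0 PN]]; exists (s @^-1` N); split.
- by rewrite -[X in measurable X]setTI; exact: ms.
- exact: (expansive_null c0 ms cs mN N0).
- by move=> x /= Px; apply: PN.
Qed.

Lemma ae_imply (P Q : set R) : P `<=` Q ->
  {ae mu, forall x, P x} -> {ae mu, forall x, Q x}.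
Proof. by move=> PQ [N [mN N0 PN]]; exists N; split => // x /= Qx; apply: PN => /PQ. Qed.

Lemma ae_shift (P : set R) c : {ae mu, forall x, P x} -> {ae mu, forall x, P (x + c)}.
Proof.
apply: (@ae_expansive _ (fun x => x + c) 1) => //.
- by apply: measurable_funD => //; exact: measurable_cst.
- by move=> x y; rewrite mul1r opprD addrACA subrr addr0.
Qed.

Lemma periodic_nat (V : Type) (g : R -> V) : (forall t, g (t + 2 * pi) = g t) ->
  forall n t, g (t + n%:R * (2 * pi)) = g t /\ g (t - n%:R * (2 * pi)) = g t.
Proof.
move=> gp; have h n t : g (t + n%:R * (2 * pi)) = g t.
  elim: n t => [|n IH] t; first by rewrite mul0r addr0.
  by rewrite -natr1 mulrDl mul1r addrA gp.
by move=> n t; split => //; rewrite -(h n (t - _)) subrK.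
Qed.

(* Convergence within the approach region |e^{it} - z| <= K (1 - |z|^2), for every K. *)
Definition ntlim (U : R * R -> R) (l : R) t := forall K e : R, 1 <= K -> 0 < e ->
  exists2 eta : R, 0 < eta & forall u v, u ^+ 2 + v ^+ 2 < 1 ->
    (cos t - u) ^+ 2 + (sin t - v) ^+ 2 <= K ^+ 2 * (1 - u ^+ 2 - v ^+ 2) ^+ 2 ->
    1 - u ^+ 2 - v ^+ 2 < eta -> `|U (u, v) - l| <= e.

Section radial.
Variables (U : R * R -> R) (phi : R -> R).
Hypothesis mphi : measurable_fun setT phi.
Hypothesis phi_per : forall t, phi (t + 2 * pi) = phi t.
Hypothesis iphi : mu.-integrable T (EFin \o phi).
Hypothesis Uphi : forall u v, u ^+ 2 + v ^+ 2 < 1 ->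
  \int[mu]_(t in T) (Pk u v (cos t) (sin t) * phi t) = U (u, v) * (2 * pi).

(** Lebesgue points settle almost every t in (0, 2 pi); countably many translates by multiples of 2
    pi and periodicity of cos, sin and phi settle the line. *)
Lemma ae_ntlim : {ae mu, forall t, ntlim U (phi t) t}.
Proof.
have L := lebesgue_differentiation (integrable_locally_restrict (measurable_itv _) iphi).
(* The endpoint 0 of T has to be discarded, since the limit theorem concerns interior points. *)
have Z : {ae mu, forall t, t != 0}.
  exists [set 0]; split => //; first exact: lebesgue_measure_set1.
  by move=> t /= /negP; rewrite negbK => /eqP.
pose P t := 0 <= t < 2 * pi -> ntlim U (phi t) t.
have HP : {ae mu, forall t, P t}.
  apply: (@filterS2 _ (almost_everywhere mu) (ae_filter_ringOfSetsType mu) _ _ _ _ L Z) => t Lt t0 /andP[t1 t2] K e K1 e0.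
  apply: (fatou_nontangential mphi iphi Uphi _ Lt K1 e0).
  by rewrite lt_neqAle eq_sym t0 t1.
have H1 : {ae mu, forall t, forall n : nat, P (t + n%:R * (2 * pi))}.
  by apply/ae_foralln => n; exact: ae_shift.
have H2 : {ae mu, forall t, forall n : nat, P (t - n%:R * (2 * pi))}.
  by apply/ae_foralln => n; exact: ae_shift.
apply: (@filterS2 _ (almost_everywhere mu) (ae_filter_ringOfSetsType mu) _ _ _ _ H1 H2) => t P1 P2; set T2 := 2 * pi in P1 P2.
have T0 : 0 < T2 by exact: pi2_gt0.
have nt s : cos s = cos t -> sin s = sin t -> phi s = phi t -> ntlim U (phi s) s ->
    ntlim U (phi t) t.
  by rewrite /ntlim => -> -> ->.
have cosp x : cos (x + 2 * pi) = cos x by rewrite [2 * pi]mulr_natl cosD2pi.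
have sinp x : sin (x + 2 * pi) = sin x by rewrite [2 * pi]mulr_natl sinD2pi.
(* m counts the periods to remove; for m = -(n+1), n+1 periods are added instead. *)
pose m := Num.floor (t / T2).
have m1 : m%:~R * T2 <= t by rewrite -ler_pdivlMr//; exact: floor_le.
have m2 : t < m%:~R * T2 + T2.
  have := floorD1_gt (t / T2); rewrite ltr_pdivrMr// -/m intrD mulrDl mul1r; exact.
move: m1 m2; case: m => n.
- rewrite -[n%:~R]/(n%:R : R) => m1 m2.
  have [c _] := (fun k => k) (periodic_nat cosp n t).
  apply: (nt _ (periodic_nat cosp n t).2 (periodic_nat sinp n t).2
    (periodic_nat phi_per n t).2); apply: P2; rewrite -/T2; apply/andP; split; lra.
- rewrite NegzE -[(- _)%:~R]/(- (n.+1)%:R : R) => m1 m2.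
  apply: (nt _ (periodic_nat cosp n.+1 t).1 (periodic_nat sinp n.+1 t).1
    (periodic_nat phi_per n.+1 t).1); apply: P1; rewrite -/T2; apply/andP; split; lra.
Qed.

End radial.

Section mean.
Variables (al be : R) (psi : R -> R).
Hypothesis ab : al < be.
Hypothesis mpsi : measurable_fun setT psi.
Let D := (`]al, be[%classic : set R).
Let mD : measurable D. Proof. exact: measurable_itv. Qed.

Let muD : mu D = (be - al)%:E.
Proof.
have E := lebesgue_measure_itv `]al, be[.
by apply: (etrans E); rewrite /= lte_fin ab -EFinD.
Qed.

(** The mean minimizes the quadratic deviation. Integrability of psi is not assumed: either the
    right side is infinite, or it forces psi to be integrable. *)
Lemma mean_min c :
  (\int[mu]_(t in D) ((psi t - (be - al)^-1 * \int[mu]_(s in D) psi s) ^+ 2)%:E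
    <= \int[mu]_(t in D) ((psi t - c) ^+ 2)%:E)%E.
Proof.
set m := _^-1 * _.
have mc (k : R) : measurable_fun setT (fun t => (psi t - k) ^+ 2).
  by apply: measurable_funX; apply: measurable_funB => //; exact: measurable_cst.
have mcD (k : R) : measurable_fun D (EFin \o (fun t => (psi t - k) ^+ 2)).
  by apply/measurable_EFinP; exact: measurable_funTS.
have [oo|noo] := eqVneq (\int[mu]_(t in D) ((psi t - c) ^+ 2)%:E)%E +oo%E.
  by rewrite oo leey.
have ic : mu.-integrable D (EFin \o (fun t => (psi t - c) ^+ 2)).
  apply/integrableP; split; first exact: mcD.
  under eq_integral do rewrite /= ger0_norm ?sqr_ge0//.
  by rewrite ltey.
have icst (k : R) : mu.-integrable D (EFin \o cst k).
  apply/integrableP; split; first by apply/measurable_EFinP; exact: measurable_cst.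
  by rewrite (_ : integral _ _ _ = (\int[mu]_(x in D) cst `|k|%:E x)%E)// integral_cst//; move: muD => /= ->; rewrite ltry.
(* X <= X^2 + 1 for X = |psi - c| gives the majorant (psi - c)^2 + |c| + 1 of |psi|. *)
have ipsi : mu.-integrable D (EFin \o psi).
  apply: (@le_integrable _ _ _ mu D (measurable_itv _) _ (EFin \o (fun t => (psi t - c) ^+ 2 + (`|c| + 1)))).
  - by apply/measurable_EFinP; exact: measurable_funTS.
  - move=> t _ /=; rewrite lee_fin [leRHS]ger0_norm; last first.
      by rewrite !addr_ge0// sqr_ge0.
    have h1 : `|psi t| <= `|psi t - c| + `|c| by rewrite -{1}(subrK c (psi t)) ler_normD.
    have h2 := real_normK (num_real (psi t - c)).
    have := sqr_ge0 (`|psi t - c| - 1 / 2); lra.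
  - by have := @integrableD _ _ _ mu D (measurable_itv _) _ _ ic (icst (`|c| + 1)); apply: eq_integrable.
have e0 : 0 < be - al by rewrite subr_gt0.
have Ipsi : \int[mu]_(t in D) psi t = m * (be - al).
  by rewrite /m mulrAC mulVf ?mul1r// lt0r_neq0.
have ilin : mu.-integrable D (EFin \o (fun t => 2 * (c - m) * psi t)).
  by have := @integrableZl _ _ _ mu D (measurable_itv _) (2 * (c - m)) _ ipsi; apply: eq_integrable.
have im : mu.-integrable D (EFin \o (fun t => (psi t - m) ^+ 2)).
  have := @integrableD _ _ _ mu D (measurable_itv _) _ _ (@integrableD _ _ _ mu D (measurable_itv _) _ _ ic ilin) (icst (m ^+ 2 - c ^+ 2)).
  by apply: eq_integrable => // t _ /=; rewrite -!EFinD; congr EFin; ring.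
have E : \int[mu]_(t in D) (psi t - m) ^+ 2 =
    \int[mu]_(t in D) (psi t - c) ^+ 2 + 2 * (c - m) * (m * (be - al))
    + (m ^+ 2 - c ^+ 2) * (be - al).
  rewrite -Ipsi -(@RintegralZl _ _ _ mu D _ (2 * (c - m)) (measurable_itv _) ipsi) -RintegralD//.
  have -> : (m ^+ 2 - c ^+ 2) * (be - al) = \int[mu]_(t in D) cst (m ^+ 2 - c ^+ 2) t.
    by rewrite Rintegral_cst//; congr (_ * _); exact: esym (congr1 fine muD).
  rewrite -RintegralD//.
    by apply: eq_Rintegral => t _ /=; ring.
  by have := @integrableD _ _ _ mu D (measurable_itv _) _ _ ic ilin; apply: eq_integrable.
rewrite -[leLHS]fineK; last exact: (@integrable_fin_num _ _ _ mu D (measurable_itv _) _ im).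
rewrite -[leRHS]fineK; last exact: (@integrable_fin_num _ _ _ mu D (measurable_itv _) _ ic).
rewrite lee_fin; change (\int[mu]_(t in D) (psi t - m) ^+ 2 <= \int[mu]_(t in D) (psi t - c) ^+ 2).
rewrite E; have := mulr_ge0 (sqr_ge0 (m - c)) (ltW e0); nra.
Qed.

End mean.
End BoundaryAlmostEverywhere.

(** * Components of f on the slice of i: square means and radial limits *)

Section BoundaryValues.
Variable R : realType.
Local Notation H := (quat R).
Local Notation mu := (@lebesgue_measure R).
Local Notation T := (`[0, 2 * pi]%classic : set R).
Implicit Types (x y z j d e : H) (u v r s t : R).
Variables (i : H) (f : H -> H).
Hypothesis Si : Sph i.
Hypothesis Sf : SHL f.

Let F (z : R * R) : H := f (slice i z.1 z.2).
Let U k : R * R -> R := co k \o F.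

Lemma qsqnorm_sum x : qsqnorm x = \sum_(k < 4) co k x ^+ 2.
Proof.
rewrite !big_ord_recl big_ord0 addr0 /qsqnorm !addrA.
by congr (_ + _ + _ + _); congr (_ ^+ 2); rewrite /co /q0 /q1 /q2 /q3; congr (x _ _); apply: val_inj.
Qed.

(** As F_v = i F_u, a harmonic conjugate of a component of F is minus the same component of i F. *)
Lemma SHL_CR k u v : u ^+ 2 + v ^+ 2 < 1 ->
  CR (U k) (fun q => - co k (i * F q)) (u, v).
Proof.
move=> uv; have [d hd] := SHL_hgrad Sf Si uv.
exists (co k d), (co k (i * d)); split; first exact: hd.
have := hasgradN (hgrad_lmul i hd k); rewrite mulrA Sph_sqr// mulN1r coN opprK; exact.
Qed.

Lemma SHL_continuous k u v : u ^+ 2 + v ^+ 2 < 1 -> {for (u, v), continuous (U k)}.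
Proof. by move=> uv; have [] := CR_continuous (SHL_CR k uv). Qed.

Lemma SHL_poisson k u v r : u ^+ 2 + v ^+ 2 < 1 -> 0 <= r < 1 ->
  \int[mu]_(t in T) (Pk u v (cos t) (sin t) * U k (r * cos t, r * sin t))
    = U k (r * u, r * v) * (2 * pi).
Proof. by move=> uv r01; apply: poisson_formula => // x y xy; exact: SHL_CR. Qed.

Lemma sqmean_mean2 r : 0 <= r < 1 ->
  sqmean f i r = ((2 * pi)^-1 * \sum_(k < 4) mean2 (U k) r)%:E.
Proof.
move=> r01; rewrite /sqmean EFinM; congr (_ * _)%E.
have cont k : continuous (fun t => circ (U k) r t ^+ 2).
  move=> t; rewrite (_ : (fun t => _) = (fun t => circ (U k) r t * circ (U k) r t)); last first.
    by apply/funext => s; rewrite expr2.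
  by apply: cvgM; apply: (circ_continuous _ r01) => u v; exact: SHL_continuous.
have I k : mu.-integrable T (EFin \o (fun t => circ (U k) r t ^+ 2)).
  by apply: contin_integrable; apply: continuous_contin.
transitivity (\int[mu]_(t in T) \sum_(k < 4) (circ (U k) r t ^+ 2)%:E)%E.
  by apply: eq_integral => t _; rewrite qnorm_sqr qcisE qsqnorm_sum sumEFin.
rewrite ge0_integral_sum//; last 2 first.
- by move=> k; exact: (measurable_int mu (I k)).
- by move=> k t _; rewrite lee_fin sqr_ge0.
rewrite -sumEFin; apply: eq_bigr => k _; rewrite -[LHS]fineK//.
exact: (integrable_fin_num _ (I k)).
Qed.

(** The mean is monotone in r; the reflection r |-> -r turns the left limit at 1 into a right limit
    at -1. *)
Lemma sqmean_cvg : cvg (sqmean f i r @[r --> 1^'-]).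
Proof.
apply: (cvgP (ereal_sup ((fun r => sqmean f i (- r)) @` [set` `](-1), 0[%R]))).
apply/cvg_at_leftNP; apply: nonincreasing_at_right_cvge; first by rewrite bnd_simp; lra.
move=> r s; rewrite !in_itv/= => /andP[r1 r2] /andP[s1 s2] rs.
have h1 : 0 <= - r < 1 by apply/andP; split; lra.
have h2 : 0 <= - s < 1 by apply/andP; split; lra.
rewrite !sqmean_mean2// lee_fin ler_wpM2l//.
  by rewrite invr_ge0 ltW// pi2_gt0.
apply: ler_sum => k _; apply: mean2_homo; [exact: SHL_continuous|exact: SHL_poisson| | |]; lra.
Qed.

(** The limit on the slice of i dominates all means by monotonicity, and the mean of one component
    is at most the sum over the four. *)
Lemma Hardy2_mean2 : Hardy2 f -> exists M : R, forall k r, 0 <= r < 1 -> mean2 (U k) r <= M.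
Proof.
move=> [_ fin]; set L := lim (sqmean f i r @[r --> 1^'-]).
have Lfin : (L < +oo)%E.
  by apply: le_lt_trans fin; apply: ereal_sup_ubound; exists i.
have SL r : 0 <= r < 1 -> (((2 * pi)^-1 * \sum_(k < 4) mean2 (U k) r)%:E <= L)%E.
  move=> /andP[r0 r1]; apply: lime_ge; first exact: sqmean_cvg.
  near=> s; have rs : r <= s by apply: ltW; near: s; exact: nbhs_left_gt.
  have s1 : s < 1 by near: s; exact: nbhs_left_lt.
  rewrite sqmean_mean2; last by rewrite s1 (le_trans r0 rs).
  rewrite lee_fin ler_wpM2l//; first by rewrite invr_ge0 ltW// pi2_gt0.
  by apply: ler_sum => k _; apply: mean2_homo => //; [exact: SHL_continuous|exact: SHL_poisson].
have Lr : L = (fine L)%:E.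
  rewrite fineK// fin_numElt Lfin andbT; apply: lt_le_trans (SL 0 _); first exact: ltNyr.
  by rewrite lexx ltr01.
exists (2 * pi * fine L) => k r r01; have := SL _ r01.
rewrite Lr lee_fin mulrC ler_pdivrMr ?pi2_gt0// mulrC; apply: le_trans.
by rewrite (bigD1 k)//= lerDl; apply: sumr_ge0 => l _; exact: mean2_ge0.
Unshelve. all: by end_near. Qed.

Lemma norm_le_co x (c : R) : 0 <= c -> (forall k, `|co k x| <= c) -> `|x| <= c.
Proof.
move=> c0 h; rewrite [leLHS]/Num.Def.normr/= mx_normrE.
by apply: bigmax_le => // -[a k] _ /=; rewrite (ord1 a); exact: h.
Qed.

Variable Phi : R -> H.

(** A path in a fixed approach region whose depth 1 - |W r|^2 is O(1 - r) eventually falls below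
    every threshold eta, for the four components at once. *)
Lemma path_lim t (W : R -> R * R) (K C : R) : 1 <= K -> 0 < C ->
  (forall r, 0 < r < 1 -> [/\ (W r).1 ^+ 2 + (W r).2 ^+ 2 < 1,
     (cos t - (W r).1) ^+ 2 + (sin t - (W r).2) ^+ 2
       <= K ^+ 2 * (1 - (W r).1 ^+ 2 - (W r).2 ^+ 2) ^+ 2 &
     1 - (W r).1 ^+ 2 - (W r).2 ^+ 2 <= C * (1 - r)]) ->
  (forall k, ntlim (U k) (co k (Phi t)) t) ->
  F (W r) @[r --> 1^'-] --> Phi t.
Proof.
move=> K1 C0 hW nt; apply/cvgrPdist_le => e e0.
have near1 k : \forall r \near (1 : R)^'-, `|co k (Phi t - F (W r))| <= e.
  have [eta eta0 H'] := nt k K e K1 e0.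
  have et : 1 - eta / C < 1 by rewrite ltrBlDr ltrDl divr_gt0.
  near=> r.
  have r0 : 0 < r by near: r; apply: nbhs_left_gt.
  have r1 : r < 1 by near: r; exact: nbhs_left_lt.
  have re : 1 - eta / C < r by near: r; exact: nbhs_left_gt.
  have [h1 h2 h3] := hW r (introT andP (conj r0 r1)).
  rewrite coD coN distrC; have := H' (W r).1 (W r).2 h1 h2.
  rewrite /U /= -surjective_pairing; apply; apply: le_lt_trans h3 _.
  by rewrite mulrC -ltr_pdivlMr//; lra.
have := filter_forall (at_left_proper_filter (1 : R)) near1.
by apply: filterS => r hr; apply: norm_le_co; rewrite ?ltW.
Unshelve. all: by end_near. Qed.

Lemma radial_lim t : (forall k, ntlim (U k) (co k (Phi t)) t) ->
  F (r * cos t, r * sin t) @[r --> 1^'-] --> Phi t.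
Proof.
apply: (@path_lim t (fun r => (r * cos t, r * sin t)) 1 2) => // r /andP[r0 r1] /=.
have E : (r * cos t) ^+ 2 + (r * sin t) ^+ 2 = r ^+ 2.
  by rewrite !exprMn -mulrDr cos2Dsin2 mulr1.
have -> : 1 - (r * cos t) ^+ 2 - (r * sin t) ^+ 2 = 1 - r ^+ 2 by rewrite -E; ring.
have -> : (cos t - r * cos t) ^+ 2 + (sin t - r * sin t) ^+ 2 = (1 - r) ^+ 2.
  transitivity ((1 - r) ^+ 2 * (cos t ^+ 2 + sin t ^+ 2)); first by ring.
  by rewrite cos2Dsin2 mulr1.
split; first by rewrite E; nra.
- rewrite expr1n mul1r ler_pXn2r// ?nnegrE; nra.
- nra.
Qed.

End BoundaryValues.

(** * The composition: slice regularity and boundary values *)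

Section Composition.
Variable R : realType.
Local Notation H := (quat R).
Local Notation mu := (@lebesgue_measure R).
Local Notation T := (`[0, 2 * pi]%classic : set R).
Implicit Types (x y j d e : H) (u v r s t : R).
Variables (i : H) (f : H -> H) (p q : R).
Hypothesis Si : Sph i.
Hypothesis Sf : SHL f.
Hypothesis pq : p ^+ 2 + q ^+ 2 < 1.

Let F (z : R * R) : H := f (slice i z.1 z.2).
Let U k : R * R -> R := co k \o F.
Let G (z : R * R) : H := F (mob_x p q z, mob_y p q z).
Let h : H -> H := f \o moebius i (slice i p q).
Let g : H -> H := icomp i f (moebius i (slice i p q)).
Let da : R := 1 - p ^+ 2 - q ^+ 2.
Let da0 : 0 < da. Proof. by rewrite /da; have := pq; lra. Qed.

Lemma icomp_disc u v : u ^+ 2 + v ^+ 2 < 1 -> h (slice i u v) = G (u, v).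
Proof.
by move=> uv; rewrite /h /= /moebius ext_same// moebiusC_slice// ltW.
Qed.

Lemma hgrad_moebius u v : u ^+ 2 + v ^+ 2 < 1 -> exists d, hgrad G (u, v) d (i * d).
Proof.
move=> uv; have [d hd] := SHL_hgrad Sf Si (mob_disc pq uv).
have [a [b [ha hb]]] := CR_mob pq (ltW uv).
exists (a *: d + (- b) *: (i * d)).
apply: (hgrad_val (hgrad_comp (p := (u, v)) hd ha hb)) => //.
rewrite mulrDr -!scalerAr mulrA Sph_sqr// mulN1r scaleNr scalerN opprK addrC.
by [].
Qed.

Lemma icomp_SHL : SHL g.
Proof. exact: (ext_SHL Si icomp_disc hgrad_moebius). Qed.

Lemma icomp_qcis j r t : Sph j -> 0 <= r < 1 -> g (r *: qcis j t) =
  mix (j * i) (G (r * cos t, r * sin t)) (G (r * cos (- t), r * sin (- t))).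
Proof.
move=> Sj /andP[r0 r1]; rewrite qcisE /g /icomp -/h (ext_mix Si icomp_disc)//.
  by rewrite cosN sinN mulrN.
by rewrite !exprMn -mulrDr cos2Dsin2 mulr1 expr_lt1.
Qed.

Lemma cvg_qmul (c : H) (w : R -> H) (l : H) : w r @[r --> 1^'-] --> l ->
  c * w r @[r --> 1^'-] --> c * l.
Proof.
move=> wl; have cc : {for l, continuous (fun x : H => c * x)}.
  apply: differentiable_continuous.
  by apply: (@differentiable_qmul R H (cst c) id).
exact: (cvg_comp _ _ wl cc).
Qed.

Variable Phi : R -> H.

(** The flag selects the angle of the conjugate point e^{-it}, so both terms of the representation
    formula are treated together. *)
Definition mtauN (b : bool) t := mtau p q (if b then - t else t).

(** The aperture is that of [mob_nontangential]. The depth constant 8 / da comes from 1 - |T z|^2 =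
    da (1 - r^2) / |1 + conj(a) z|^2, with denominator at least da^2 / 4 and 1 - r^2 <= 2 (1 -
    r). *)
Lemma mob_lim t : (forall k, ntlim (U k) (co k (Phi (mtau p q t))) (mtau p q t)) ->
  G (r * cos t, r * sin t) @[r --> 1^'-] --> Phi (mtau p q t).
Proof.
apply: (@path_lim R i f Phi (mtau p q t) (fun r => (mob_x p q (r * cos t, r * sin t),
  mob_y p q (r * cos t, r * sin t))) (4 / da) (8 / da)) => //.
- by rewrite ler_pdivlMr// mul1r /da; have := sqr_ge0 p; have := sqr_ge0 q; lra.
- by rewrite divr_gt0.
move=> r r01 /=; have /andP[r0 r1] := r01.
have E : (r * cos t) ^+ 2 + (r * sin t) ^+ 2 = r ^+ 2.
  by rewrite !exprMn -mulrDr cos2Dsin2 mulr1.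
have uv : (r * cos t) ^+ 2 + (r * sin t) ^+ 2 < 1 by rewrite E; nra.
have [-> ->] := mtauE pq t; split; first exact: mob_disc.
- exact: mob_nontangential.
- rewrite mob_sqr ?(ltW uv)// -/da.
  have -> : 1 - (r * cos t) ^+ 2 - (r * sin t) ^+ 2 = 1 - r ^+ 2 by rewrite -E; ring.
  have M := mden_ge pq (ltW uv); rewrite -/da in M.
  rewrite ler_pdivrMr ?(mden_gt0 pq (ltW uv))//.
  apply: (@le_trans _ _ (8 / da * (1 - r) * (da ^+ 2 / 4))).
    have -> : 8 / da * (1 - r) * (da ^+ 2 / 4) = da * (2 * (1 - r)).
      by have := lt0r_neq0 da0; move=> n0; field.
    by rewrite ler_wpM2l ?(ltW da0)//; nra.
  rewrite ler_wpM2l// mulr_ge0 ?divr_ge0 ?(ltW da0)//; lra.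
Qed.

Lemma mtauN_expansive b (x y : R) : da / 4 * `|x - y| <= `|mtauN b x - mtauN b y|.
Proof.
rewrite /mtauN; case: b; last exact: mtau_expansive.
apply: le_trans (mtau_expansive pq _ _).
by rewrite -opprD normrN.
Qed.

Lemma mtauN_measurable b : measurable_fun setT (mtauN b).
Proof.
apply: continuous_measurable_fun; rewrite /mtauN; case: b; last exact: mtau_continuous.
by move=> t; apply: (@continuous_comp _ _ _ -%R (mtau p q)); [exact: opp_continuous|exact: mtau_continuous].
Qed.

(* The boundary function of the composition on the slice of [j]. *)
Definition bval j t : H := mix (j * i) (Phi (mtauN false t)) (Phi (mtauN true t)).

Hypothesis nt : {ae mu, forall t, forall k, ntlim (U k) (co k (Phi t)) t}.

Lemma bdry_f : {ae mu, forall t, bdry f i t = Phi t}.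
Proof.
apply: ae_imply nt => t ht.
rewrite /bdry; apply: cvg_lim; first exact: norm_hausdorff.
have := radial_lim ht; apply: cvg_trans; apply: near_eq_cvg.
by apply: nearW => r; rewrite qcisE.
Qed.

(** The limit exists where Phi has nontangential limits at both tau(t) and tau(-t); the exceptional
    t form null preimages because both maps are expansive. *)
Lemma bdry_icomp j : Sph j -> {ae mu, forall t, bdry g j t = bval j t}.
Proof.
move=> Sj; have d4 : 0 < da / 4 by rewrite divr_gt0.
have N b := ae_expansive d4 (mtauN_measurable b) (mtauN_expansive b) nt.
apply: (@filterS2 _ (almost_everywhere mu) (ae_filter_ringOfSetsType mu) _ _ _ _ (N false) (N true)) => t h1 h2.
rewrite /bdry; apply: cvg_lim; first exact: norm_hausdorff.
have L1 := mob_lim h1; have L2 := mob_lim h2.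
have L : mix (j * i) (G (r * cos t, r * sin t)) (G (r * cos (- t), r * sin (- t)))
    @[r --> 1^'-] --> bval j t.
  by apply: cvgD; apply: cvgZr; apply: cvg_qmul.
apply: cvg_trans L; apply: near_eq_cvg; near=> r; rewrite icomp_qcis//; apply/andP; split.
- by apply: ltW; near: r; apply: nbhs_left_gt.
- by near: r; exact: nbhs_left_lt.
Unshelve. all: by end_near. Qed.

End Composition.

(** * Mean oscillation under the change of variables *)

Section Oscillation.
Variable R : realType.
Local Notation H := (quat R).
Local Notation mu := (@lebesgue_measure R).
Local Notation T := (`[0, 2 * pi]%classic : set R).
Implicit Types (x y j d e c : H) (u v r s t : R) (w : R -> H).

Definition qmeas w := forall k, measurable_fun setT (co k \o w).

Lemma qmeasB w c : qmeas w -> qmeas (fun t => w t - c).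
Proof.
move=> mw k; rewrite (_ : co k \o _ = (fun t => (co k \o w) t - co k c)).
  by apply: measurable_funB => //; exact: measurable_cst.
by apply/funext => t; rewrite /= coD coN.
Qed.

Lemma qmeas_sqr w k : qmeas w -> measurable_fun setT (fun t => co k (w t) ^+ 2).
Proof. by move=> mw; apply: measurable_funX; exact: mw. Qed.

Lemma qmeas_qsqnorm w : qmeas w -> measurable_fun setT (fun t => qsqnorm (w t)).
Proof.
move=> mw; rewrite (_ : (fun t => _) = (fun t => \sum_(k < 4) co k (w t) ^+ 2)).
  by apply: measurable_sum => k; exact: qmeas_sqr.
by apply/funext => t; exact: qsqnorm_sum.
Qed.

Lemma qmeas_lmul w c : qmeas w -> qmeas (fun t => c * w t).
Proof.
move=> mw k; rewrite (_ : co k \o _ =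
    (fun t => \sum_(l < 4) co k (c * (delta_mx 0 l : H)) * co l (w t))).
  by apply: measurable_sum => l; apply: measurable_funM => //; exact: mw.
by apply/funext => t; rewrite /= coM.
Qed.

Lemma qmeas_mix w w' c : qmeas w -> qmeas w' -> qmeas (fun t => mix c (w t) (w' t)).
Proof.
move=> mw mw' k; rewrite (_ : co k \o _ = (fun t => 2^-1 * co k ((1 - c) * w t)
    + 2^-1 * co k ((1 + c) * w' t))); last first.
  by apply/funext => t; rewrite /= /mix coD !coZ.
by apply: measurable_funD; apply: measurable_funM;
  [exact: measurable_cst|exact: qmeas_lmul|exact: measurable_cst|exact: qmeas_lmul].
Qed.

Lemma integral_qsqnorm (D : set R) w : measurable D -> qmeas w ->
  (\int[mu]_(t in D) (qsqnorm (w t))%:E =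
   \sum_(k < 4) \int[mu]_(t in D) ((co k (w t)) ^+ 2)%:E)%E.
Proof.
move=> mD mw; rewrite -ge0_integral_sum//; last 2 first.
- by move=> k; apply/measurable_EFinP; apply: measurable_funTS; exact: qmeas_sqr.
- by move=> k t _; rewrite lee_fin sqr_ge0.
by apply: eq_integral => t _; rewrite qsqnorm_sum sumEFin.
Qed.

Lemma integral_mix_le (D : set R) w w' c : measurable D -> qmeas w -> qmeas w' ->
  qsqnorm c = 1 ->
  (\int[mu]_(t in D) (qsqnorm (mix c (w t) (w' t)))%:E <=
    2%:E * (\int[mu]_(t in D) (qsqnorm (w t))%:E + \int[mu]_(t in D) (qsqnorm (w' t))%:E))%E.
Proof.
move=> mD mw mw' c1.
have m0 w0 : qmeas w0 -> measurable_fun D (fun t => (qsqnorm (w0 t))%:E).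
  by move=> mw0; apply/measurable_EFinP; apply: measurable_funTS; exact: qmeas_qsqnorm.
rewrite -ge0_integralD//; try by [move=> t _; rewrite lee_fin qsqnorm_ge0|exact: m0].
rewrite -ge0_integralZl_EFin//; last 2 first.
- by move=> t _; rewrite -EFinD lee_fin addr_ge0 ?qsqnorm_ge0.
- by apply: emeasurable_funD; exact: m0.
apply: ge0_le_integral => //.
- by move=> t _; rewrite lee_fin qsqnorm_ge0.
- by apply: m0; exact: qmeas_mix.
- by apply: measurable_funeM; apply: emeasurable_funD; exact: m0.
- by move=> t _; rewrite -EFinD -EFinM lee_fin; exact: qsqnorm_mix.
Qed.

(** The formula of [bmean] for an arbitrary function, so that boundary values can be replaced by a
    measurable representative. *)
Definition qmean w (al be : R) : H :=
  (be - al)^-1 *: (\row_(k < 4) \int[mu]_(t in `]al, be[) (w t ord0 k) : H).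

(** Oscillation may thus be estimated about any convenient constant, in particular one carried over
    from the image interval. *)
Lemma qmean_min w c (al be : R) : al < be -> qmeas w ->
  (\int[mu]_(t in `]al, be[) (qsqnorm (w t - qmean w al be))%:E
    <= \int[mu]_(t in `]al, be[) (qsqnorm (w t - c))%:E)%E.
Proof.
move=> ab mw; rewrite !integral_qsqnorm//; try exact: qmeasB.
apply: lee_sum => k _.
have -> : (fun t => (co k (w t - qmean w al be) ^+ 2)%:E) = (fun t => (((co k \o w) t
    - (be - al)^-1 * \int[mu]_(s in `]al, be[) (co k \o w) s) ^+ 2)%:E).
  apply/funext => t; rewrite /= coD coN /qmean coZ; congr ((_ - _ * _) ^+ 2)%:E.
  by rewrite /co mxE.
have -> : (fun t => (co k (w t - c) ^+ 2)%:E) = (fun t => (((co k \o w) t - co k c) ^+ 2)%:E).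
  by apply/funext => t; rewrite /= coD coN.
exact: mean_min ab (mw k) (co k c).
Qed.

Section transfer.
Variables (p q : R) (Phi : R -> H) (C : R).
Hypothesis pq : p ^+ 2 + q ^+ 2 < 1.
Hypothesis mPhi : qmeas Phi.
Hypothesis C0 : 0 <= C.
Hypothesis osc : forall al be : R, al < be -> be - al <= 2 * pi -> exists c,
  (\int[mu]_(t in `]al, be[) (qsqnorm (Phi t - c))%:E <= (C * (be - al))%:E)%E.
Let da : R := 1 - p ^+ 2 - q ^+ 2.
Let da0 : 0 < da. Proof. by rewrite /da; have := pq; lra. Qed.

Lemma qmeas_mtauN b : qmeas (fun t => Phi (mtauN p q b t)).
Proof.
by move=> k; exact: (measurableT_comp (mPhi k) (mtauN_measurable pq b)).
Qed.

(** The constant c is one for the image interval (A, B). One factor 4 / da is the density bound of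
    the expansive map, the other bounds the length B - A. *)
Lemma mtau_osc (b : bool) (al be : R) : al < be -> be - al <= 2 * pi -> exists c,
  (\int[mu]_(t in `]al, be[) (qsqnorm (Phi (mtauN p q b t) - c))%:E
    <= ((4 / da) ^+ 2 * C * (be - al))%:E)%E.
Proof.
move=> ab ab2.
have mono r s : r < s -> mtau p q r < mtau p q s.
  move=> rs; have /andP[h _] := mtau_MVT pq (ltW rs).
  have : 0 < da / 4 * (s - r) by rewrite mulr_gt0 ?divr_gt0// subr_gt0.
  by rewrite /da; lra.
pose a1 : R := if b then - be else al; pose b1 : R := if b then - al else be.
have ab1 : a1 < b1 by rewrite /a1 /b1; case: (b); lra.
have abE : b1 - a1 = be - al by rewrite /a1 /b1; case: (b); lra.
pose A := mtau p q a1; pose B := mtau p q b1.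
have AB : A < B by exact: mono.
have ABlen : B - A <= 4 / da * (be - al).
  by have /andP[_] := mtau_MVT pq (ltW ab1); rewrite abE.
(* Monotonicity gives tau(b1) <= tau(a1 + 2 pi) = tau(a1) + 2 pi. *)
have AB2 : B - A <= 2 * pi.
  have : b1 <= a1 + 2 * pi by lra.
  rewrite le_eqVlt => /predU1P[E|/mono].
    by rewrite /A /B E mtau_period; lra.
  by rewrite mtau_period /A /B; lra.
have [c hc] := osc AB AB2; exists c.
have sub : `]al, be[%classic `<=` mtauN p q b @^-1` `]A, B[%classic.
  move=> t /=; rewrite !in_itv/= => /andP[t1 t2].
  rewrite /mtauN /A /B /a1 /b1; case: (b); apply/andP; split; apply: mono; lra.
have mh : measurable_fun setT (fun t => (qsqnorm (Phi t - c))%:E).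
  by apply/measurable_EFinP; apply: qmeas_qsqnorm; exact: qmeasB.
have h0 t : (0 <= (qsqnorm (Phi t - c))%:E)%E by rewrite lee_fin qsqnorm_ge0.
have d4 : 0 < da / 4 by rewrite divr_gt0.
have E := expansive_integral d4 (mtauN_measurable pq b) (mtauN_expansive pq b)
  (measurable_itv `]A, B[) mh h0.
apply: (@le_trans _ _ (\int[mu]_(t in mtauN p q b @^-1` `]A, B[%classic)
    (qsqnorm (Phi (mtauN p q b t) - c))%:E)%E).
  apply: ge0_subset_integral => //.
  - by rewrite -[X in measurable X]setTI; exact: mtauN_measurable.
  - apply/measurable_EFinP; apply: measurable_funTS.
    by apply: qmeas_qsqnorm; apply: qmeasB; exact: qmeas_mtauN.
apply: (le_trans E); apply: (@le_trans _ _ ((da / 4)^-1%:E * (C * (B - A))%:E)%E).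
  by apply: lee_wpmul2l => //; rewrite lee_fin invr_ge0 ltW.
rewrite -EFinM lee_fin invf_div.
have h4 : 0 <= 4 / da by rewrite divr_ge0// ltW.
have := ler_wpM2l (mulr_ge0 h4 C0) ABlen; rewrite -mulrA => /le_trans; apply.
by rewrite le_eqVlt; apply/orP; left; apply/eqP; ring.
Qed.

(** The mixture of the constants for the two image intervals is compared with the mean;
    [integral_mix_le] gives a factor 2 and the two summands another 2. *)
Lemma bval_osc i j (al be : R) : Sph i -> Sph j -> al < be -> be - al <= 2 * pi ->
  (\int[mu]_(t in `]al, be[) (qsqnorm (bval i p q Phi j t - qmean (bval i p q Phi j) al be))%:E
    <= (4 * ((4 / da) ^+ 2 * C) * (be - al))%:E)%E.
Proof.
move=> Si Sj ab ab2; set psi := bval i p q Phi j; have ji : qsqnorm (j * i) = 1 by rewrite qsqnormM !Sph_qsqnorm// mulr1.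
have [c1 h1] := mtau_osc false ab ab2; have [c2 h2] := mtau_osc true ab ab2.
have mpsi : qmeas psi by apply: qmeas_mix; exact: qmeas_mtauN.
apply: (le_trans (qmean_min (mix (j * i) c1 c2) ab mpsi)).
under eq_integral do rewrite /psi /bval -mixB.
apply: (le_trans (integral_mix_le _ _ _ ji)) => //; try (apply: qmeasB; exact: qmeas_mtauN).
apply: (le_trans (lee_wpmul2l _ (leeD h1 h2))); first by rewrite lee_fin.
by rewrite -EFinD -EFinM lee_fin le_eqVlt; apply/orP; left; apply/eqP; ring.
Qed.

End transfer.
End Oscillation.

(** * Uniform bounds over all slices *)

Section MainEstimates.
Variable R : realType.
Local Notation H := (quat R).
Local Notation mu := (@lebesgue_measure R).
Local Notation T := (`[0, 2 * pi]%classic : set R).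
Implicit Types (x y j d c : H) (u v r s t : R) (e : bool).
Variables (i : H) (f : H -> H).
Hypothesis Si : Sph i.
Hypothesis Hf : Hardy2 f.

Let F (z : R * R) : H := f (slice i z.1 z.2).
Let U k : R * R -> R := co k \o F.
Let Sf : SHL f. Proof. by case: Hf. Qed.

Lemma Hardy2_boundary : exists (M : R) (Phi : R -> H), forall k,
  [/\ measurable_fun setT (co k \o Phi), forall t, co k (Phi (t + 2 * pi)) = co k (Phi t),
  (\int[mu]_(t in T) ((co k (Phi t)) ^+ 2)%:E <= M%:E)%E,
  mu.-integrable T (EFin \o (co k \o Phi)) &
  forall u v, u ^+ 2 + v ^+ 2 < 1 ->
    \int[mu]_(t in T) (Pk u v (cos t) (sin t) * co k (Phi t)) = U k (u, v) * (2 * pi)].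
Proof.
have [M hM] := Hardy2_mean2 Si Sf Hf.
have B k := boundary_function (@SHL_continuous R i f Si Sf k)
  (@SHL_poisson R i f Si Sf k) (hM k).
have [phi hphi] := choice B; exists M, (fun t => \row_k phi k t) => k.
have E : co k \o (fun t => (\row_l phi l t : H)) = phi k.
  by apply/funext => t; rewrite /co /= mxE.
have E' t : co k (\row_l phi l t : H) = phi k t by rewrite /co mxE.
have [h1 h2 h3 h4 h5] := hphi k.
rewrite E; split => //.
- by move=> t; rewrite !E'.
- by under eq_integral do rewrite E'.
- by move=> u v uv; rewrite -h5//; apply: eq_Rintegral => t _; rewrite E'.
Qed.

Variables p q : R.
Hypothesis pq : p ^+ 2 + q ^+ 2 < 1.

Let G (z : R * R) : H := F (mob_x p q z, mob_y p q z).
Let g : H -> H := icomp i f (moebius i (slice i p q)).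
Let da : R := 1 - p ^+ 2 - q ^+ 2.

Let z (e : bool) r t : R * R := (r * cos t, r * sin ((-1) ^+ e * t)).

Let qmeas_G e r : 0 <= r < 1 -> qmeas (fun t => G (z e r t)).
Proof.
move=> r01 k; apply: continuous_measurable_fun.
have cG u v : u ^+ 2 + v ^+ 2 < 1 -> {for (u, v), continuous (co k \o G)}.
  by move=> uv; have [d hd] := hgrad_moebius Si Sf pq uv; exact: hasgrad_continuous (hd k).
have c := circ_continuous cG r01.
move=> t; apply: (@cvg_trans _ (circ (co k \o G) r ((-1) ^+ e * s) @[s --> t])).
  apply: near_eq_cvg; apply: nearW => s; rewrite /circ /z /=.
  by case: e => //=; rewrite ?expr1 ?expr0 ?mulN1r ?mul1r ?cosN.
have -> : (co k \o (fun t => G (z e r t))) t = circ (co k \o G) r ((-1) ^+ e * t).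
  by rewrite /circ /z /=; case: e => //=; rewrite ?expr1 ?expr0 ?mulN1r ?mul1r ?cosN.
apply: (@continuous_comp _ _ _ (fun s => (-1) ^+ e * s) (circ (co k \o G) r)); last exact: c.
exact: mulrl_continuous.
Qed.

(** The bound depends neither on j nor on r: the four components at z and at its conjugate are each
    controlled by [moebius_hardy]. *)
Lemma sqmean_icomp : exists B : R, forall j r, Sph j -> 0 <= r < 1 -> (sqmean g j r <= B%:E)%E.
Proof.
have [M [Phi hPhi]] := Hardy2_boundary.
exists ((2 * pi)^-1 * (2 * (4 / da * M *+ 4 + 4 / da * M *+ 4))) => j r Sj r01.
rewrite EFinM; apply: lee_wpmul2l; first by rewrite lee_fin invr_ge0 ltW// pi2_gt0.
have ji : qsqnorm (j * i) = 1 by rewrite qsqnormM !Sph_qsqnorm// mulr1.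
rewrite (_ : integral _ _ _ = (\int[mu]_(t in T)
    (qsqnorm (mix (j * i) (G (z false r t)) (G (z true r t))))%:E)%E); last first.
  apply: eq_integral => t _; rewrite qnorm_sqr /g icomp_qcis//.
  by rewrite /z expr0 expr1 mul1r mulN1r cosN.
have bd e : (\int[mu]_(t in T) (qsqnorm (G (z e r t)))%:E <= (4 / da * M *+ 4)%:E)%E.
  rewrite integral_qsqnorm//; last exact: qmeas_G.
  rewrite (_ : (_ *+ 4)%:E = (\sum_(k < 4) (4 / da * M)%:E)%E); last first.
    by rewrite sumEFin sumr_const card_ord.
  apply: lee_sum => k _; have [h1 _ h3 h4 h5] := hPhi k.
  exact: (moebius_hardy (@SHL_continuous R i f Si Sf k) h1 h4 h3 h5 e pq r01).
apply: (le_trans (integral_mix_le _ (qmeas_G false r01) (qmeas_G true r01) ji)) => //.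
apply: (le_trans (lee_wpmul2l _ (leeD (bd false) (bd true)))); first by rewrite lee_fin.
by rewrite -EFinD -EFinM.
Qed.

Lemma icomp_Hardy2 : Hardy2 g.
Proof.
split; first exact: icomp_SHL.
have [B hB] := sqmean_icomp.
apply: (@le_lt_trans _ _ (maxe B%:E 0)); last by rewrite gt_max ltry lt0y.
apply: ge_ereal_sup => _ [j Sj <-]; rewrite le_max.
(* A divergent limit has the default value 0, covered by the maximum with 0. *)
have [c|/dvgP ->] := pselect (cvg (sqmean g j r @[r --> 1^'-])); last by rewrite lexx orbT.
apply/orP; left; apply: lime_le => //; near=> r; apply: hB => //; apply/andP; split.
- by apply: ltW; near: r; apply: nbhs_left_gt.
- by near: r; exact: nbhs_left_lt.
Unshelve. all: by end_near. Qed.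

(** The slice oscillation of f passes to the measurable representative Phi, with the mean of the
    radial limits as constant. *)
Lemma bmo_osc (Phi : R -> H) : qmeas Phi -> {ae mu, forall t, bdry f i t = Phi t} ->
  (bmo_norm f < +oo)%E -> exists2 C : R, 0 <= C &
  forall al be : R, al < be -> be - al <= 2 * pi -> exists c,
    (\int[mu]_(t in `]al, be[) (qsqnorm (Phi t - c))%:E <= (C * (be - al))%:E)%E.
Proof.
move=> mPhi aePhi fin.
pose S : \bar R := ereal_sup [set bosc f i I.1 I.2 |
    I in [set I : R * R | I.1 < I.2 /\ I.2 - I.1 <= 2 * pi]].
have Sfin : (sqrte S < +oo)%E.
  by apply: le_lt_trans fin; apply: ereal_sup_ubound; exists i.
have [C C0 SC] : exists2 C : R, 0 <= C & (S <= C%:E)%E.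
  (* A finite square root excludes +oo; negative values and -oo are replaced by 0. *)
  move: Sfin; case: S => [s _| |_]; last by exists 0 => //; exact: leNye.
  - by exists (Num.max s 0); rewrite ?lee_fin le_max lexx ?orbT.
  - by rewrite /= ltxx.
exists C => // al be ab ab2; exists (bmean f i al be).
have hb : (bosc f i al be <= C%:E)%E.
  by apply: le_trans SC; apply: ereal_sup_ubound; exists (al, be).
have L0 : 0 < be - al by rewrite subr_gt0.
move: hb; rewrite /bosc lee_pdivrMl// -EFinM mulrC; apply: le_trans.
apply: ae_integral_ge => //.
- by apply/measurable_EFinP; apply: measurable_funTS; apply: qmeas_qsqnorm; exact: qmeasB.
- by move=> t; rewrite lee_fin qsqnorm_ge0.
- by move=> t; rewrite lee_fin sqr_ge0.
- apply: ae_imply aePhi => t -> _.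
  by rewrite qnorm_sqr.
Qed.

(** Almost everywhere equality with [bval] identifies the means and dominates the integrals, so
    [bval_osc] yields one bound for all slices and intervals. *)
Lemma bosc_icomp : (bmo_norm f < +oo)%E -> exists2 K : R, 0 <= K &
  forall j (al be : R), Sph j -> al < be -> be - al <= 2 * pi -> (bosc g j al be <= K%:E)%E.
Proof.
move=> fin; have [M [Phi hPhi]] := Hardy2_boundary.
have mPhi : qmeas Phi by move=> k; have [] := hPhi k.
have nt : {ae mu, forall t, forall k, ntlim (U k) (co k (Phi t)) t}.
  have ntk k : {ae mu, forall t, ntlim (U k) (co k (Phi t)) t}.
    by have [h1 h2 h3 h4 h5] := hPhi k; exact: (ae_ntlim h1 h2 h4 h5).
  (* The four components are indexed by natural numbers through [inord], to use the countable form
     of the almost everywhere quantifier. *)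
  have := ae_foralln (fun n => ntk (inord n)).
  by apply: ae_imply => t h k;
    have := h k; rewrite inord_val.
have [C C0 osc] := bmo_osc mPhi (bdry_f nt) fin.
exists (4 * ((4 / da) ^+ 2 * C)); first by apply: mulr_ge0 => //; apply: mulr_ge0 => //; exact: sqr_ge0.
move=> j al be Sj ab ab2; set psi := bval i p q Phi j.
have L0 : 0 < be - al by rewrite subr_gt0.
have mpsi : qmeas psi by apply: qmeas_mix; exact: qmeas_mtauN.
have aepsi := bdry_icomp Si pq nt Sj; rewrite -/g -/psi in aepsi.
have mE : bmean g j al be = qmean psi al be.
  rewrite /bmean /qmean; congr (_ *: _); apply/rowP => k; rewrite !mxE.
  apply: ae_Rintegral_eq => //; first by apply: measurable_funTS; exact: (mpsi k).
  by apply: ae_imply aepsi => t -> _.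
rewrite /bosc lee_pdivrMl// -EFinM mulrC mE.
apply: le_trans (bval_osc pq mPhi C0 osc Si Sj ab ab2).
apply: ae_integral_le => //.
- by apply/measurable_EFinP; apply: measurable_funTS; apply: qmeas_qsqnorm; exact: qmeasB.
- by move=> t; rewrite lee_fin sqr_ge0.
- by move=> t; rewrite lee_fin qsqnorm_ge0.
- apply: ae_imply aepsi => t -> _.
  by rewrite qnorm_sqr.
Qed.

Lemma icomp_bmo_norm : (bmo_norm f < +oo)%E -> (bmo_norm g < +oo)%E.
Proof.
move=> /bosc_icomp[K K0 hK]; apply: (@le_lt_trans _ _ (sqrte K%:E)); last exact: ltry.
apply: ge_ereal_sup => _ [j Sj <-]; rewrite /bmo_slice lee_sqrt ?lee_fin//.
by apply: ge_ereal_sup => _ [[al be] /= [ab ab2] <-]; exact: hK.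
Qed.

End MainEstimates.

Theorem proposition4p10 (R : realType) (i a : quat R) (f : quat R -> quat R) :
  Sph i -> Di i a -> BMOSH f -> BMOSH (icomp i f (moebius i a)).
Proof.
move=> Si Da [Hf bf]; have [p [q [-> pq]]] := slice_inj_Ci Da Si.
by split; [exact: icomp_Hardy2|exact: icomp_bmo_norm].
Qed.
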